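(* Let $G$ be an edge-independent random graph on $[n]$ with Laplacian $L$, expected Laplacian $\bar L$ and minimum expected degree $\delta=\min_{1\le i\le n}\sum_{j=1}^n p_{ij}$. Let $g(n)$ be an arbitrarily slowly growing function (i.e. $g(n)\to\infty$), let $$\Lambda=\{\lambda_i(\bar L):\ |1-\lambda_i(\bar L)|\ge 1/(g(n)\sqrt{\ln n})\}$$ (a multiset, eigenvalues counted with multiplicity), and let $k=|\Lambda|$. If $\delta\gg\max\{k,\ln^4 n\}$, then almost surely $$|\lambda_i(L)-\lambda_i(\bar L)|\le\left(2+\sqrt{\sum_{\lambda\in\Lambda}(1-\lambda)^2}+o(1)\right)\frac{1}{\sqrt{\delta}}\qquad\text{for each }1\le i\le n.$$
   Context: Edge-independent random graph: for each $n$ we are given numbers $p_{ij}=p_{ji}\in[0,1]$ ($1\le i,j\le n$), not assumed equal and allowed to depend on $n$. The random graph $G$ has vertex set $[n]=\{1,\dots,n\}$, and each pair $\{i,j\}$, $i\le j$, is an edge with probability $p_{ij}$, independently of all other pairs; $X_{ij}=X_{ji}$ is the indicator of $\{i,j\}$ being an edge (the case $i=j$ is a loop). $A=(X_{ij})$ is the adjacency matrix and $\bar A=\mathrm{E}(A)=(p_{ij})$. The degree of $i$ is $d_i=\sum_{j=1}^n X_{ij}$ and its expected degree is $t_i=\sum_{j=1}^n p_{ij}$; $D$ and $T$ are the diagonal matrices with $D_{ii}=d_i$, $T_{ii}=t_i$. The normalized Laplacian is $L=I-D^{-1/2}AD^{-1/2}$ (with $(D^{-1/2})_{ii}=0$ if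 $d_i=0$), and the expected Laplacian is $\bar L=I-T^{-1/2}\bar A T^{-1/2}$. For an $n\times n$ symmetric matrix $M$, $\lambda_1(M)\le\dots\le\lambda_n(M)$ are its eigenvalues in non-decreasing order, with multiplicity. All quantities depend on $n$ and asymptotics are as $n\to\infty$: $f\gg h$ means $f(n)/h(n)\to\infty$, $o(1)$ is a deterministic quantity tending to $0$ (uniform in $i$), and ''almost surely'' means with probability tending to $1$ as $n\to\infty$. *)

(* Defs.v *)
From mathcomp Require Import all_boot all_order all_algebra.
From mathcomp Require Import spectral complex.
From mathcomp Require Import boolp classical_sets filter reals topology normedtype exp.

Set Implicit Arguments.
Unset Strict Implicit.
Unset Printing Implicit Defensive.

Import Order.TTheory GRing.Theory Num.Theory.
Import numFieldNormedType.Exports.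
Local Open Scope ring_scope.

(* The eigenvalues of M in non-decreasing order, repeated according to
   multiplicity.  The list is determined by the condition below and exists for
   every symmetric M (eigvalsP); for a matrix whose characteristic polynomial
   does not split over R it is the junk value [::]. *)
Definition eigvals (R : realType) (n : nat) (M : 'M[R]_n) : seq R :=
  xget [::] [set s : seq R |
    sorted <=%R s /\ char_poly M = \prod_(x <- s) ('X - x%:P)]%classic.

(* lambda M i is the eigenvalue usually written \lambda_(i+1)(M), as 'I_n is
   numbered from 0. *)
Definition lambda (R : realType) (n : nat) (M : 'M[R]_n) (i : 'I_n) : R :=
  nth 0 (eigvals M) i.

Definition degree (R : realType) (n : nat) (M : 'M[R]_n) (i : 'I_n) : R :=
  \sum_j M i j.

(* 0^-1 = 0, so the entries for vertices of degree 0 vanish. *)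
Definition inv_sqrt_degree (R : realType) (n : nat) (M : 'M[R]_n) : 'M[R]_n :=
  diag_mx (\row_i (Num.sqrt (degree M i))^-1).

(* Applied to the adjacency matrix this is the Laplacian L, and applied to the
   matrix of edge probabilities it is the expected Laplacian. *)
Definition laplacian (R : realType) (n : nat) (M : 'M[R]_n) : 'M[R]_n :=
  1%:M - inv_sqrt_degree M *m M *m inv_sqrt_degree M.

(* Degrees are at most n when the entries of M are in [0, 1], so that the
   default value n%:R does not affect the minimum for n > 0 (min_degreeP). *)
Definition min_degree (R : realType) (n : nat) (M : 'M[R]_n) : R :=
  \big[Order.min/n%:R]_(i < n) degree M i.

(* The unordered pair {i, j}, possibly with i = j, is represented by (i, j)
   with i <= j, and a graph on 'I_n by its edge set, a subset of slots n. *)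
Definition slots (n : nat) : {set 'I_n * 'I_n} :=
  [set e : 'I_n * 'I_n | (e.1 <= e.2)%N].

Definition adjacency (R : realType) (n : nat) (E : {set 'I_n * 'I_n}) :
    'M[R]_n :=
  \matrix_(i, j) (((i, j) \in E) || ((j, i) \in E))%:R.

(* The law of the random graph: pairs are edges independently of each other,
   the pair {i, j} with probability P i j. *)
Definition graph_weight (R : realType) (n : nat) (P : 'M[R]_n)
    (E : {set 'I_n * 'I_n}) : R :=
  \prod_(e in slots n) (if e \in E then P e.1 e.2 else 1 - P e.1 e.2).

Definition graph_prob (R : realType) (n : nat) (P : 'M[R]_n)
    (event : pred {set 'I_n * 'I_n}) : R :=
  \sum_(E in powerset (slots n) | event E) graph_weight P E.

Definition far_eigvals (R : realType) (n : nat) (M : 'M[R]_n) (c : R) : seq R :=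
  [seq x <- eigvals M | c <= `|1 - x|].

Lemma char_poly_conj (F : fieldType) n (P A : 'M[F]_n) :
  P \in unitmx -> char_poly (invmx P *m A *m P) = char_poly A.
Proof.
move=> uP; rewrite /char_poly.
have -> : char_poly_mx (invmx P *m A *m P) =
    map_mx polyC (invmx P) *m char_poly_mx A *m map_mx polyC P.
  rewrite /char_poly_mx mulmxBr mulmxBl -!map_mxM; congr (_ - _).
  by rewrite scalar_mxC -mulmxA -map_mxM mulVmx // map_mx1 mulmx1.
rewrite !det_mulmx mulrC mulrA -det_mulmx -map_mxM mulmxV // map_mx1 det1.
by rewrite mul1r.
Qed.

Lemma eigvalsP (R : realType) (n : nat) (M : 'M[R]_n) : M^T = M ->
  [/\ sorted <=%R (eigvals M), size (eigvals M) = n &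
      char_poly M = \prod_(x <- eigvals M) ('X - x%:P)].
Proof.
move=> symM.
have [] : sorted <=%R (eigvals M) /\
    char_poly M = \prod_(x <- eigvals M) ('X - x%:P).
  suff : exists s : seq R,
      sorted <=%R s /\ char_poly M = \prod_(x <- s) ('X - x%:P).
    exact: (@xgetPex _ [::] (fun s : seq R =>
      sorted <=%R s /\ char_poly M = \prod_(x <- s) ('X - x%:P))).
  pose f : {rmorphism R -> R[i]} := real_complex R.
  pose A := map_mx f M.
  have hA : A \is hermsymmx.
    apply: realsym_hermsym.
      apply/is_hermitianmxP; rewrite expr0 scale1r; apply/matrixP => i j.
      by rewrite !mxE -[M in LHS]symM mxE.
    apply/mxOverP => i j; by rewrite mxE complex_real.
  have /orthomx_spectralP eA := hermitian_normalmx hA.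
  have dR := hermitian_spectral_diag_real hA.
  pose d i : R := complex.Re (spectral_diag A 0 i).
  have dE i : spectral_diag A 0 i = f (d i).
    by rewrite [RHS](RRe_real (mxOverP dR 0 i)).
  exists (sort <=%R [seq d i | i <- enum 'I_n]).
  split; first exact: (sort_sorted le_total).
  apply: (map_poly_inj f); rewrite map_char_poly -/A eA char_poly_conj ?spectral_unit //.
  rewrite char_poly_trig ?diag_mx_is_trig // rmorph_prod.
  rewrite (perm_big _ (permEl (perm_sort _ _))) big_map big_enum /=.
  by apply: eq_bigr => i _; rewrite !mxE eqxx mulr1n dE map_polyXsubC.
move=> sM eM; split=> //.
have := size_char_poly M; rewrite eM size_prod_XsubC.
by case.
Qed.

Lemma laplacian_sym (R : realType) (n : nat) (M : 'M[R]_n) :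
  M^T = M -> (laplacian M)^T = laplacian M.
Proof.
move=> symM; rewrite /laplacian linearB /= trmx1 !trmx_mul symM.
by rewrite !tr_diag_mx mulmxA.
Qed.

Lemma adjacency_sym (R : realType) (n : nat) (E : {set 'I_n * 'I_n}) :
  (adjacency R E)^T = adjacency R E.
Proof. by apply/matrixP => i j; rewrite !mxE orbC. Qed.

Lemma min_degreeP (R : realType) (n : nat) (M : 'M[R]_n) : (0 < n)%N ->
  (forall i j, 0 <= M i j <= 1) ->
  (forall i, min_degree M <= degree M i) /\
  (exists i, min_degree M = degree M i).
Proof.
move=> n0 M01; have le_min i : min_degree M <= degree M i.
  by rewrite /min_degree (bigD1 i) //= ge_min lexx.
split=> //; have degn i : degree M i <= n%:R.
  rewrite -[n in n%:R]card_ord -sumr_const; apply: ler_sum => j _.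
  by have /andP[] := M01 i j.
have : min_degree M = n%:R \/ exists i, min_degree M = degree M i.
  rewrite /min_degree; apply: (big_ind (fun x => x = n%:R \/ exists i, x = degree M i)).
  - by left.
  - by move=> x y Px Py; rewrite minElt; case: ifP.
  - by move=> i _; right; exists i.
case=> // mn; exists (Ordinal n0).
by apply/eqP; rewrite eq_le le_min mn degn.
Qed.

(* Mutual independence of the edges, with the prescribed marginals. *)
Lemma graph_prob_sub (R : realType) (n : nat) (P : 'M[R]_n)
    (S : {set 'I_n * 'I_n}) : S \subset slots n ->
  graph_prob P (fun E => S \subset E) = \prod_(e in S) P e.1 e.2.
Proof.
move=> /fintype.subsetP sS.
pose F e : R := if e \in slots n then P e.1 e.2 else 0.
pose G e : R :=
  if e \in slots n then (if e \in S then 0 else 1 - P e.1 e.2) else 1.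
transitivity (\prod_e (F e + G e)); last first.
  rewrite [RHS]big_mkcond; apply: eq_bigr => e _; rewrite /F /G.
  have := sS e; case: (e \in S) => [->//|_]; first by rewrite addr0.
  by case: ifP => _; rewrite ?add0r // addrC subrK.
rewrite bigA_distr /graph_prob.
rewrite [LHS]big_mkcond [RHS]big_mkcond; apply: eq_bigr => E _ /=.
rewrite powersetE.
case: (boolP (E \subset slots n)) =>
  [/fintype.subsetP sE | /fintype.subsetPn[e eE eU]] /=; last first.
  by rewrite (bigD1 e) //= eE /F (negPf eU) mul0r.
case: (boolP (S \subset E)) =>
  [/fintype.subsetP SE | /fintype.subsetPn[e eS eE]]; last first.
  by rewrite (bigD1 e) //= (negPf eE) /G sS // eS mul0r.
rewrite /graph_weight big_mkcond; apply: eq_bigr => e _ /=; rewrite /F /G.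
case: (boolP (e \in E)) => [/sE-> // | eE].
by case: ifP => // _; case: ifP => // /SE; rewrite (negPf eE).
Qed.

Lemma graph_prob_predT (R : realType) (n : nat) (P : 'M[R]_n) :
  graph_prob P predT = 1.
Proof.
rewrite -(@finset.big_set0 R 1 *%R _ (fun e : 'I_n * 'I_n => P e.1 e.2)).
rewrite -graph_prob_sub ?finset.sub0set //.
by apply: eq_bigl => E; rewrite finset.sub0set.
Qed.

(* Main.v *)
Require Import Defs.
From mathcomp Require Import all_boot all_order all_algebra all_fingroup.
From mathcomp Require Import ring lra zify.
From mathcomp Require Import boolp classical_sets filter reals topology normedtype.
From mathcomp Require Import sequences exp.

Set Implicit Arguments.
Unset Strict Implicit.
Unset Printing Implicit Defensive.

Import Order.TTheory GRing.Theory Num.Theory.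
Import numFieldNormedType.Exports.
Local Open Scope ring_scope.

(** Write [t i] for the expected degrees, [N] for the matrix with entries
    [p i j / sqrt (t i * t j)], so that [1 - N] is the expected Laplacian, and [H] for
    the centred adjacency matrix normalized in the same way.  The Laplacian of the
    random graph is [1 - theta (N + H) theta], where the diagonal matrix [theta]
    replaces the expected degrees by the actual ones.  By Weyl's inequality ([weyl])
    it suffices to compare quadratic forms, and the error has two parts of the order
    of [delta ^ (-1/2)]: the norm of [H], responsible for the [2], and the effect of
    [theta] on [N], responsible for the sum over [Lambda].

    Degrees ([laplacian_perturbation]).  If [r] is the diagonal matrix of the relative
    deviations of the degrees, then [theta] is about [1 - r / 2].  By Chernoff's bound
    all entries of [r] are [O(sqrt (ln n / delta))].  On the eigenspaces of [N] with
    eigenvalue below [1 / (g sqrt (ln n))] in absolute value the effect of [theta] is therefore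
    [O(1 / (g sqrt delta))], which is negligible.  On the other eigenspaces it is at
    most the Hilbert-Schmidt norm of the restriction of [N r].  The square of that
    norm is a weighted sum of the squares of the entries of [r], with weights that add
    up to the sum over [Lambda], so its mean is at most this sum divided by [delta].
    It concentrates around its mean because it is a quadratic form in independent
    centred variables ([expect_noise_form_sqr], [weighted_square_prob]); here
    [delta >> k] is used.

    Noise ([nb_norm_bound]).  The norm of [sqrt delta * H] is shown to be at most
    [2 + o(1)] under the sole assumption [delta >> ln ^ 4 n].  The rows of this matrix
    have variance at most [1] and its entries are at most [delta ^ (-1/2)].  Instead of
    traces of powers of [H], whose closed walks are hard to count at this degree, one
    counts non-backtracking walks.  By the Ihara-Bass formula a matrix [h] lifts to an
    operator on directed edges.  The pencil [ihara_pencil s], about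
    [1 + v / s ^ 2 - h / s] with [v] the row sums of squares, has a kernel only if [s]
    is an eigenvalue of that operator, hence only if the sum of squares of its powers,
    [nb_energy], grows like [s ^ (2 l)] ([nb_growth]).  The pencil is positive for
    large [s] and depends continuously on [s]; so it is positive for all [s > 1 + e] if
    the energy is too small for [1 + e] ([pencil_psd]).  Positivity at [s = 1 + e]
    says that [h <= s + v / s], which is [2 + O(e)] because the row sums [v] are at
    most [1 + e].

    Energy ([expect_nb_energy]).  The expected energy is a sum over closed walks of
    length [2 m], with [m] of order [ln n], that backtrack only once, in the middle.
    Because the noise is centred, only the walks that use every edge at least twice
    contribute.  Steps of such a walk are divided into those that discover a vertex,
    those whose target is determined by the first visit to the current vertex, and the
    remaining, free ones.  A vertex that is visited only twice is left the second time
    along one of the edges used the first time ([visits_or_forced]), and so the number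
    of free steps is at most four times the number of new steps by which the walk
    falls short of [m], plus three ([free_step_bound]).  Each free step has at most
    [2 m] targets but brings a factor [kappa], the square root of the bound on the
    entries, so free steps hardly matter if [m * kappa] is small; since [kappa] is
    [delta ^ (-1/4)], this is the assumption [delta >> ln ^ 4 n].  The new steps have
    total weight at most [1] and the determined ones are unique, but no determined
    step can follow a new step, and this keeps the growth rate of the total weight
    near [1] ([potential_step]).

    The resulting bound on the failure probability for fixed [n] is
    [laplacian_failure_prob]. *)

(** * Expectation over the random edge set *)

Definition expect (R : realType) n (P : 'M[R]_n)
    (F : {set 'I_n * 'I_n} -> R) : R :=
  \sum_(E in powerset (slots n)) graph_weight P E * F E.

Definition slot n (i j : 'I_n) : 'I_n * 'I_n :=
  if (i <= j)%N then (i, j) else (j, i).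

Definition noise (R : realType) n (P : 'M[R]_n) (E : {set 'I_n * 'I_n})
    (e : 'I_n * 'I_n) : R := (e \in E)%:R - P e.1 e.2.

Definition edge_var (R : realType) n (P : 'M[R]_n) (e : 'I_n * 'I_n) : R :=
  P e.1 e.2 * (1 - P e.1 e.2).

Section Expectation.
Variables (R : realType) (n : nat) (P : 'M[R]_n).
Hypothesis P01 : forall i j, 0 <= P i j <= 1.
Implicit Types (E : {set 'I_n * 'I_n}) (e : 'I_n * 'I_n).

Lemma graph_weight_ge0 E : 0 <= graph_weight P E.
Proof.
apply: prodr_ge0 => e _; have /andP[p0 p1] := P01 e.1 e.2.
by case: ifP; rewrite ?subr_ge0.
Qed.

Lemma expectD F G : expect P (fun E => F E + G E) = expect P F + expect P G.
Proof. by rewrite -big_split; apply: eq_bigr => E _; rewrite mulrDr. Qed.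

Lemma expectZ c F : expect P (fun E => c * F E) = c * expect P F.
Proof. by rewrite /expect big_distrr; apply: eq_bigr => E _; rewrite /= mulrCA. Qed.

Lemma expect_sum (I : Type) (r : seq I) (Q : pred I) F :
  expect P (fun E => \sum_(i <- r | Q i) F i E) =
  \sum_(i <- r | Q i) expect P (F i).
Proof.
by rewrite exchange_big; apply: eq_bigr => E _; rewrite big_distrr.
Qed.

Lemma eq_expect F G : (forall E, E \subset slots n -> F E = G E) ->
  expect P F = expect P G.
Proof. by move=> eFG; apply: eq_bigr => E; rewrite powersetE => /eFG->. Qed.

Lemma le_expect F G : (forall E, E \subset slots n -> F E <= G E) ->
  expect P F <= expect P G.
Proof.
move=> leFG; apply: ler_sum => E; rewrite powersetE => /leFG leE.
by rewrite ler_wpM2l ?graph_weight_ge0.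
Qed.

Lemma expect_cst c : expect P (fun=> c) = c.
Proof.
rewrite /expect -big_distrl /= -[RHS]mul1r -(graph_prob_predT P); congr (_ * _).
by apply: eq_bigl => E; rewrite andbT.
Qed.

(** The weight of an edge set is a product over the slots, so that summing over the
    edge sets expands a product of sums.  This is independence of the edges, for an
    arbitrary function of each of them. *)
Lemma expect_prod (f : 'I_n * 'I_n -> bool -> R) :
  expect P (fun E => \prod_(e in slots n) f e (e \in E)) =
  \prod_(e in slots n)
    (P e.1 e.2 * f e true + (1 - P e.1 e.2) * f e false).
Proof.
pose F e : R := if e \in slots n then P e.1 e.2 * f e true else 0.
pose G e : R := if e \in slots n then (1 - P e.1 e.2) * f e false else 1.
transitivity (\prod_e (F e + G e)); last first.
  rewrite [RHS]big_mkcond; apply: eq_bigr => e _; rewrite /F /G.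
  by case: ifP; rewrite ?add0r.
rewrite bigA_distr /expect [LHS]big_mkcond; apply: eq_bigr => E _ /=.
rewrite powersetE.
case: (boolP (E \subset slots n)) =>
  [/fintype.subsetP sE | /fintype.subsetPn[e eE eU]] /=; last first.
  by rewrite (bigD1 e) //= eE /F (negPf eU) mul0r.
rewrite /graph_weight -big_split big_mkcond; apply: eq_bigr => e _ /=.
rewrite /F /G; case: (boolP (e \in E)) => [/sE-> // | eE].
by case: ifP.
Qed.

Lemma graph_prob_expect (ev : pred {set 'I_n * 'I_n}) :
  graph_prob P ev = expect P (fun E => (ev E)%:R).
Proof.
rewrite /graph_prob /expect big_mkcondr; apply: eq_bigr => E _.
by case: ifP; rewrite ?mulr1 ?mulr0.
Qed.

Lemma graph_prob_ge0 ev : 0 <= graph_prob P ev.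
Proof. by apply: sumr_ge0 => E _; apply: graph_weight_ge0. Qed.

Lemma graph_prob_le (ev1 ev2 : pred {set 'I_n * 'I_n}) :
  (forall E, E \subset slots n -> ev1 E -> ev2 E) ->
  graph_prob P ev1 <= graph_prob P ev2.
Proof.
move=> sub; rewrite !graph_prob_expect; apply: le_expect => E /sub.
by case: (ev1 E) => [->//|_]; case: (ev2 E).
Qed.

Lemma graph_probC ev : graph_prob P (predC ev) = 1 - graph_prob P ev.
Proof.
rewrite -[1](expect_cst 1) !graph_prob_expect -mulN1r -expectZ -expectD.
by apply: eq_expect => E _ /=; case: (ev E); rewrite /= ?mulr1 ?mulr0; ring.
Qed.

Lemma graph_prob_le1 ev : graph_prob P ev <= 1.
Proof. by have := graph_prob_ge0 (predC ev); rewrite graph_probC subr_ge0. Qed.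

Lemma graph_probU ev1 ev2 :
  graph_prob P (predU ev1 ev2) <= graph_prob P ev1 + graph_prob P ev2.
Proof.
rewrite !graph_prob_expect -expectD; apply: le_expect => E _ /=.
by case: (ev1 E); case: (ev2 E); rewrite /= ?addr0 ?add0r // lerDl.
Qed.

Lemma graph_prob_exists (I : finType) (ev : I -> pred {set 'I_n * 'I_n}) :
  graph_prob P (fun E => [exists i, ev i E]) <= \sum_i graph_prob P (ev i).
Proof.
under eq_bigr do rewrite graph_prob_expect.
rewrite graph_prob_expect -expect_sum; apply: le_expect => E _.
case: existsP => [[i evi]|_]; last by apply: sumr_ge0.
by rewrite (bigD1 i) //= evi lerDl sumr_ge0.
Qed.

Lemma markov F c : 0 < c -> (forall E, E \subset slots n -> 0 <= F E) ->
  graph_prob P (fun E => c <= F E) <= expect P F / c.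
Proof.
move=> c0 F0; rewrite ler_pdivlMr // mulrC graph_prob_expect -expectZ.
apply: le_expect => E sE; case: (boolP (c <= F E)) => [cF|_]; rewrite ?mulr1 //.
by rewrite mulr0 F0.
Qed.

Lemma chebyshev F m v s : 0 < s -> expect P (fun E => F E ^+ 2) <= m ^+ 2 + v ->
  expect P F = m ->
  graph_prob P (fun E => m + s <= F E) <= v / s ^+ 2.
Proof.
move=> s0 F2 Fm; apply: (le_trans (y := graph_prob P
    (fun E => s ^+ 2 <= (F E - m) ^+ 2))).
  apply: graph_prob_le => E _ le; rewrite ler_sqr ?nnegrE ?(ltW s0) //; lra.
apply: (le_trans (markov (F := fun E => (F E - m) ^+ 2) _ _)).
- by rewrite exprn_gt0.
- by move=> E _; rewrite sqr_ge0.
rewrite ler_wpM2r ?invr_ge0 ?sqr_ge0 //.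
have -> : expect P (fun E => (F E - m) ^+ 2) =
    expect P (fun E => F E ^+ 2 + ((- 2 * m) * F E + m ^+ 2)).
  by apply: eq_expect => E _; ring.
rewrite !expectD expect_cst expectZ Fm; lra.
Qed.

Lemma noise_norm E e : `|noise P E e| <= 1.
Proof.
rewrite /noise; have /andP[p0 p1] := P01 e.1 e.2.
by case: (e \in E); rewrite ler_norml; apply/andP; split; rewrite /=; lra.
Qed.

Lemma edge_var_ge0 e : 0 <= edge_var P e.
Proof. by have /andP[p0 p1] := P01 e.1 e.2; rewrite /edge_var mulr_ge0 // subr_ge0. Qed.

Lemma edge_var_le e : edge_var P e <= P e.1 e.2.
Proof. by have /andP[p0 p1] := P01 e.1 e.2; rewrite /edge_var; nra. Qed.

Definition noise_moment e (m : nat) : R :=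
  P e.1 e.2 * (1 - P e.1 e.2) ^+ m + (1 - P e.1 e.2) * (- P e.1 e.2) ^+ m.

Lemma noise_moment0 e : noise_moment e 0 = 1.
Proof. rewrite /noise_moment !expr0; ring. Qed.

Lemma noise_moment1 e : noise_moment e 1 = 0.
Proof. rewrite /noise_moment !expr1; ring. Qed.

Lemma noise_moment2 e : noise_moment e 2 = edge_var P e.
Proof. rewrite /noise_moment /edge_var; ring. Qed.

Lemma noise_moment_le1 e m : `|noise_moment e m| <= 1.
Proof.
have /andP[p0 p1] := P01 e.1 e.2; rewrite /noise_moment.
have q0 : 0 <= 1 - P e.1 e.2 by lra.
apply: le_trans (ler_normD _ _) _; rewrite !normrM !normrX normrN.
rewrite !ger0_norm //.
have : (1 - P e.1 e.2) ^+ m <= 1 by rewrite exprn_ile1 //; lra.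
have : P e.1 e.2 ^+ m <= 1 by rewrite exprn_ile1.
move: ((1 - _) ^+ m) (_ ^+ m) => x y; nra.
Qed.

Lemma noise_moment_le_var e m : `|noise_moment e m.+2| <= edge_var P e.
Proof.
have /andP[p0 p1] := P01 e.1 e.2; rewrite /noise_moment /edge_var.
have q0 : 0 <= 1 - P e.1 e.2 by lra.
have : `|(1 - P e.1 e.2) ^+ m.+2| <= (1 - P e.1 e.2) ^+ 2.
  by rewrite normrX ger0_norm // -addn2 exprD ler_piMl ?sqr_ge0 ?exprn_ile1 //; lra.
have : `|(- P e.1 e.2) ^+ m.+2| <= P e.1 e.2 ^+ 2.
  by rewrite normrX normrN ger0_norm // -addn2 exprD ler_piMl ?sqr_ge0 ?exprn_ile1.
move: (P e.1 e.2) p0 p1 q0 => p p0 p1 q0.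
move: ((1 - p) ^+ m.+2) ((- p) ^+ m.+2) => x y yp xq.
apply: le_trans (ler_normD _ _) _; rewrite (normrM p) (normrM (1 - p)) (ger0_norm p0) (ger0_norm q0).
have : p * `|x| <= p * (1 - p) ^+ 2 by rewrite ler_wpM2l.
have : (1 - p) * `|y| <= (1 - p) * p ^+ 2 by rewrite ler_wpM2l.
by move: (`|x|) (`|y|) => u v; rewrite !expr2; lra.
Qed.

Lemma expect_noise_seq (s : seq ('I_n * 'I_n)) : {subset s <= slots n} ->
  expect P (fun E => \prod_(e <- s) noise P E e) =
  \prod_(e in slots n) noise_moment e (count_mem e s).
Proof.
move=> sS; have mE e : noise_moment e (count_mem e s) =
    P e.1 e.2 * (true%:R - P e.1 e.2) ^+ count_mem e s +
    (1 - P e.1 e.2) * (false%:R - P e.1 e.2) ^+ count_mem e s.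
  by rewrite /noise_moment add0r.
under [RHS]eq_bigr do rewrite mE.
rewrite -(expect_prod (fun e b => (b%:R - P e.1 e.2) ^+ count_mem e s)).
apply: eq_expect => E _.
transitivity (\prod_(e <- s) \prod_(f in slots n) noise P E f ^+ (f == e)).
  apply: eq_big_seq => e es; rewrite (bigD1 e) ?sS //= eqxx expr1 big1 ?mulr1 //.
  by move=> f /andP[_ /negPf->]; rewrite expr0.
rewrite exchange_big; apply: eq_bigr => e _ /=; rewrite -/(noise P E e).
elim: s {sS mE} => [|f s IH]; first by rewrite big_nil expr0.
by rewrite big_cons /= exprD IH eq_sym.
Qed.

(** The noise is centred: an edge that occurs once annihilates the product. *)
Lemma expect_noise_unpaired (s : seq ('I_n * 'I_n)) e :
  {subset s <= slots n} -> count_mem e s = 1%N ->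
  expect P (fun E => \prod_(e <- s) noise P E e) = 0.
Proof.
move=> sS c1; rewrite expect_noise_seq // (bigD1 e) /= ?c1 ?noise_moment1 ?mul0r //.
by apply: sS; rewrite -has_pred1 has_count c1.
Qed.

(** A product of four noise variables that survives consists of two pairs or of a
    single fourth power, and the fourth moment is at most the variance. *)
Lemma expect_noise4_le e f g h : e \in slots n -> f \in slots n ->
  g \in slots n -> h \in slots n ->
  expect P (fun E => noise P E e * noise P E f * (noise P E g * noise P E h)) <=
  ((e == f) && (g == h))%:R * (edge_var P e * edge_var P g) +
  ((e == g) && (f == h))%:R * (edge_var P e * edge_var P f) +
  ((e == h) && (f == g))%:R * (edge_var P e * edge_var P f) +
  [&& e == f, e == g & e == h]%:R * edge_var P e.
Proof.
move=> eS fS gS hS.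
have sS : {subset [:: e; f; g; h] <= slots n}.
  by move=> x; rewrite 4!in_cons in_nil orbF => /or4P[] /eqP->.
have -> : expect P (fun E => noise P E e * noise P E f * (noise P E g * noise P E h))
    = expect P (fun E => \prod_(x <- [:: e; f; g; h]) noise P E x).
  by apply: eq_expect => E _; rewrite !big_cons big_nil mulr1 !mulrA.
have vv x y : 0 <= edge_var P x * edge_var P y by rewrite mulr_ge0 ?edge_var_ge0.
have rhs0 (b1 b2 b3 b4 : bool) : 0 <= b1%:R * (edge_var P e * edge_var P g) +
    b2%:R * (edge_var P e * edge_var P f) + b3%:R * (edge_var P e * edge_var P f)
    + b4%:R * edge_var P e.
  by rewrite !addr_ge0 // mulr_ge0 ?edge_var_ge0.
have un x (b1 b2 b3 b4 : bool) : count_mem x [:: e; f; g; h] = 1%N ->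
    expect P (fun E => \prod_(x <- [:: e; f; g; h]) noise P E x) <=
    b1%:R * (edge_var P e * edge_var P g) + b2%:R * (edge_var P e * edge_var P f)
    + b3%:R * (edge_var P e * edge_var P f) + b4%:R * edge_var P e.
  by move=> c1; rewrite (expect_noise_unpaired sS c1) rhs0.
have two x y : x != y -> x \in slots n -> y \in slots n ->
    perm_eq [:: e; f; g; h] [:: x; x; y; y] ->
    expect P (fun E => \prod_(x <- [:: e; f; g; h]) noise P E x)
      = edge_var P x * edge_var P y.
  move=> xy xS yS pxy; rewrite expect_noise_seq // (bigD1 x) //=.
  rewrite (bigD1 y) /=; last by rewrite yS eq_sym.
  have cE z : count_mem z [:: e; f; g; h] = ((x == z).*2 + (y == z).*2)%N.
    by rewrite (seq.permP pxy) /= addn0 !addnA -!addnn !addnA.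
  rewrite -!/(count_mem _ [:: e; f; g; h]) !cE.
  rewrite !eqxx [y == x]eq_sym (negPf xy) /= !noise_moment2.
  rewrite big1 ?mulr1 // => z /andP[/andP[_ zx] zy].
  rewrite -/(count_mem _ [:: e; f; g; h]) cE !(eq_sym _ z) (negPf zx) (negPf zy).
  exact: noise_moment0.
case: (eqVneq e f) => [ef|ef].
  subst f; case: (eqVneq g h) => [gh|gh].
    subst h; case: (eqVneq e g) => [eg|eg] /=.
      subst g; rewrite expect_noise_seq // (bigD1 e) //= eqxx /=.
      rewrite big1 ?mulr1; last first.
        by move=> x /andP[_ xe]; rewrite /= !(eq_sym _ x) (negPf xe); exact: noise_moment0.
      apply: le_trans (ler_norm _) _; apply: le_trans (noise_moment_le_var _ _) _.
      by rewrite !mul1r lerDr !addr_ge0.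
    by rewrite (two e g) // ?mul0r ?addr0 ?mul1r.
  case: (eqVneq g e) => [ge|ge].
    by subst g; apply: (un h); rewrite /= (negPf gh) eqxx.
  by apply: (un g); rewrite /= (eq_sym e g) (eq_sym h g) (negPf gh) (negPf ge) eqxx.
case: (eqVneq e g) => [eg|eg].
  subst g; case: (eqVneq f h) => [fh|fh].
    subst h; rewrite (two e f) //=.
      by rewrite (negPf ef) /= !mul0r !addr0 add0r mul1r.
    by rewrite /= perm_cons perm_sym -(cat1s e) perm_catC /= perm_sym (perm_catC [:: f; e] [:: f]) //=.
  by apply: (un f); rewrite /= !(eq_sym _ f) [f == e]eq_sym (negPf ef) (negPf fh) eqxx.
case: (eqVneq e h) => [eh|eh].
  subst h; case: (eqVneq f g) => [fg|fg].
    subst g; rewrite (two e f) //=.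
      by rewrite /= !mul0r !addr0 add0r mul1r.
    by rewrite /= perm_cons (perm_catC [:: f; f] [:: e]).
  by apply: (un f); rewrite /= !(eq_sym _ f) [f == e]eq_sym (negPf ef) (negPf fg) eqxx.
apply: (un e); rewrite /= !(eq_sym _ e) (negPf ef) (negPf eg) (negPf eh).
by rewrite eqxx.
Qed.

Definition noise_form (q : 'I_n * 'I_n -> 'I_n * 'I_n -> R) E : R :=
  \sum_(e in slots n) \sum_(f in slots n) q e f * (noise P E e * noise P E f).

Lemma expect_noise2 e f : e \in slots n -> f \in slots n ->
  expect P (fun E => noise P E e * noise P E f) = (e == f)%:R * edge_var P e.
Proof.
move=> eS fS; have sS : {subset [:: e; f] <= slots n}.
  by move=> x; rewrite 2!in_cons in_nil orbF => /orP[] /eqP->.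
have -> : expect P (fun E => noise P E e * noise P E f)
    = expect P (fun E => \prod_(x <- [:: e; f]) noise P E x).
  by apply: eq_expect => E _; rewrite !big_cons big_nil mulr1.
case: (eqVneq e f) => [ef|ef].
  subst f; rewrite expect_noise_seq // (bigD1 e) //= eqxx noise_moment2 mul1r.
  rewrite big1 ?mulr1 // => x /andP[_ xe].
  by rewrite !(eq_sym _ x) (negPf xe); exact: noise_moment0.
by rewrite mul0r (@expect_noise_unpaired _ e) //= eqxx eq_sym (negPf ef).
Qed.

Lemma expect_noise_form q :
  expect P (noise_form q) = \sum_(e in slots n) q e e * edge_var P e.
Proof.
rewrite /noise_form expect_sum; apply: eq_bigr => e eS.
rewrite expect_sum (bigD1 e) //= expectZ expect_noise2 // eqxx mul1r.
rewrite big1 ?addr0 // => f /andP[fS fe].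
by rewrite expectZ expect_noise2 // eq_sym (negPf fe) mul0r mulr0.
Qed.

(** Of the three ways to pair up the indices in [expect_noise4_le], the first gives
    the square of the mean, the other two give equal terms by symmetry of [q], and
    the coincidence of all four indices gives the last term. *)
Lemma expect_noise_form_sqr q : (forall e f, 0 <= q e f) ->
  (forall e f, q e f = q f e) ->
  expect P (fun E => noise_form q E ^+ 2) <=
  (\sum_(e in slots n) q e e * edge_var P e) ^+ 2 +
  (2 * (\sum_(e in slots n) \sum_(f in slots n)
          q e f ^+ 2 * (edge_var P e * edge_var P f)) +
   \sum_(e in slots n) q e e ^+ 2 * edge_var P e).
Proof.
move=> q0 qs.
pose X e f g h := expect P (fun E => noise P E e * noise P E f * (noise P E g * noise P E h)).
have -> : expect P (fun E => noise_form q E ^+ 2) =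
    \sum_(e in slots n) \sum_(f in slots n) \sum_(g in slots n)
      \sum_(h in slots n) q e f * q g h * X e f g h.
  rewrite (_ : expect P _ = expect P (fun E => \sum_(e in slots n)
      \sum_(f in slots n) \sum_(g in slots n) \sum_(h in slots n)
      q e f * q g h * (noise P E e * noise P E f * (noise P E g * noise P E h)))).
    rewrite expect_sum; apply: eq_bigr => e _.
    rewrite expect_sum; apply: eq_bigr => f _.
    rewrite expect_sum; apply: eq_bigr => g _.
    by rewrite expect_sum; apply: eq_bigr => h _; rewrite expectZ.
  apply: eq_expect => E _; rewrite expr2 /noise_form big_distrl.
  apply: eq_bigr => e _; rewrite big_distrl; apply: eq_bigr => f _.
  rewrite big_distrr; apply: eq_bigr => g _; rewrite big_distrr.
  by apply: eq_bigr => h _ /=; ring.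
have pick x (F : 'I_n * 'I_n -> R) : x \in slots n ->
    \sum_(y in slots n) (x == y)%:R * F y = F x.
  move=> xS; rewrite (bigD1 x) //= eqxx mul1r big1 ?addr0 // => y /andP[_ yx].
  by rewrite eq_sym (negPf yx) mul0r.
apply: (le_trans (y := \sum_(e in slots n) \sum_(f in slots n)
    \sum_(g in slots n) \sum_(h in slots n)
   ((e == f)%:R * ((g == h)%:R * (q e f * q g h * (edge_var P e * edge_var P g))) +
    (e == g)%:R * ((f == h)%:R * (q e f * q g h * (edge_var P e * edge_var P f))) +
    (f == g)%:R * ((e == h)%:R * (q e f * q g h * (edge_var P e * edge_var P f))) +
    (e == f)%:R * ((e == g)%:R * ((e == h)%:R * (q e f * q g h * edge_var P e)))))).
  apply: ler_sum => e eS; apply: ler_sum => f fS; apply: ler_sum => g gS.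
  apply: ler_sum => h hS.
  apply: (le_trans (ler_wpM2l _ (expect_noise4_le eS fS gS hS))).
    by rewrite mulr_ge0.
  by rewrite -!mulnb !natrM le_eqVlt; apply/orP; left; apply/eqP; ring.
under eq_bigr => e eS. under eq_bigr => f fS. under eq_bigr => g gS.
  rewrite !big_split /= -!big_distrr /= !pick //. over.
  rewrite !big_split /= -!big_distrr /= !pick //. over.
  rewrite !big_split /= !pick //. over.
rewrite !big_split /= le_eqVlt; apply/orP; left; apply/eqP.
rewrite mulr2n mulrDl !mul1r !addrA; congr (_ + _ + _ + _).
- rewrite expr2 big_distrl; apply: eq_bigr => e _; rewrite !big_distrr.
  by apply: eq_bigr => f _ /=; ring.
- by apply: eq_bigr => e _; apply: eq_bigr => f _; rewrite expr2 (qs f e).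
Qed.

Lemma expR_le_quad (x : R) : x <= 1 / 2 -> expR x <= 1 + x + 2 * x ^+ 2.
Proof.
move=> x2; have e1 : 1 - x <= expR (- x) by apply: expR_ge1Dx.
have e0 : 0 < expR x by apply: expR_gt0.
have : expR x * (1 - x) <= 1.
  by rewrite -[leRHS](expRxMexpNx_1 x) ler_wpM2l // ltW.
nra.
Qed.

(** Markov's inequality for [exp (th * X)], where [X] is the sum and [th] is [s / (4 * t)].
    The expectation is a product over the edges; in each factor the linear term of
    [expR_le_quad] vanishes because the noise is centred, and the quadratic term is
    twice [th ^ 2] times the variance. *)
Lemma noise_chernoff (c : 'I_n * 'I_n -> R) (t s : R) :
  (forall e, `|c e| <= 1) -> 0 < t ->
  \sum_(e in slots n) c e ^+ 2 * edge_var P e <= t -> 0 <= s <= 2 * t ->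
  graph_prob P (fun E => s <= \sum_(e in slots n) c e * noise P E e) <=
  expR (- (s ^+ 2 / (8 * t))).
Proof.
move=> c1 t0 vt /andP[s0 st]; pose th := s / (4 * t).
have th0 : 0 <= th by rewrite divr_ge0 ?mulr_ge0 // ltW.
have th2 : th <= 1 / 2 by rewrite ler_pdivrMr ?mulr_gt0 //; lra.
pose F E := expR (th * \sum_(e in slots n) c e * noise P E e).
apply: (le_trans (y := graph_prob P (fun E => expR (th * s) <= F E))).
  by apply: graph_prob_le => E _ le; rewrite ler_expR ler_wpM2l.
apply: le_trans (markov (expR_gt0 _) _) _; first by move=> E _; rewrite expR_ge0.
suff FE : expect P F <= expR (2 * th ^+ 2 * t).
  apply: (le_trans (ler_wpM2r _ FE)); first by rewrite invr_ge0 expR_ge0.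
  rewrite -expRN -expRD ler_expR /th le_eqVlt; apply/orP; left; apply/eqP.
  by field; rewrite gt_eqF.
have -> : expect P F = expect P (fun E => \prod_(e in slots n)
    expR (th * (c e * ((e \in E)%:R - P e.1 e.2)))).
  apply: eq_expect => E _; rewrite /F big_distrr /= expR_sum //.
rewrite (expect_prod (fun e b => expR (th * (c e * (b%:R - P e.1 e.2))))).
apply: (le_trans (y := \prod_(e in slots n) expR (2 * th ^+ 2 * (c e ^+ 2 * edge_var P e)))); last first.
  by rewrite -expR_sum ler_expR -big_distrr /= ler_wpM2l // mulr_ge0 // sqr_ge0.
apply: ler_prod => e _; have /andP[p0 p1] := P01 e.1 e.2.
rewrite addr_ge0 ?mulr_ge0 ?expR_ge0 ?subr_ge0 //=.
apply: le_trans (expR_ge1Dx _).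
have cb (b : bool) : th * (c e * (b%:R - P e.1 e.2)) <= 1 / 2.
  apply: le_trans th2; rewrite ler_piMr //; apply: le_trans (ler_norm _) _.
  rewrite normrM mulr_ile1 //.
  by case: b; rewrite ler_norml; apply/andP; split; rewrite /=; lra.
have := expR_le_quad (cb true); have := expR_le_quad (cb false) => /=.
rewrite /edge_var => lev leu; have q0 : 0 <= 1 - P e.1 e.2 by lra.
by have := ler_wpM2l p0 leu; have := ler_wpM2l q0 lev; lra.
Qed.

End Expectation.

(** * Closed non-backtracking walks that use every edge twice *)

Section WalkSteps.
Local Open Scope nat_scope.
Variables (T : finType) (z : nat -> T).

Definition new_step t := z t.+1 \notin mkseq z t.+1.
Definition first_visit t := index (z t) (mkseq z t.+1).

(** The first visit to the current vertex, at time [s], uses two edges there, from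
    [z s.-1] and to [z s.+1].  A step retraces if it leaves along the second after an
    arrival along the first, and along the first after any other arrival.  So the past
    determines the target, which makes these steps free of charge in the counting. *)
Definition retracing_step t :=
  let s := first_visit t in
  (s < t) && (z t.+1 == if z t.-1 == z s.-1 then z s.+1 else z s.-1).

Definition forced_step t := ~~ new_step t && retracing_step t.
Definition free_step t := ~~ new_step t && ~~ retracing_step t.

Definition same_edge t u :=
  (z t == z u) && (z t.+1 == z u.+1) || (z t == z u.+1) && (z t.+1 == z u).

Lemma steps_partition L :
  \sum_(t < L) new_step t + \sum_(t < L) forced_step t +
  \sum_(t < L) free_step t = L.
Proof.
rewrite -!big_split /= -[RHS]card_ord -sum1_card; apply: eq_bigr => t _.
by rewrite /forced_step /free_step; case: new_step; case: retracing_step.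
Qed.

Lemma mem_mkseq t s : t < s -> z t \in mkseq z s.
Proof. by move=> ts; apply/map_f; rewrite mem_iota. Qed.

Lemma mkseqP x s : reflect (exists2 t, t < s & x = z t) (x \in mkseq z s).
Proof.
by apply: (iffP mapP) => -[t]; rewrite ?mem_iota => ts ->; exists t; rewrite ?mem_iota.
Qed.

Lemma card_visited L :
  #|[set x in mkseq z L.+1]| = (\sum_(t < L) new_step t).+1.
Proof.
elim: L => [|L IH]; first by rewrite big_ord0 finset.set_cons finset.set_nil finset.setU0 cards1.
have -> : [set x in mkseq z L.+2] = z L.+1 |: [set x in mkseq z L.+1].
  apply/finset.setP => x; rewrite finset.in_setU1 2!inE.
  apply/mkseqP/idP => [[t tL ->]|/orP[/eqP->|/mkseqP[t tL ->]]].
  - by move: tL; rewrite ltnS leq_eqVlt => /orP[/eqP->|/mem_mkseq->]; rewrite ?eqxx ?orbT.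
  - by exists L.+1.
  - by exists t => //; lia.
by rewrite finset.cardsU1 IH big_ord_recr /= inE addnS addnC.
Qed.

Lemma first_visitE t s : s <= t -> z s = z t ->
  (forall r, r < s -> z r != z t) -> first_visit t = s.
Proof.
move=> st e smin; have vt : z t \in mkseq z t.+1 by apply: mem_mkseq.
have i_lt : first_visit t < t.+1.
  by rewrite -[X in _ < X](size_mkseq z t.+1) index_mem.
have : z (first_visit t) = z t by rewrite -[LHS](nth_mkseq (z t) z i_lt) nth_index.
case: (ltngtP (first_visit t) s) => // [/smin/negP + /eqP//|lt _].
have := before_find (z t) lt; rewrite nth_mkseq /= ?e ?eqxx //; lia.
Qed.

End WalkSteps.

Section DoubledWalk.
Local Open Scope nat_scope.
Variables (T : finType) (z : nat -> T) (m : nat).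
Hypothesis m0 : 0 < m.
Hypothesis closed : z (2 * m) = z 0.
(* Time [m] is exempt because the two halves of the walk are joined there. *)
Hypothesis nonback : forall t, 0 < t < 2 * m -> t != m -> z t.-1 != z t.+1.
Hypothesis doubled : forall t, t < 2 * m ->
  exists u, [&& u < 2 * m, u != t & same_edge z t u].

(** The edges of the first arrival at and of the first departure from [v] are used
    again, at later visits to [v].  Either these are two different visits, and
    [v] is visited three times, or the same visit uses both edges again, and then
    its departure is determined by its arrival. *)
Lemma visits_or_forced v : v != z 0 -> v != z m -> v \in mkseq z (2 * m) ->
  3 <= \sum_(t < 2 * m) (z t == v) +
       \sum_(t < 2 * m) ((z t == v) && forced_step z t).
Proof.
move=> v0 vm /mkseqP[s0 s0m es0].
have exs : exists s, (s < 2 * m) && (z s == v) by exists s0; rewrite s0m es0 eqxx.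
case: (ex_minnP exs) => s /andP[sm /eqP es] smin {s0 s0m es0 exs}.
have s_gt0 : 0 < s by rewrite lt0n; apply: contraNneq v0 => s0; rewrite -es s0.
have s_m : s != m by apply: contraNneq vm => sm'; rewrite -es sm'.
have nbs : z s.-1 != z s.+1 by apply: nonback => //; rewrite s_gt0.
have visit_lt u : u.+1 <= 2 * m -> z u.+1 = v -> u.+1 < 2 * m.
  rewrite leq_eqVlt => /orP[/eqP e|//] ev.
  by rewrite -ev e closed eqxx in v0.
have [t tm [et ts tE]] : exists2 t, t < 2 * m &
    [/\ z t = v, t != s & z t.-1 = z s.-1 \/ z t.+1 = z s.-1].
  have [|u /and3P[um us]] := doubled (t := s.-1); first by lia.
  rewrite /same_edge prednK // es => /orP[] /andP[/eqP e1 /eqP e2].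
    exists u.+1; first exact: visit_lt.
    by split=> //; [lia | left].
  exists u => //; split=> //; last by right.
  by apply: contraNneq nbs => us'; rewrite e1 us'.
have [t' t'm [et' t's t'E]] : exists2 t, t < 2 * m &
    [/\ z t = v, t != s & z t.-1 = z s.+1 \/ z t.+1 = z s.+1].
  have [|u /and3P[um us]] := doubled (t := s); first by [].
  rewrite /same_edge es => /orP[] /andP[/eqP e1 /eqP e2].
    by exists u => //; split=> //; right.
  exists u.+1; first exact: visit_lt.
  split=> //; last by left.
  by apply: contraNneq nbs => us'; rewrite e2 -us'.
pose V := [set r : 'I_(2 * m) | z r == v].
have -> : \sum_(r < 2 * m) (z r == v) = #|V|.
  by rewrite -sum1dep_card [RHS]big_mkcond.
have sV : Ordinal sm \in V by rewrite inE es.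
have tV : Ordinal tm \in V by rewrite inE et.
have t'V : Ordinal t'm \in V by rewrite inE et'.
case: (eqVneq t t') => [tt'|tt'].
  subst t'; have st : s < t.
    by rewrite ltn_neqAle eq_sym ts smin // tm et eqxx.
  have fv : first_visit z t = s.
    apply: first_visitE; [exact: ltnW | by rewrite es et |] => r rs.
    rewrite et; apply/negP => er; have := smin r; rewrite er andbT; lia.
  have ret : retracing_step z t.
    rewrite /retracing_step fv st /=; case: (eqVneq (z t.-1) (z s.-1)) => [e|ne].
      by case: t'E => [e'|->//]; rewrite -e -e' eqxx in nbs.
    by case: tE => [e|->//]; rewrite e eqxx in ne.
  have nnew : ~~ new_step z t.
    rewrite /new_step negbK.
    have : z t.+1 = z s.+1 \/ z t.+1 = z s.-1.
      by case: t'E => [e'|]; [right; case: tE => // e; rewrite -e -e' eqxx in nbs | left].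
    by case=> ->; apply: mem_mkseq; lia.
  rewrite (bigD1 (Ordinal tm)) //= et eqxx /= /forced_step nnew ret /= addnA addn1.
  apply: leq_trans (leq_addr _ _); rewrite ltnS.
  apply: (@leq_trans #|[set Ordinal sm; Ordinal tm]|).
    by rewrite cards2 -val_eqE /= eq_sym ts.
  by apply: subset_leq_card; apply/fintype.subsetP => r; rewrite finset.in_set2 => /orP[] /eqP->.
apply: leq_trans (leq_addr _ _).
apply: (@leq_trans #|[set Ordinal sm; Ordinal tm; Ordinal t'm]|).
  rewrite finset.setUC finset.cardsU1 cards2 !inE -!val_eqE /= (eq_sym s) ts (negPf t's) eq_sym.
  by rewrite (negPf tt').
apply: subset_leq_card; apply/fintype.subsetP => r.
by rewrite finset.in_setU finset.in_set2 finset.in_set1 => /orP[/orP[]|] /eqP->.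
Qed.

(** Each visited vertex other than [z 0] and [z m] adds at least [3] to the sums in
    [visits_or_forced], the visits add up to [2 * m], and every step is new, forced or
    free.  The constants matter: a walk has at most [m] new steps, and each one that it
    falls short of [m] allows only four free steps more. *)
Lemma free_step_bound :
  \sum_(t < 2 * m) free_step z t + 4 * \sum_(t < 2 * m) new_step z t <=
  2 * (2 * m) + 3.
Proof.
pose S := [set x in mkseq z (2 * m)].
have cS : #|S| = (\sum_(t < 2 * m) new_step z t).+1.
  rewrite -card_visited; apply: eq_card => x; rewrite 2!inE.
  apply/mkseqP/mkseqP => -[t tm ->]; first by exists t => //; lia.
  move: tm; rewrite ltnS leq_eqVlt => /orP[/eqP->|tm]; last by exists t.
  by exists 0; [lia | rewrite closed].
have split_sum (a : 'I_(2 * m) -> bool) :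
    \sum_(v in S) \sum_(t < 2 * m) ((z t == v) && a t) = \sum_(t < 2 * m) a t.
  rewrite exchange_big; apply: eq_bigr => t _ /=.
  rewrite (bigD1 (z t)) /=; last by rewrite inE mem_mkseq.
  by rewrite eqxx big1 ?addn0 // => v /andP[_ /negPf vt]; rewrite eq_sym vt.
have : 3 * (#|S| - 2) <= \sum_(v in S) (\sum_(t < 2 * m) (z t == v) +
      \sum_(t < 2 * m) ((z t == v) && forced_step z t)).
  apply: (@leq_trans (\sum_(v in S :\: [set z 0; z m]) 3)).
    rewrite sum_nat_const mulnC leq_mul2r /=.
    have := finset.leq_card_setU S [set z 0; z m]; have := cards2 (z 0) (z m).
    have := finset.cardsID [set z 0; z m] S.
    have : #|S :&: [set z 0; z m]| <= #|[set z 0; z m]|.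
      by apply: subset_leq_card; apply: finset.subsetIr.
    case: (_ != _); lia.
  rewrite big_mkcond [leqRHS]big_mkcond; apply: leq_sum => v _.
  case: ifP => // vD; have : v \in S :\: [set z 0; z m] by [].
  rewrite finset.in_setD finset.in_set2 negb_or => /andP[/andP[v0 vm] vS]; rewrite vS.
  by apply: visits_or_forced => //; rewrite inE in vS.
have -> : \sum_(v in S) (\sum_(t < 2 * m) (z t == v) +
      \sum_(t < 2 * m) ((z t == v) && forced_step z t)) =
    2 * m + \sum_(t < 2 * m) forced_step z t.
  rewrite big_split /= split_sum; congr (_ + _).
  under eq_bigr => v _ do under eq_bigr => t _ do rewrite -(andbT (z t == v)).
  by rewrite split_sum sum_nat_const card_ord muln1.
have := steps_partition z (2 * m); rewrite cS; lia.
Qed.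

End DoubledWalk.

(** * Expected weight of closed non-backtracking walks *)

Lemma slotC n (i j : 'I_n) : slot i j = slot j i.
Proof.
rewrite /slot; case: ltngtP => // ij; have -> : i = j by apply: val_inj.
by [].
Qed.

Lemma slot_in n (i j : 'I_n) : slot i j \in slots n.
Proof. by rewrite /slot; case: leqP => ij; rewrite inE //= ltnW. Qed.

Lemma slot_eq n (i j k l : 'I_n) :
  (slot i j == slot k l) = (i == k) && (j == l) || (i == l) && (j == k).
Proof.
apply/eqP/orP => [|[]/andP[/eqP-> /eqP->]]; [|by []|exact: slotC].
by rewrite /slot; case: leqP => _; case: leqP => _ [-> ->]; rewrite !eqxx; auto.
Qed.

Section WalkMoment.
Variables (R : realType) (n : nat) (P c : 'M[R]_n) (kappa : R).
Hypothesis P01 : forall i j, 0 <= P i j <= 1.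
Hypothesis c_sym : forall i j, c i j = c j i.
Hypothesis P_sym : forall i j, P i j = P j i.
Hypothesis kappa01 : 0 < kappa <= 1.
Hypothesis c_bound : forall i j, 0 <= c i j <= kappa ^+ 2.

Definition weighted_noise E (i j : 'I_n) : R := c i j * noise P E (slot i j).
Definition weighted_var (i j : 'I_n) : R := c i j ^+ 2 * edge_var P (slot i j).

Lemma slot_sym (M : 'M[R]_n) i j : (forall i j, M i j = M j i) ->
  M (slot i j).1 (slot i j).2 = M i j.
Proof. by move=> Ms; rewrite /slot; case: leqP. Qed.

Lemma weighted_noise_sym E i j : weighted_noise E i j = weighted_noise E j i.
Proof. by rewrite /weighted_noise c_sym slotC. Qed.

(** What one step contributes to the bound on the expected weight of a walk: the
    variance of its edge if it discovers a vertex, [1] if the past determines it, and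
    the square root [kappa] of the bound on the entries in all other cases, in which
    the target is one of the few vertices visited before. *)
Definition step_weight (z : nat -> 'I_n) t : R :=
  if new_step z t then weighted_var (z t) (z t.+1)
  else if retracing_step z t then 1 else kappa.

Lemma weighted_var_ge0 i j : 0 <= weighted_var i j.
Proof. by rewrite mulr_ge0 ?sqr_ge0 // edge_var_ge0. Qed.

Lemma step_weight_ge0 z t : 0 <= step_weight z t.
Proof.
rewrite /step_weight; have /andP[k0 _] := kappa01.
by case: ifP => _; rewrite ?weighted_var_ge0 //; case: ifP => _; rewrite ?ltW.
Qed.

Section OneWalk.
Variables (z : nat -> 'I_n) (L : nat).

Let edge t := slot (z t) (z t.+1).
Let cnt e := (\sum_(t < L) (edge t == e))%N.
Let fresh e := (\sum_(t < L) (new_step z t && (edge t == e)))%N.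

Lemma edge_same t u : (edge t == edge u) = same_edge z t u.
Proof. by rewrite /edge slot_eq. Qed.

Lemma fresh_le_cnt e : (fresh e <= cnt e)%N.
Proof. by apply: leq_sum => t _; case: (edge t == e); rewrite ?andbT ?andbF // leq_b1. Qed.

Lemma new_edge_inj t u : (t < u)%N -> new_step z u -> edge t != edge u.
Proof.
move=> tu; apply: contraTneq => /eqP; rewrite edge_same /new_step negbK.
by case/orP => /andP[/eqP e1 /eqP e2]; [rewrite -e2 | rewrite -e1]; apply: mem_mkseq; lia.
Qed.

Lemma fresh_le1 e : (fresh e <= 1)%N.
Proof.
case: (pickP (fun t : 'I_L => new_step z t && (edge t == e))) => [t /andP[nt /eqP et]|no].
  rewrite /fresh (bigD1 t) //= nt et eqxx big1 // => u ut; apply/eqP; rewrite eqb0.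
  apply/negP => /andP[nu /eqP eu].
  case: (ltngtP t u) => [tu|tu|tu].
  - by have := new_edge_inj tu nu; rewrite et eu eqxx.
  - by have := new_edge_inj tu nt; rewrite et eu eqxx.
  - by rewrite -val_eqE /= tu eqxx in ut.
by rewrite /fresh big1 // => t _; rewrite no.
Qed.

Let K := kappa ^+ 2.
Let ce (e : 'I_n * 'I_n) := c e.1 e.2.

Lemma expect_walkE :
  expect P (fun E => \prod_(t < L) weighted_noise E (z t) (z t.+1)) =
  \prod_(e in slots n) (ce e ^+ cnt e * noise_moment P e (cnt e)).
Proof.
pose s := [seq edge t | t : 'I_L].
have cntE e : count_mem e s = cnt e.
  by rewrite count_map -sum1_count big_mkcond /cnt big_enum /=; apply: eq_bigr => t _; case: eqP.
have sS : {subset s <= slots n} by move=> e /mapP[t _ ->]; exact: slot_in.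
have prodE (f : 'I_n * 'I_n -> R) : \prod_(e <- s) f e = \prod_(t < L) f (edge t).
  by rewrite big_map big_enum.
under eq_bigr do rewrite -cntE.
rewrite big_split /= -(@expect_noise_seq _ _ P s sS).
have -> : \prod_(e in slots n) ce e ^+ count_mem e s = \prod_(t < L) ce (edge t).
  under [RHS]eq_bigr => t _.
    rewrite (_ : ce (edge t) = \prod_(e in slots n) ce e ^+ (edge t == e)); last first.
      rewrite (bigD1 (edge t)) ?slot_in //= eqxx expr1 big1 ?mulr1 // => e /andP[_ /negPf].
      by rewrite eq_sym => ->.
    over.
  rewrite exchange_big; apply: eq_bigr => e _ /=.
  by rewrite prodrXr cntE.
rewrite -expectZ; apply: eq_expect => E _; rewrite prodE -big_split.
by apply: eq_bigr => t _; rewrite /weighted_noise /ce slot_sym.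
Qed.

Lemma walk_unpaired e : cnt e = 1%N ->
  expect P (fun E => \prod_(t < L) weighted_noise E (z t) (z t.+1)) = 0.
Proof.
move=> c1; rewrite expect_walkE (bigD1 e) /=; last first.
  case: (pickP (fun t : 'I_L => edge t == e)) => [t /eqP<-|no]; first exact: slot_in.
  by rewrite /cnt big1 // in c1 => t _; rewrite no.
by rewrite c1 noise_moment1 mulr0 mul0r.
Qed.

(** An edge that discovered a vertex is used at least twice, and contributes its
    variance times a power of the bound [K] on the entries; any other edge contributes
    such a power only.  The factor on the left accounts for the two powers of [K] that
    the variance replaces. *)
Lemma walk_paired : (forall e, cnt e != 1%N) ->
  K ^+ (2 * \sum_(t < L) new_step z t) *
    `|expect P (fun E => \prod_(t < L) weighted_noise E (z t) (z t.+1))| <=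
  K ^+ L * \prod_(t < L) (if new_step z t then weighted_var (z t) (z t.+1) else 1).
Proof.
move=> c1; rewrite expect_walkE normr_prod.
have [k0 k1] := andP kappa01.
have K0 : 0 <= K by rewrite exprn_ge0 // ltW.
have -> : (2 * \sum_(t < L) new_step z t = \sum_(e in slots n) 2 * fresh e)%N.
  rewrite -big_distrr /= /fresh exchange_big /=; congr (2 * _)%N.
  apply: eq_bigr => t _; rewrite (bigD1 (edge t)) ?slot_in //= eqxx andbT.
  rewrite big1 ?addn0 // => e /andP[_ /negPf]; rewrite eq_sym => ->.
  by rewrite andbF.
have LE : L = (\sum_(e in slots n) cnt e)%N.
  rewrite /cnt exchange_big /= -[LHS]card_ord -sum1_card; apply: eq_bigr => t _.
  rewrite (bigD1 (edge t)) ?slot_in //= eqxx.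
  by rewrite big1 ?addn0 // => e /andP[_ /negPf]; rewrite eq_sym => ->.
have -> : \prod_(t < L) (if new_step z t then weighted_var (z t) (z t.+1) else 1) =
    \prod_(e in slots n) (ce e ^+ 2 * edge_var P e) ^+ fresh e.
  under [LHS]eq_bigr => t _.
    rewrite (_ : (if _ then _ else _) = \prod_(e in slots n)
       (ce e ^+ 2 * edge_var P e) ^+ (new_step z t && (edge t == e))); last first.
      rewrite (bigD1 (edge t)) ?slot_in //= eqxx andbT big1 ?mulr1; last first.
        by move=> e /andP[_ /negPf]; rewrite eq_sym => ->; rewrite andbF.
      by case: new_step; rewrite ?expr0 // expr1 /weighted_var /ce slot_sym.
    over.
  by rewrite exchange_big; apply: eq_bigr => e _ /=; rewrite prodrXr.
have -> : K ^+ L = \prod_(e in slots n) K ^+ cnt e by rewrite prodrXr -LE.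
rewrite -prodrXr -!big_split /=; apply: ler_prod => e _.
rewrite mulr_ge0 ?normr_ge0 ?exprn_ge0 ?(ltW k0) //=.
have /andP[ce0 ceK] : 0 <= ce e <= K by exact: c_bound.
have := c1 e; have := fresh_le_cnt e; have := fresh_le1 e.
rewrite normrM normrX (ger0_norm ce0).
have powK m : ce e ^+ m <= K ^+ m by rewrite lerXn2r // nnegrE.
case: (fresh e) => [|[|//]] _.
  rewrite muln0 !expr0 mul1r mulr1 => _ _; apply: le_trans (powK _).
  by rewrite ler_piMr ?exprn_ge0 // noise_moment_le1.
case: (cnt e) => [|[|m]] // _ _; rewrite muln1 expr1.
have vm := noise_moment_le_var P01 e m; have ym := powK m.
have yv : ce e ^+ m * `|noise_moment P e m.+2| <= K ^+ m * edge_var P e.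
  by apply: ler_pM; rewrite ?exprn_ge0.
have KK : 0 <= K ^+ 2 * ce e ^+ 2 by rewrite mulr_ge0 ?sqr_ge0.
have := ler_wpM2l KK yv; rewrite (exprD K 2 m) (exprD (ce e) 2 m).
move: (K ^+ 2) (K ^+ m) (ce e ^+ 2) (ce e ^+ m) => a b d f.
move: (edge_var P e) `|_| => v w; lra.
Qed.

End OneWalk.

(** The bound of [walk_paired] has [kappa] to the power [2 * (2 * m)] minus four times
    the number of new steps.  By [free_step_bound] this is at least the number of free
    steps minus three, so every free step is given a factor [kappa], at the cost of a
    factor independent of the walk. *)
Lemma closed_walk_moment (z : nat -> 'I_n) m : (0 < m)%N ->
  z (2 * m)%N = z 0 ->
  (forall t, (0 < t < 2 * m)%N -> t != m -> z t.-1 != z t.+1) ->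
  expect P (fun E => \prod_(t < 2 * m) weighted_noise E (z t) (z t.+1)) <=
  (kappa ^+ 3)^-1 * \prod_(t < 2 * m) step_weight z t.
Proof.
move=> m0 closed nb; have /andP[k0 k1] := kappa01.
have W0 : 0 <= \prod_(t < 2 * m) step_weight z t.
  by apply: prodr_ge0 => t _; apply: step_weight_ge0.
pose cnt e := (\sum_(t < 2 * m) (slot (z t) (z t.+1) == e))%N.
case: (pselect (exists e, cnt e = 1%N)) => [[e c1]|no].
  by rewrite (walk_unpaired c1) mulr_ge0 // invr_ge0 exprn_ge0 // ltW.
have no1 e : cnt e != 1%N by apply/eqP => c1; apply: no; exists e.
have doubled t : (t < 2 * m)%N -> exists u, [&& (u < 2 * m)%N, u != t & same_edge z t u].
  move=> tm; have := no1 (slot (z t) (z t.+1)).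
  rewrite /cnt (bigD1 (Ordinal tm)) //= eqxx.
  case: (pickP (fun u : 'I_(2 * m) => (u != Ordinal tm) && same_edge z t u)).
    by move=> u /andP[ut stu] _; exists u; rewrite ltn_ord ut stu.
  move=> non; rewrite big1 // => u ut; have := non u; rewrite ut /= => ns.
  by rewrite eq_sym slot_eq -/(same_edge z t u) ns.
have := walk_paired no1; set EE := expect _ _ => pair.
have fb := free_step_bound m0 closed nb doubled.
set N := (\sum_(t < 2 * m) new_step z t)%N in pair fb.
set C := (\sum_(t < 2 * m) free_step z t)%N in fb.
have WE : \prod_(t < 2 * m) step_weight z t = kappa ^+ C *
    \prod_(t < 2 * m) (if new_step z t then weighted_var (z t) (z t.+1) else 1).
  rewrite /C -prodrXr -big_split; apply: eq_bigr => t _ /=.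
  rewrite /step_weight /free_step; case: new_step; rewrite /= ?expr0 ?mul1r //.
  by case: retracing_step; rewrite /= mulr1 ?expr0 ?expr1.
rewrite mulrC ler_pdivlMr ?exprn_gt0 //.
apply: (le_trans (ler_wpM2r _ (ler_norm _))); first by rewrite exprn_ge0 // ltW.
rewrite -(ler_pM2l (exprn_gt0 (4 * N) k0)).
rewrite mulrA [kappa ^+ (4 * N)](_ : _ = (kappa ^+ 2) ^+ (2 * N)); last first.
  by rewrite -exprM mulnA.
apply: (le_trans (ler_wpM2r _ pair)); first by rewrite exprn_ge0 // ltW.
rewrite WE -!exprM; set D := \prod_(t < 2 * m) (if _ then _ else _).
rewrite [leLHS]mulrAC [leRHS]mulrA -!exprD; apply: ler_wpM2r.
  apply: prodr_ge0 => t _; case: ifP => // _; exact: weighted_var_ge0.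
by apply: ler_wiXn2l => //; [exact: ltW | lia].
Qed.

End WalkMoment.

Section TupleSums.
Variables (R : realType) (T : finType).

Lemma sum_tuple_rcons L (F : seq T -> R) :
  \sum_(w : L.+1.-tuple T) F w = \sum_(w : L.-tuple T) \sum_v F (rcons w v).
Proof.
rewrite pair_big /= (reindex (fun q : L.-tuple T * T => [tuple of rcons q.1 q.2])) /=.
  by [].
exists (fun w : L.+1.-tuple T => ([tuple of belast (thead w) (behead w)], last (thead w) (behead w))).
  move=> [w v] _; congr pair => /=.
    apply: val_inj => /=; rewrite /thead (tnth_nth v) /=.
    by case: w => [[|a s] hs] //=; rewrite belast_rcons.
  rewrite /thead (tnth_nth v) /=.
  by case: w => [[|a s] hs] //=; rewrite last_rcons.
move=> w _; apply: val_inj => /=; rewrite -lastI.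
by rewrite [RHS](congr1 val (tuple_eta w)).
Qed.

Lemma sum_tuple0 (F : seq T -> R) : \sum_(w : 0.-tuple T) F w = F [::].
Proof.
by rewrite (big_pred1 [tuple]) // => w; apply/esym/eqP; exact: tuple0.
Qed.

Lemma nth_rcons_lt (x0 : T) w v t : (t < size w)%N ->
  nth x0 (rcons w v) t = nth x0 w t.
Proof. by move=> tw; rewrite nth_rcons tw. Qed.

Lemma mkseq_nth_rcons (x0 : T) w v : mkseq (nth x0 (rcons w v)) (size w) = w.
Proof.
apply: (@eq_from_nth _ x0); rewrite size_mkseq // => t tw.
by rewrite nth_mkseq // nth_rcons_lt.
Qed.

Lemma eq_mkseq_le (z z' : nat -> T) t : (forall r, (r < t)%N -> z r = z' r) ->
  mkseq z t = mkseq z' t.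
Proof. by move=> e; apply/eq_in_map => r; rewrite mem_iota => /e. Qed.

Lemma eq_new_step (z z' : nat -> T) t : (forall r, (r <= t.+1)%N -> z r = z' r) ->
  new_step z t = new_step z' t.
Proof.
by move=> e; rewrite /new_step e // (@eq_mkseq_le z z') // => r rt; apply: e; apply: ltnW.
Qed.

Lemma eq_first_visit (z z' : nat -> T) t : (forall r, (r <= t)%N -> z r = z' r) ->
  first_visit z t = first_visit z' t.
Proof. by move=> e; rewrite /first_visit e // (@eq_mkseq_le z z'). Qed.

Lemma eq_retracing_step (z z' : nat -> T) t : (forall r, (r <= t.+1)%N -> z r = z' r) ->
  retracing_step z t = retracing_step z' t.
Proof.
move=> e; have efv : first_visit z t = first_visit z' t.
  by apply: eq_first_visit => r rt; apply: e; apply: ltnW.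
rewrite /retracing_step efv; case: ltnP => //= lt.
by rewrite !e //; lia.
Qed.

End TupleSums.

Section WalkSum.
Variables (R : realType) (n : nat) (P c : 'M[R]_n) (kappa beta : R) (x0 : 'I_n).
Hypothesis P01 : forall i j, 0 <= P i j <= 1.
Hypothesis kappa01 : 0 < kappa <= 1.
Hypothesis beta01 : 0 < beta <= 1.
Hypothesis row_var : forall i, \sum_j weighted_var P c i j <= 1.

Let weight z t := step_weight P c kappa z t.
Let weight_ge0 z t : 0 <= weight z t := step_weight_ge0 c P01 kappa01 z t.

Lemma eq_step_weight (z z' : nat -> 'I_n) t : (forall r, (r <= t.+1)%N -> z r = z' r) ->
  weight z t = weight z' t.
Proof.
move=> e; rewrite /weight /step_weight (eq_new_step e) (eq_retracing_step e).
by rewrite !e.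
Qed.

(** A new step and a retracing step together would allow the total weight to double
    at each step.  But no retracing step follows a new step, and the factor [beta]
    after a new step keeps track of that: it brings the growth rate down to about
    [1 + beta]. *)
Definition potential (z : nat -> 'I_n) L : R :=
  (if (0 < L)%N && new_step z L.-1 then beta else 1) * \prod_(t < L) weight z t.

(** Given the past, the new steps have total weight at most [1] and bring a factor
    [beta]; there is at most one retracing step, and none after a new step, where
    [first_visit] is the present; the remaining steps go to one of at most [size w]
    visited vertices. *)
Lemma potential_step w : (0 < size w)%N -> (size w)%:R * kappa <= beta ^+ 2 ->
  \sum_v potential (nth x0 (rcons w v)) (size w) <=
  (1 + beta + beta ^+ 2) * potential (nth x0 w) (size w).-1.
Proof.
move=> w0 kb; have [k0 k1] := andP kappa01; have [b0 b1] := andP beta01.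
set L := (size w).-1; have wL : size w = L.+1 by rewrite prednK.
set z := nth x0 w; set W := \prod_(t < L) weight z t.
have W0 : 0 <= W by apply: prodr_ge0.
pose s := first_visit z L.
pose tgt := if z L.-1 == z s.-1 then z s.+1 else z s.-1.
have agree v r : (r <= L)%N -> nth x0 (rcons w v) r = z r.
  by move=> rL; rewrite nth_rcons_lt // wL.
have zv_last v : nth x0 (rcons w v) L.+1 = v by rewrite -wL nth_rcons ltnn eqxx.
have step v : potential (nth x0 (rcons w v)) (size w) <=
    W * (beta * weighted_var P c (z L) v + ((s < L)%N && (v == tgt))%:R +
      kappa * (v \in w)%:R).
  rewrite /potential wL /= big_ord_recr /= mulrCA.
  rewrite (eq_bigr (fun t : 'I_L => weight z t)); last first.
    by move=> t _; apply: eq_step_weight => r rt; apply: agree; exact: leq_trans rt (ltn_ord t).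
  rewrite -/W ler_wpM2l // /weight /step_weight.
  have newE : new_step (nth x0 (rcons w v)) L = (v \notin w).
    by rewrite /new_step zv_last -wL mkseq_nth_rcons.
  have retE : retracing_step (nth x0 (rcons w v)) L = (s < L)%N && (v == tgt).
    rewrite /retracing_step (eq_first_visit (z' := z)) -/s; last by move=> r; exact: agree.
    by case: ltnP => //= sL; rewrite zv_last !agree //; lia.
  rewrite newE retE agree // zv_last; case: (v \in w) => /=.
    have v0 := weighted_var_ge0 c P01 (z L) v; rewrite mul1r mulr1.
    have bv : 0 <= beta * weighted_var P c (z L) v by rewrite mulr_ge0 // ltW.
    by case: ifP => _ /=; lra.
  by rewrite mulr0 addr0 lerDl.
apply: (le_trans (ler_sum _ (fun v _ => step v))).
rewrite -big_distrr /= !big_split /= -!big_distrr /=.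
have s1 : beta * (\sum_v weighted_var P c (z L) v) <= beta.
  by rewrite ler_piMr // ltW.
have s2 : \sum_v ((s < L)%N && (v == tgt))%:R <= (s < L)%N%:R :> R.
  rewrite (bigD1 tgt) //= eqxx andbT big1 ?addr0 // => v /negPf->.
  by rewrite andbF.
have s3 : kappa * (\sum_v (v \in w)%:R) <= beta ^+ 2.
  apply: le_trans kb; rewrite mulrC ler_pM2r // -natr_sum ler_nat.
  apply: leq_trans (card_size w); rewrite -sum1_card [leqRHS]big_mkcond.
  by apply: leq_sum => v _; case: (v \in w).
rewrite /potential -/W [leRHS]mulrA [leRHS]mulrC ler_wpM2l //.
have b2 : 0 <= beta ^+ 2 by rewrite sqr_ge0.
have b3 : 0 <= beta ^+ 3 by rewrite exprn_ge0 // ltW.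
have [/andP[L0 nw]|_] := ifP; last first.
  have : (s < L)%N%:R <= 1 :> R by case: (s < L)%N.
  rewrite mulr1; lra.
have sE : s = L.
  apply: first_visitE => // r rL; apply: contraNneq nw => e.
  by rewrite prednK // -e; apply: mem_mkseq.
have : (s < L)%N%:R = 0 :> R by rewrite sE ltnn.
move=> e0; rewrite e0 in s2; rewrite !mulrDl mul1r -expr2 -exprSr; lra.
Qed.

Lemma sum_potential L : L%:R * kappa <= beta ^+ 2 ->
  \sum_(w : L.+1.-tuple 'I_n) potential (nth x0 w) L <=
  n%:R * (1 + beta + beta ^+ 2) ^+ L.
Proof.
have [k0 k1] := andP kappa01; have [b0 b1] := andP beta01.
elim: L => [|L IH] kb.
  rewrite (sum_tuple_rcons _ (fun w => potential (nth x0 w) 0)).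
  rewrite (sum_tuple0 (fun w => \sum_v potential (nth x0 (rcons w v)) 0)) expr0 mulr1.
  under eq_bigr do rewrite /potential big_ord0 mulr1 /=.
  by rewrite sumr_const card_ord.
rewrite (sum_tuple_rcons _ (fun w => potential (nth x0 w) L.+1)).
apply: (le_trans (y := \sum_(w : L.+1.-tuple 'I_n)
    (1 + beta + beta ^+ 2) * potential (nth x0 w) L)).
  apply: ler_sum => w _; have := @potential_step w; rewrite size_tuple /=.
  by apply.
rewrite -big_distrr /= [_ ^+ L.+1]exprS mulrCA ler_wpM2l //.
  by rewrite !addr_ge0 ?sqr_ge0 // ltW.
by apply: IH; apply: le_trans kb; rewrite ler_pM2r // ler_nat.
Qed.

Lemma sum_walk_weights L : L%:R * kappa <= beta ^+ 2 ->
  \sum_(w : L.+1.-tuple 'I_n) \prod_(t < L) weight (nth x0 w) t <=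
  n%:R * (1 + beta + beta ^+ 2) ^+ L / beta.
Proof.
have [b0 b1] := andP beta01 => kb; rewrite ler_pdivlMr // mulrC big_distrr /=.
apply: le_trans (sum_potential kb); apply: ler_sum => w _.
have W0 : 0 <= \prod_(t < L) weight (nth x0 w) t by apply: prodr_ge0.
by rewrite /potential ler_wpM2r //; case: ifP.
Qed.

End WalkSum.

Definition nonbacktracking (T : eqType) (z : nat -> T) m :=
  [forall t : 'I_m, (0 < t)%N ==> (z t.-1 != z t.+1)].

Definition walk_ends n (x0 : 'I_n) m (w : seq 'I_n) :=
  (nth x0 w 0, nth x0 w m.-1, nth x0 w m).

Definition walk_prod (R : realType) n (H : 'I_n -> 'I_n -> R) m (z : nat -> 'I_n) : R :=
  \prod_(t < m) H (z t) (z t.+1).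

(** An entry of a power of the weighted non-backtracking operator, indexed by the
    first vertex and the last directed edge of the walks. *)
Definition nb_power (R : realType) n (x0 : 'I_n) (H : 'I_n -> 'I_n -> R) m k : R :=
  \sum_(w : m.+1.-tuple 'I_n | nonbacktracking (nth x0 w) m && (walk_ends x0 m w == k))
    walk_prod H m (nth x0 w).

(** The squared Hilbert-Schmidt norm of that power. *)
Definition nb_energy (R : realType) n (x0 : 'I_n) (H : 'I_n -> 'I_n -> R) m : R :=
  \sum_k nb_power x0 H m k ^+ 2.

Section Energy.
Variables (R : realType) (n : nat) (x0 : 'I_n) (m : nat).
Hypothesis m0 : (0 < m)%N.

(** The walk [w] followed by the reversal of [w'], for walks of length [m] with the
    same last vertex. *)
Definition glue_fun (w w' : seq 'I_n) t :=
  if (t <= m)%N then nth x0 w t else nth x0 w' (2 * m - t).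
Definition glue (w w' : seq 'I_n) : (2 * m).+1.-tuple 'I_n :=
  [tuple glue_fun w w' t | t < (2 * m).+1].

Lemma nth_glue w w' t : (t <= 2 * m)%N -> nth x0 (glue w w') t = glue_fun w w' t.
Proof.
move=> tm; rewrite (_ : t = val (@Ordinal (2 * m).+1 t tm)) //.
by rewrite -tnth_nth tnth_mktuple.
Qed.

Lemma glue_left w w' t : (t <= m)%N -> nth x0 (glue w w') t = nth x0 w t.
Proof. by move=> tm; rewrite nth_glue /glue_fun ?tm //; lia. Qed.

Lemma glue_right w w' t : nth x0 w m = nth x0 w' m -> (m <= t <= 2 * m)%N ->
  nth x0 (glue w w') t = nth x0 w' (2 * m - t).
Proof.
move=> e /andP[mt tm]; rewrite nth_glue // /glue_fun.
case: leqP => // tm'; have -> : t = m by lia.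
by rewrite e; congr nth; lia.
Qed.

Lemma glue_inj (w1 w1' w2 w2' : m.+1.-tuple 'I_n) :
  nth x0 w1 m = nth x0 w1' m -> nth x0 w2 m = nth x0 w2' m ->
  glue w1 w1' = glue w2 w2' -> w1 = w2 /\ w1' = w2'.
Proof.
move=> e1 e2 eg; split; apply: val_inj; apply: (@eq_from_nth _ x0);
  rewrite ?size_tuple // => t; rewrite ltnS => tm.
  by rewrite -(glue_left _ w1') // eg glue_left.
have -> : t = (2 * m - (2 * m - t))%N by lia.
by rewrite -(glue_right e1) ?eg ?glue_right //; lia.
Qed.

Lemma glue_prod (H : 'I_n -> 'I_n -> R) w w' : (forall i j, H i j = H j i) ->
  nth x0 w m = nth x0 w' m ->
  walk_prod H (2 * m) (nth x0 (glue w w')) =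
  walk_prod H m (nth x0 w) * walk_prod H m (nth x0 w').
Proof.
move=> Hs e; rewrite /walk_prod.
rewrite -!(big_mkord xpredT (fun t => H (nth x0 _ t) (nth x0 _ t.+1))).
rewrite (@big_cat_nat _ _ _ m) //=; last by lia.
congr (_ * _); first by apply: eq_big_nat => t tm; rewrite !glue_left //; lia.
rewrite big_nat_rev -{1}(add0n m) big_addn.
have -> : (2 * m - m = m)%N by lia.
apply: eq_big_nat => t /andP[_ tm].
rewrite (glue_right (t := m + 2 * m - (t + m).+1) e); last by lia.
rewrite (glue_right (t := (m + 2 * m - (t + m).+1).+1) e); last by lia.
rewrite Hs; congr (H (nth x0 w' _) (nth x0 w' _)); lia.
Qed.

Lemma nb_energyE (H : 'I_n -> 'I_n -> R) :
  nb_energy x0 H m =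
  \sum_(p : m.+1.-tuple 'I_n * m.+1.-tuple 'I_n |
        [&& nonbacktracking (nth x0 p.1) m, nonbacktracking (nth x0 p.2) m &
            walk_ends x0 m p.1 == walk_ends x0 m p.2])
    walk_prod H m (nth x0 p.1) * walk_prod H m (nth x0 p.2).
Proof.
rewrite /nb_energy; under eq_bigr => k _.
  rewrite expr2 /nb_power big_distrl /=.
  under eq_bigr => w _ do rewrite big_distrr /=.
  rewrite pair_big /= big_mkcond /=.
  over.
rewrite exchange_big [RHS]big_mkcond; apply: eq_bigr => -[w w'] _ /=.
case: (nonbacktracking _ m) => /=; last by rewrite big1.
rewrite (bigD1 (walk_ends x0 m w)) //= eqxx /= big1 ?addr0.
  by rewrite [walk_ends _ _ w' == _]eq_sym.
by move=> k /negPf; rewrite eq_sym => ->.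
Qed.

Lemma nonbacktrackingP (z : nat -> 'I_n) k :
  reflect (forall t, (0 < t < k)%N -> z t.-1 != z t.+1) (nonbacktracking z k).
Proof.
apply: (iffP forallP) => [nb t /andP[t0 tk]|nb t].
  by have := nb (Ordinal tk); rewrite /= t0.
by apply/implyP => t0; apply: nb; rewrite t0 ltn_ord.
Qed.

Variables (P c : 'M[R]_n) (kappa beta : R).
Hypothesis P01 : forall i j, 0 <= P i j <= 1.
Hypothesis P_sym : forall i j, P i j = P j i.
Hypothesis c_sym : forall i j, c i j = c j i.
Hypothesis kappa01 : 0 < kappa <= 1.
Hypothesis c_bound : forall i j, 0 <= c i j <= kappa ^+ 2.
Hypothesis beta01 : 0 < beta <= 1.
Hypothesis row_var : forall i, \sum_j weighted_var P c i j <= 1.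

(** The energy is a sum over pairs of walks with the same ends.  The first walk
    followed by the reversal of the second is a closed walk of length [2 * m] that
    backtracks only in the middle, so that [closed_walk_moment] bounds its expectation
    and [sum_walk_weights] the sum over all of them. *)
Lemma expect_nb_energy : (2 * m)%:R * kappa <= beta ^+ 2 ->
  expect P (fun E => nb_energy x0 (weighted_noise P c E) m) <=
  (kappa ^+ 3)^-1 * (n%:R * (1 + beta + beta ^+ 2) ^+ (2 * m) / beta).
Proof.
move=> kb; have /andP[k0 k1] := kappa01.
pose Q (p : m.+1.-tuple 'I_n * m.+1.-tuple 'I_n) :=
  [&& nonbacktracking (nth x0 p.1) m, nonbacktracking (nth x0 p.2) m &
      walk_ends x0 m p.1 == walk_ends x0 m p.2].
pose wt z := \prod_(t < 2 * m) step_weight P c kappa z t.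
have wt0 z : 0 <= wt z by apply: prodr_ge0 => t _; apply: step_weight_ge0.
have -> : expect P (fun E => nb_energy x0 (weighted_noise P c E) m) =
    \sum_(p | Q p) expect P (fun E =>
      walk_prod (weighted_noise P c E) (2 * m) (nth x0 (glue p.1 p.2))).
  rewrite -expect_sum; apply: eq_expect => E _; rewrite nb_energyE.
  apply: eq_bigr => -[w w'] /and3P[_ _ /eqP[_ _ e]]; rewrite glue_prod //.
  by move=> i j; apply: weighted_noise_sym.
apply: (le_trans (y := \sum_(p | Q p) (kappa ^+ 3)^-1 * wt (nth x0 (glue p.1 p.2)))).
  apply: ler_sum => -[w w'] /and3P[/nonbacktrackingP nb /nonbacktrackingP nb' /eqP[e0 _ e]].
  apply: closed_walk_moment => //.
    rewrite (glue_left _ _ (leq0n m)) (glue_right (t := 2 * m) e); last by lia.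
    by rewrite subnn e0.
  move=> t /andP[t0 t2m] tm; case: (ltnP t m) => tm'.
    by rewrite !glue_left ?nb ?t0 //; lia.
  rewrite !(glue_right e); try lia.
  have := nb' (2 * m - t)%N; rewrite eq_sym.
  have -> : (2 * m - t.+1 = (2 * m - t).-1)%N by lia.
  have -> : (2 * m - t.-1 = (2 * m - t).+1)%N by lia.
  by apply; lia.
rewrite -big_distrr ler_wpM2l ?invr_ge0 ?exprn_ge0 ?(ltW k0) //.
have := sum_walk_weights x0 P01 kappa01 beta01 row_var kb; apply: le_trans.
pose gl (p : m.+1.-tuple 'I_n * m.+1.-tuple 'I_n) := glue p.1 p.2.
have injQ : {in Q &, injective gl}.
  move=> [w w'] [v v'] /and3P[_ _ /eqP[_ _ e]] /and3P[_ _ /eqP[_ _ e']] eg.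
  by have [-> ->] := glue_inj e e' eg.
have -> : \sum_(p | Q p) wt (nth x0 (glue p.1 p.2)) =
    \sum_(w in gl @: Q) wt (nth x0 w).
  by rewrite (big_imset (fun w : (2 * m).+1.-tuple 'I_n => wt (nth x0 w)) injQ).
rewrite [leLHS]big_mkcond; apply: ler_sum => w _; case: ifP => // _.
exact: (wt0 (nth x0 w)).
Qed.

End Energy.

(** * Spectral decomposition and perturbation of real symmetric matrices *)

Lemma prod_XsubC_perm (F : fieldType) (s t : seq F) :
  \prod_(x <- s) ('X - x%:P) = \prod_(x <- t) ('X - x%:P) -> perm_eq s t.
Proof.
elim: s t => [|x s IH] t e.
  have := congr1 (fun p : {poly F} => size p) e.
  by rewrite !size_prod_XsubC => -[/esym/size0nil->].
have xt : x \in t by rewrite -root_prod_XsubC -e root_prod_XsubC mem_head.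
rewrite perm_sym (perm_trans (perm_to_rem xt)) // perm_cons perm_sym; apply: IH.
apply: (mulfI (negbT (polyXsubC_eq0 x))).
by rewrite big_cons in e; rewrite e (perm_big _ (perm_to_rem xt)) big_cons.
Qed.

Section Spectral.
Variable R : realType.

Definition sqnorm n (x : 'I_n -> R) : R := \sum_i x i ^+ 2.
Definition quad n (M : 'M[R]_n) (x : 'I_n -> R) : R :=
  \sum_i \sum_j x i * M i j * x j.

Lemma sqnorm_ge0 n (x : 'I_n -> R) : 0 <= sqnorm x.
Proof. by apply: sumr_ge0 => i _; rewrite sqr_ge0. Qed.

Lemma cauchy_schwarz (I : finType) (A : pred I) (a b : I -> R) :
  (\sum_(i | A i) a i * b i) ^+ 2 <=
  (\sum_(i | A i) a i ^+ 2) * (\sum_(i | A i) b i ^+ 2).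
Proof.
have h : 0 <= \sum_(i | A i) \sum_(j | A j) (a i * b j - a j * b i) ^+ 2.
  by apply: sumr_ge0 => i _; apply: sumr_ge0 => j _; rewrite sqr_ge0.
suff e : \sum_(i | A i) \sum_(j | A j) (a i * b j - a j * b i) ^+ 2 =
  2 * ((\sum_(i | A i) a i ^+ 2) * (\sum_(i | A i) b i ^+ 2) -
       (\sum_(i | A i) a i * b i) ^+ 2) by lra.
have -> : \sum_(i | A i) \sum_(j | A j) (a i * b j - a j * b i) ^+ 2 =
    \sum_(i | A i) \sum_(j | A j) (a i ^+ 2 * b j ^+ 2) +
    \sum_(i | A i) \sum_(j | A j) (b i ^+ 2 * a j ^+ 2) -
    2 * (\sum_(i | A i) \sum_(j | A j) (a i * b i) * (a j * b j)).
  rewrite big_distrr /= -!sumrN -!big_split /=; apply: eq_bigr => i _.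
  rewrite big_distrr /= -sumrN -!big_split /=; apply: eq_bigr => j _.
  ring.
have prodE (f g : I -> R) : \sum_(i | A i) \sum_(j | A j) f i * g j =
    (\sum_(i | A i) f i) * (\sum_(i | A i) g i).
  by rewrite big_distrl; apply: eq_bigr => i _; rewrite big_distrr.
rewrite (prodE (fun i => a i ^+ 2) (fun j => b j ^+ 2)).
rewrite (prodE (fun i => b i ^+ 2) (fun j => a j ^+ 2)).
rewrite (prodE (fun i => a i * b i) (fun j => a j * b j)).
rewrite expr2; ring.
Qed.

(** Unless [u] is the first basis vector [e], the reflection in the hyperplane
    orthogonal to [e - u] exchanges the two. *)
Lemma householder n (u : 'rV[R]_(1 + n)) : (u *m u^T) 0 0 = 1 ->
  exists Q : 'M[R]_(1 + n), [/\ Q^T = Q, Q *m Q = 1%:M & row 0 Q = u].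
Proof.
move=> u1; pose e : 'rV[R]_(1 + n) := delta_mx 0 0; pose w := e - u.
pose s := (w *m w^T) 0 0.
have sE : s = 2 - 2 * u 0 0.
  rewrite /s /w linearB /= mulmxBl !mulmxBr !mxE.
  have -> : \sum_j u 0 j * u^T j 0 = 1 by rewrite -u1 mxE.
  have -> : \sum_j e 0 j * e^T j 0 = 1.
    rewrite (bigD1 0) //= !mxE eqxx mulr1 big1 ?addr0 // => j /negPf j0.
    by rewrite !mxE j0 mul0r.
  have -> : \sum_j e 0 j * u^T j 0 = u 0 0.
    rewrite (bigD1 0) //= !mxE eqxx mul1r big1 ?addr0 // => j /negPf j0.
    by rewrite !mxE j0 mul0r.
  have -> : \sum_j u 0 j * e^T j 0 = u 0 0.
    rewrite (bigD1 0) //= !mxE eqxx mulr1 big1 ?addr0 // => j /negPf j0.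
    by rewrite !mxE j0 mulr0.
  ring.
have sM : w *m w^T = s%:M by apply/matrixP => i j; rewrite !ord1 [RHS]mxE eqxx mulr1n.
case: (eqVneq s 0) => [s0|s0].
  exists 1%:M; split; rewrite ?trmx1 ?mulmx1 //.
  have w0 : w = 0.
    have h : \sum_k w 0 k ^+ 2 = 0.
      rewrite -[RHS]s0 /s [RHS]mxE; apply: eq_bigr => k _.
      by rewrite [w^T k 0]mxE expr2.
    apply/rowP => j; rewrite [RHS]mxE; apply/eqP; rewrite -sqrf_eq0 eq_le sqr_ge0 andbT.
    rewrite -[leRHS]h (bigD1 j) //= lerDl.
    by apply: sumr_ge0 => i _; rewrite sqr_ge0.
  by rewrite rowE mulmx1 -/e; apply/eqP; rewrite -subr_eq0 -/w w0.
exists (1%:M - (2 / s) *: (w^T *m w)); split.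
- by rewrite linearB /= linearZ /= trmx1 trmx_mul trmxK.
- have : (w^T *m w) *m (w^T *m w) = s *: (w^T *m w).
    by rewrite mulmxA -(mulmxA w^T w) sM mul_mx_scalar -scalemxAl.
  move: (w^T *m w) => W WW.
  rewrite mulmxBl mul1mx mulmxBr mulmx1 -scalemxAl -scalemxAr WW.
  by apply/matrixP => i j; rewrite !mxE; field.
- rewrite rowE -/e mulmxBr mulmx1 -scalemxAr mulmxA.
  have -> : e *m w^T = (1 - u 0 0)%:M.
    apply/matrixP => i j; rewrite !ord1 [RHS]mxE eqxx mulr1n mxE (bigD1 0) //= big1.
      by rewrite !mxE eqxx addr0 mul1r.
    by move=> k /negPf k0; rewrite !mxE k0 mul0r.
  rewrite mul_scalar_mx scalerA.
  have -> : 2 / s * (1 - u 0 0) = 1 by rewrite sE; field; rewrite -sE.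
  by rewrite scale1r /w opprB addrC subrK.
Qed.

(** Deflation: an eigenvector exists because the characteristic polynomial splits, a
    Householder reflection makes it the first basis vector, and by symmetry the rest of
    the first row and column vanishes. *)
Lemma spectral_exists n (M : 'M[R]_n) : M^T = M ->
  exists P : 'M[R]_n, exists d : 'rV[R]_n,
    P *m P^T = 1%:M /\ M = P^T *m diag_mx d *m P.
Proof.
elim: n M => [|n IH] M Ms.
  by exists 1%:M, 0; split; apply/matrixP => -[].
have [sE szE chE] := eigvalsP Ms.
case: (eigvals M) szE chE {sE} => [//|a s] _ chE.
have : eigenvalue M a.
  by rewrite eigenvalue_root_char chE root_prod_XsubC mem_head.
move=> /eigenvalueP[v va v0].
have vv : 0 < (v *m v^T) 0 0.
  rewrite mxE lt_neqAle; apply/andP; split; last first.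
    by apply: sumr_ge0 => j _; rewrite mxE -expr2 sqr_ge0.
  rewrite eq_sym psumr_neq0; last by move=> j _; rewrite mxE -expr2 sqr_ge0.
  case/rV0Pn: v0 => j vj; apply/hasP; exists j; rewrite ?mem_index_enum //=.
  by rewrite mxE -expr2 exprn_even_gt0.
pose r := Num.sqrt ((v *m v^T) 0 0); have r0 : 0 < r by rewrite sqrtr_gt0.
pose u : 'rV[R]_(1 + n) := r^-1 *: v.
have u1 : (u *m u^T) 0 0 = 1.
  rewrite /u linearZ /= -scalemxAl -scalemxAr scalerA !mxE -invfM -expr2.
  have <- : r ^+ 2 = \sum_j v 0 j * v^T j 0 by rewrite sqr_sqrtr ?ltW // mxE.
  by rewrite mulVf // expf_neq0 // gt_eqF.
have ua : u *m (M : 'M_(1 + n)) = a *: u.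
  by rewrite /u -scalemxAl va !scalerA mulrC.
have [Q [Qs QQ Qu]] := householder u1.
pose N : 'M[R]_(1 + n) := Q *m M *m Q.
have Ns : N^T = N by rewrite /N !trmx_mul Qs Ms mulmxA.
have N0 : row 0 N = a *: delta_mx 0 0.
  rewrite /N !row_mul Qu ua -scalemxAl -Qu -row_mul QQ; congr (_ *: _).
  by rewrite rowE mulmx1.
have MN : M = Q *m N *m Q :> 'M_(1 + n).
  by rewrite /N !mulmxA QQ mul1mx -mulmxA QQ mulmx1.
clearbody N.
have drs : (drsubmx N)^T = drsubmx N by rewrite trmx_drsub Ns.
have [P' [d' [PP' dE']]] := IH (drsubmx N) drs.
pose B : 'M[R]_(1 + n) := block_mx 1%:M 0 0 P'.
pose d : 'rV[R]_(1 + n) := row_mx (const_mx a) d'.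
have BB : B *m B^T = 1%:M.
  rewrite tr_block_mx mulmx_block !trmx0 trmx1 !mulmx0 !mul0mx !addr0 !add0r.
  by rewrite mulmx1 PP' -scalar_mx_block.
have BdB : B^T *m diag_mx d *m B = N; last first.
  exists (B *m Q), d; rewrite trmx_mul Qs; split.
    by rewrite mulmxA -(mulmxA B) QQ mulmx1.
  by rewrite MN -BdB !mulmxA.
rewrite /B /d diag_mx_row tr_block_mx !mulmx_block.
rewrite !trmx0 trmx1 !mulmx0 !mul0mx !mulmx1 !mul1mx !addr0 !add0r.
rewrite -dE' ?mul0mx ?mulmx0 -[RHS]submxK; congr block_mx.
- apply/matrixP => i j; rewrite !ord1 !mxE /=.
  have := congr1 (fun z : 'rV_(1 + n) => z 0 0) N0; rewrite !mxE !eqxx /= mulr1.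
  by rewrite !lshift0 => ->; rewrite mulr1n.
- apply/matrixP => i j; rewrite !ord1 !mxE /=.
  have := congr1 (fun z : 'rV_(1 + n) => z 0 (rshift 1 j)) N0; rewrite !mxE /=.
  by rewrite !lshift0 => ->; rewrite mulr0.
- apply/matrixP => i j; rewrite !ord1 !mxE /= -Ns mxE.
  have := congr1 (fun z : 'rV_(1 + n) => z 0 (rshift 1 i)) N0; rewrite !mxE /=.
  by rewrite !lshift0 => ->; rewrite mulr0.
Qed.

(** The rows of [P] are an orthonormal eigenbasis.  Listing them by increasing
    eigenvalue is a permutation of the diagonalization of [spectral_exists], because
    [eigvals] and the diagonal are the roots of the same polynomial. *)
Theorem spectral_theorem n (M : 'M[R]_n) : M^T = M ->
  exists P : 'M[R]_n,
    [/\ forall x, \sum_j (\sum_k P j k * x k) ^+ 2 = sqnorm x,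
        forall a b, M a b = \sum_j lambda M j * (P j a * P j b),
        forall a b, \sum_k P a k * P b k = (a == b)%:R &
        forall a b, \sum_j P j a * P j b = (a == b)%:R].
Proof.
move=> Ms; have [P [d [PP ME]]] := spectral_exists Ms.
have PP' : P^T *m P = 1%:M by apply: mulmx1C.
have [sE szE chE] := eigvalsP Ms.
have : perm_eq (eigvals M) [tuple d 0 i | i < n].
  apply: prod_XsubC_perm; rewrite -chE.
  have uP : P \in unitmx by case/mulmx1_unit: PP.
  have iP : invmx P = P^T by rewrite -[RHS]mulmx1 -(mulmxV uP) mulmxA PP' mul1mx.
  rewrite ME -iP char_poly_conj // char_poly_trig ?diag_mx_is_trig //.
  by rewrite big_map big_enum /=; apply: eq_bigr => i _; rewrite mxE eqxx mulr1n.
move=> /tuple_permP[s eE].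
have lamE i : lambda M i = d 0 (s i).
  by rewrite /lambda eE -tnth_nth !tnth_mktuple.
exists (row_perm s P); split.
- move=> x; pose X : 'cV[R]_n := \col_k x k.
  rewrite (reindex_inj (h := (s^-1)%g)) /=; last exact: perm_inj.
  have coordE j : \sum_k row_perm s P ((s^-1)%g j) k * x k = (P *m X) j 0.
    by rewrite [RHS]mxE; apply: eq_bigr => k _; rewrite !mxE permKV.
  under eq_bigr do rewrite coordE.
  transitivity (((P *m X)^T *m (P *m X)) 0 0).
    by rewrite [RHS]mxE; apply: eq_bigr => j _; rewrite [_^T 0 j]mxE expr2.
  rewrite trmx_mul mulmxA -(mulmxA X^T) PP' mulmx1 mxE.
  by apply: eq_bigr => j _; rewrite !mxE expr2.
- move=> a b; rewrite {1}ME mxE.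
  rewrite [RHS](reindex_inj (h := (s^-1)%g)) /=; last exact: perm_inj.
  apply: eq_bigr => j _; rewrite lamE permKV !mxE permKV (bigD1 j) //= big1.
    by rewrite !mxE eqxx mulr1n addr0; ring.
  by move=> k /negPf kj; rewrite !mxE kj mulr0n mulr0.
- move=> a b; have := congr1 (fun A : 'M_n => A (s a) (s b)) PP; rewrite !mxE.
  rewrite (inj_eq perm_inj) => <-.
  by apply: eq_bigr => k _; rewrite !mxE.
- move=> a b; have := congr1 (fun A : 'M_n => A a b) PP'; rewrite !mxE => <-.
  rewrite (reindex_inj (h := (s^-1)%g)) /=; last exact: perm_inj.
  by apply: eq_bigr => k _; rewrite !mxE permKV.
Qed.

Lemma quad_spectral n (M P : 'M[R]_n) (d : 'I_n -> R) (x : 'I_n -> R) :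
  (forall a b, M a b = \sum_j d j * (P j a * P j b)) ->
  quad M x = \sum_j d j * (\sum_k P j k * x k) ^+ 2.
Proof.
move=> ME; rewrite /quad.
under eq_bigr => a _. under eq_bigr => b _.
  rewrite ME big_distrr big_distrl /=. over. over.
under eq_bigr => a _ do rewrite exchange_big.
rewrite exchange_big; apply: eq_bigr => j _ /=.
rewrite expr2 big_distrl big_distrr; apply: eq_bigr => a _ /=.
rewrite mulrCA big_distrr /=; rewrite big_distrr; apply: eq_bigr => b _ /=; ring.
Qed.

Lemma lambda_le n (M : 'M[R]_n) (i j : 'I_n) : M^T = M -> (i <= j)%N ->
  lambda M i <= lambda M j.
Proof.
move=> Ms ij; have [sE szE _] := eigvalsP Ms.
by apply: (sorted_leq_nth le_trans le_refl 0 sE); rewrite ?inE ?szE.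
Qed.

(** Weyl's inequality. Requiring the [i] lowest coordinates in one eigenbasis and
    the [n - 1 - i] highest ones in the other to vanish leaves a nonzero vector. *)
Lemma weyl_le n (A B : 'M[R]_n) c : A^T = A -> B^T = B ->
  (forall x, quad B x - quad A x <= c * sqnorm x) ->
  forall i, lambda B i <= lambda A i + c.
Proof.
move=> As Bs le i.
have [PA [nA AE _ _]] := spectral_theorem As; have [PB [nB BE _ _]] := spectral_theorem Bs.
pose C : 'M[R]_n := \matrix_(j, k)
  (if (j < i)%N then PB j k else if (i < j)%N then PA j k else 0).
have : \det C^T == 0.
  rewrite det_tr (expand_det_row _ i) big1 // => k _.
  by rewrite mxE ltnn mul0r.
move=> /det0P[v v0 vC]; pose x k := v 0 k.
have vCj j : \sum_k C j k * x k = 0.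
  have := congr1 (fun w : 'rV_n => w 0 j) vC; rewrite !mxE => e.
  by rewrite -[RHS]e; apply: eq_bigr => k _; rewrite [C^T _ _]mxE mulrC.
have x0 : 0 < sqnorm x.
  rewrite lt_neqAle sqnorm_ge0 andbT eq_sym psumr_neq0; last by move=> k _; rewrite sqr_ge0.
  case/rV0Pn: v0 => k vk; apply/hasP; exists k; rewrite ?mem_index_enum //=.
  by rewrite exprn_even_gt0.
have qA : quad A x <= lambda A i * sqnorm x.
  rewrite (quad_spectral x AE) -nA big_distrr; apply: ler_sum => j _ /=.
  case: (leqP j i) => ij; first by rewrite ler_wpM2r ?sqr_ge0 // lambda_le.
  have -> : \sum_k PA j k * x k = 0; last rewrite expr0n !mulr0 //.
    rewrite -[RHS](vCj j); apply: eq_bigr => k _.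
    by rewrite /C mxE ij ltnNge (ltnW ij).
have qB : lambda B i * sqnorm x <= quad B x.
  rewrite (quad_spectral x BE) -nB big_distrr; apply: ler_sum => j _ /=.
  case: (leqP i j) => ij; first by rewrite ler_wpM2r ?sqr_ge0 // lambda_le.
  have -> : \sum_k PB j k * x k = 0; last rewrite expr0n !mulr0 //.
    by rewrite -[RHS](vCj j); apply: eq_bigr => k _; rewrite /C mxE ij.
rewrite -(ler_pM2r x0) mulrDl; have := le x; lra.
Qed.

Lemma weyl n (A B : 'M[R]_n) c : A^T = A -> B^T = B ->
  (forall x, `|quad A x - quad B x| <= c * sqnorm x) ->
  forall i, `|lambda A i - lambda B i| <= c.
Proof.
move=> As Bs le i; rewrite ler_norml; apply/andP; split.
  rewrite lerNl opprB lerBlDl; apply: weyl_le => // x.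
  by have := le x; rewrite distrC => /ler_normlP[].
by rewrite lerBlDl; apply: weyl_le => // x; have /ler_normlP[] := le x.
Qed.

Lemma lambda_min_quad n (M : 'M[R]_n) (i0 : 'I_n) x : M^T = M -> i0 = 0%N :> nat ->
  lambda M i0 * sqnorm x <= quad M x.
Proof.
move=> Ms i00; have [P [nP ME _ _]] := spectral_theorem Ms.
rewrite (quad_spectral x ME) -nP big_distrr; apply: ler_sum => j _ /=.
by rewrite ler_wpM2r ?sqr_ge0 // lambda_le // i00.
Qed.

Lemma lambda_eigenvector n (M : 'M[R]_n) i : M^T = M ->
  exists2 x : 'I_n -> R, sqnorm x = 1 &
    forall a, \sum_b M a b * x b = lambda M i * x a.
Proof.
move=> Ms; have [P [nP ME oP _]] := spectral_theorem Ms.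
exists (P i).
  transitivity (\sum_k P i k * P i k); last by rewrite oP eqxx.
  by apply: eq_bigr => k _; rewrite expr2.
move=> a; under eq_bigr => b _ do rewrite ME big_distrl /=.
rewrite exchange_big (bigD1 i) //= [X in _ + X]big1 => [|j ji].
  rewrite addr0; transitivity (\sum_b lambda M i * P i a * (P i b * P i b)).
    by apply: eq_bigr => b _; ring.
  by rewrite -big_distrr /= oP eqxx mulr1.
transitivity (\sum_b lambda M j * P j a * (P j b * P i b)).
  by apply: eq_bigr => b _; ring.
by rewrite -big_distrr /= oP (negPf ji) mulr0.
Qed.

Lemma quad_eigenvector n (M : 'M[R]_n) (c : R) x :
  (forall a, \sum_b M a b * x b = c * x a) -> quad M x = c * sqnorm x.
Proof.
move=> e; rewrite /quad /sqnorm big_distrr; apply: eq_bigr => a _ /=.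
under eq_bigr => b _ do rewrite -mulrA.
by rewrite -big_distrr /= e; ring.
Qed.

Lemma eigvals_lambda n (M : 'M[R]_n) : M^T = M ->
  eigvals M = [seq lambda M i | i <- enum 'I_n].
Proof.
move=> Ms; have [_ sz _] := eigvalsP Ms.
have szE : size [seq lambda M i | i <- enum 'I_n] = n by rewrite size_map size_enum_ord.
apply: (@eq_from_nth _ 0); rewrite sz ?szE // => i im.
by rewrite (nth_map (Ordinal im)) ?size_enum_ord // /lambda nth_enum_ord.
Qed.

End Spectral.

(** * From non-backtracking walks to the spectral norm *)

Lemma sqr_le_quarter (R : realType) (x : R) : `|x| <= 1 / 2 -> x ^+ 2 <= 1 / 4.
Proof. by rewrite ler_norml => /andP[]; nra. Qed.

Section NonBacktracking.
Variables (R : realType) (n : nat) (x0 : 'I_n) (h : 'I_n -> 'I_n -> R).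
Hypothesis h_sym : forall i j, h i j = h j i.
Hypothesis h_half : forall i j, `|h i j| <= 1 / 2.

Definition ihara_gap (s : R) i j := s ^+ 2 - h i j ^+ 2.

(** The vertex matrix of the weighted Ihara-Bass formula: its kernel lifts to the
    eigenfunctions, for the eigenvalue [s], of the non-backtracking operator with
    weights [h].  To leading order it is [1 + r / s ^ 2 - h / s], where the diagonal
    matrix [r] has the row sums of the squares of [h]. *)
Definition ihara_pencil (s : R) : 'M[R]_n :=
  \matrix_(i, j) ((i == j)%:R * (1 + \sum_k h i k ^+ 2 / ihara_gap s i k)
                  - s * h i j / ihara_gap s i j).

Lemma h_sqr i j : h i j ^+ 2 <= 1 / 4.
Proof. exact: sqr_le_quarter. Qed.

Lemma ihara_gap_ge s i j : 1 <= s -> 3 / 4 * s ^+ 2 <= ihara_gap s i j.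
Proof. by move=> s1; have := h_sqr i j; rewrite /ihara_gap; nra. Qed.

Lemma ihara_gap_gt0 s i j : 1 <= s -> 0 < ihara_gap s i j.
Proof.
move=> s1; apply: lt_le_trans (ihara_gap_ge i j s1).
by rewrite mulr_gt0 ?exprn_gt0 //; lra.
Qed.

Lemma ihara_gapC s i j : ihara_gap s i j = ihara_gap s j i.
Proof. by rewrite /ihara_gap h_sym. Qed.

Lemma ihara_pencil_sym s : (ihara_pencil s)^T = ihara_pencil s.
Proof.
apply/matrixP => i j; rewrite !mxE ihara_gapC (h_sym j i).
by case: (eqVneq i j) => [->|] //; rewrite !mul0r.
Qed.

Section Kernel.
Variables (s : R) (S : 'I_n -> R).
Hypothesis s1 : 1 <= s.
Hypothesis kerS : forall i, \sum_j ihara_pencil s i j * S j = 0.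

(** The function on directed edges into which a kernel vector [S] lifts;
    [edge_fun_step] says that it is an eigenfunction of the non-backtracking operator
    for the eigenvalue [s]. *)
Definition edge_fun i j := (s * S j - h i j * S i) / ihara_gap s i j.

Lemma edge_fun_sum i : S i = \sum_j h i j * edge_fun i j.
Proof.
have := kerS i; under eq_bigr => j _ do rewrite mxE mulrBl.
rewrite sumrB (bigD1 i) //= eqxx mul1r [X in _ + X - _]big1 => [|j /negPf ji]; last first.
  by rewrite eq_sym ji !mul0r.
rewrite addr0 mulrDl mul1r big_distrl /= => /eqP; rewrite subr_eq0 => /eqP e.
under eq_bigr => j _ do rewrite /edge_fun mulrA mulrBr mulrBl.
rewrite sumrB -[LHS](addrK (\sum_j h i j ^+ 2 / ihara_gap s i j * S i)) e.
by congr (_ - _); apply: eq_bigr => j _; ring.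
Qed.

Lemma edge_fun_swap i j : s * edge_fun i j = S j - h i j * edge_fun j i.
Proof.
rewrite /edge_fun -(ihara_gapC s i j) (h_sym j i).
have := gt_eqF (ihara_gap_gt0 i j s1); rewrite /ihara_gap => /negbT ne.
by field.
Qed.

Lemma edge_fun_step i j : s * edge_fun i j = \sum_(k | k != i) h j k * edge_fun j k.
Proof. by rewrite edge_fun_swap {1}(edge_fun_sum j) (bigD1 i) //= h_sym; ring. Qed.

Lemma nonbacktracking_rcons l w v : size w = l.+2 ->
  nonbacktracking (nth x0 (rcons w v)) l.+2 =
  nonbacktracking (nth x0 w) l.+1 && (v != nth x0 w l).
Proof.
move=> sw; have lt t : (t <= l.+1)%N -> nth x0 (rcons w v) t = nth x0 w t.
  by move=> tl; rewrite nth_rcons_lt // sw.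
have lst : nth x0 (rcons w v) l.+2 = v by rewrite nth_rcons sw ltnn eqxx.
apply/nonbacktrackingP/andP => [nb|[/nonbacktrackingP nb ne] t /andP[t0]].
  split; last by have := nb l.+1; rewrite /= lst lt // eq_sym; apply; rewrite ltnS leqnn.
  apply/nonbacktrackingP => t /andP[t0 tl].
  by have := nb t; rewrite !lt ?t0; [apply|..]; lia.
rewrite ltnS leq_eqVlt => /orP[/eqP->|tl]; first by rewrite /= lst lt // eq_sym.
by rewrite !lt ?nb ?t0 //; lia.
Qed.

(** The eigenvalue equation [edge_fun_step], iterated [l] times. *)
Lemma nb_walk_expansion l i :
  s ^+ l * S i = \sum_(w : l.+2.-tuple 'I_n |
      nonbacktracking (nth x0 w) l.+1 && (nth x0 w 0 == i))
    walk_prod h l.+1 (nth x0 w) * edge_fun (nth x0 w l) (nth x0 w l.+1).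
Proof.
pose F l (w : seq 'I_n) : R :=
  if nonbacktracking (nth x0 w) l.+1 && (nth x0 w 0 == i)
  then walk_prod h l.+1 (nth x0 w) * edge_fun (nth x0 w l) (nth x0 w l.+1) else 0.
rewrite [RHS]big_mkcond /= -/(F l _); elim: l => [|l IH].
  rewrite expr0 mul1r (sum_tuple_rcons _ (F 0%N)).
  rewrite (sum_tuple_rcons _ (fun w => \sum_v F 0%N (rcons w v))).
  rewrite (sum_tuple0 (fun w => \sum_u \sum_v F 0%N (rcons (rcons w u) v))) /=.
  rewrite edge_fun_sum [RHS](bigD1 i) //= [X in _ = _ + X]big1 ?addr0 => [|u ui]; last first.
    by rewrite big1 // => v _; rewrite /F /= (negPf ui) andbF.
  apply: eq_bigr => v _; rewrite /F /= eqxx andbT /walk_prod big_ord_recl big_ord0 mulr1 /=.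
  have -> : nonbacktracking (nth x0 [:: i; v]) 1 by apply/nonbacktrackingP => t; lia.
  by [].
rewrite exprS -mulrA IH big_distrr /= (sum_tuple_rcons _ (F l.+1)).
apply: eq_bigr => w _; have sw : size w = l.+2 by rewrite size_tuple.
rewrite {1}/F; case: ifP => [/andP[nb w0]|nw]; last first.
  rewrite mulr0 big1 // => v _; rewrite /F nonbacktracking_rcons // nth_rcons_lt ?sw //.
  by rewrite andbAC nw.
rewrite mulrCA edge_fun_step big_distrr [LHS]big_mkcond; apply: eq_bigr => v _ /=.
rewrite /F nonbacktracking_rcons // nb /= nth_rcons_lt ?sw // w0 andbT.
case: ifP => // _.
have lst : nth x0 (rcons w v) l.+2 = v by rewrite nth_rcons sw ltnn eqxx.
rewrite lst nth_rcons_lt ?sw // /walk_prod [in RHS]big_ord_recr /= lst nth_rcons_lt ?sw //.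
rewrite mulrA; congr (_ * _ * _).
apply: eq_bigr => t _; rewrite !nth_rcons_lt // sw; have := ltn_ord t; lia.
Qed.

Lemma edge_fun_sqr i j : edge_fun i j ^+ 2 <= 4 * S j ^+ 2 + S i ^+ 2.
Proof.
have g0 := ihara_gap_gt0 i j s1; have ge := ihara_gap_ge i j s1.
have x2 := h_sqr i j; rewrite /edge_fun.
move: (ihara_gap s i j) (h i j) (S i) (S j) g0 ge x2 => g x a b g0 ge x2.
have s1' := s1; have ss : s <= s ^+ 2 by rewrite expr2 -[leLHS]mulr1 ler_wpM2l //; exact: le_trans ler01 s1.
have g1 : 3 / 4 * s <= g by lra.
rewrite expr_div_n ler_pdivrMr ?exprn_gt0 //.
have gg : 9 / 16 * s ^+ 2 <= g ^+ 2.
  have : (3 / 4 * s) ^+ 2 <= g ^+ 2 by rewrite ler_sqr ?nnegrE; lra.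
  by rewrite exprMn; lra.
have sq : (s * b - x * a) ^+ 2 <= 2 * (s ^+ 2 * b ^+ 2) + 2 * (x ^+ 2 * a ^+ 2).
  by have := sqr_ge0 (s * b + x * a); lra.
have h1 : x ^+ 2 * a ^+ 2 <= 1 / 4 * a ^+ 2 by rewrite ler_wpM2r ?sqr_ge0.
have s2 : 1 <= s ^+ 2 by lra.
have h2 : a ^+ 2 <= s ^+ 2 * a ^+ 2 by rewrite ler_peMl ?sqr_ge0.
have h3 := ler_wpM2r (sqr_ge0 a) gg; have h4 := ler_wpM2r (sqr_ge0 b) gg.
have h5 : 0 <= s ^+ 2 * b ^+ 2 by rewrite mulr_ge0 ?sqr_ge0.
have h6 := sqr_ge0 a.
lra.
Qed.

(** By [nb_walk_expansion], powers of the non-backtracking operator map [edge_fun]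
    to [s ^ l] times [S], and [edge_fun] is not much larger than [S].  So a nonzero
    kernel vector forces the energy to be large, by the Cauchy-Schwarz inequality. *)
Lemma nb_growth l : 0 < sqnorm S ->
  s ^+ (2 * l) <= 5 * n%:R * nb_energy x0 h l.+1.
Proof.
move=> S0; rewrite -(ler_pM2r S0).
pose G i q := nb_power x0 h l.+1 (i, q.1, q.2).
have GE i : s ^+ l * S i = \sum_(q : 'I_n * 'I_n) G i q * edge_fun q.1 q.2.
  rewrite nb_walk_expansion.
  pose f (w : l.+2.-tuple 'I_n) := (nth x0 w l, nth x0 w l.+1).
  rewrite (partition_big f xpredT) //=; apply: eq_bigr => -[y v] _.
  rewrite /G /nb_power big_distrl /=; apply: eq_big => [w|w /andP[_ /eqP[-> ->]]] //.
  by rewrite /walk_ends /f !xpair_eqE /= !andbA.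
have E : \sum_i \sum_(q : 'I_n * 'I_n) G i q ^+ 2 = nb_energy x0 h l.+1.
  rewrite /nb_energy pair_big /=.
  rewrite (reindex (fun q : 'I_n * ('I_n * 'I_n) => (q.1, q.2.1, q.2.2))) //=.
  by exists (fun k => (k.1.1, (k.1.2, k.2))) => [[? []]|[[]]].
have U : \sum_(q : 'I_n * 'I_n) edge_fun q.1 q.2 ^+ 2 <= 5 * n%:R * sqnorm S.
  rewrite -(pair_big xpredT xpredT (fun i j => edge_fun i j ^+ 2)) /=.
  apply: (le_trans (y := \sum_(i < n) \sum_(j < n) (4 * S j ^+ 2 + S i ^+ 2))).
    by apply: ler_sum => i _; apply: ler_sum => j _; apply: edge_fun_sqr.
  under eq_bigr => i _ do rewrite big_split /= -big_distrr /= sumr_const card_ord.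
  rewrite big_split /= sumr_const card_ord sumrMnl -/(sqnorm S).
  by rewrite -[X in X + _]mulr_natl -[X in _ + X]mulr_natl; lra.
have -> : s ^+ (2 * l) * sqnorm S = \sum_i (s ^+ l * S i) ^+ 2.
  rewrite /sqnorm big_distrr /=; apply: eq_bigr => i _.
  by rewrite exprMn -exprM mulnC.
apply: (le_trans (y := \sum_i (\sum_q G i q ^+ 2) * (5 * n%:R * sqnorm S))).
  apply: ler_sum => i _; rewrite GE; apply: le_trans (cauchy_schwarz _ _ _) _.
  by rewrite ler_wpM2l //; apply: sumr_ge0 => q _; rewrite sqr_ge0.
by rewrite -big_distrl /= E; lra.
Qed.

End Kernel.

Definition pencil_term (s x a b : R) := (x ^+ 2 * a ^+ 2 - s * x * (a * b)) / (s ^+ 2 - x ^+ 2).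

Lemma quad_pencil s y : quad (ihara_pencil s) y =
  sqnorm y + \sum_i \sum_j pencil_term s (h i j) (y i) (y j).
Proof.
rewrite /quad /sqnorm -big_split /=; apply: eq_bigr => i _.
under eq_bigr => j _ do rewrite mxE mulrBr mulrBl.
rewrite sumrB (bigD1 i) //= eqxx mul1r [X in _ + X - _]big1 => [|j /negPf ji]; last first.
  by rewrite eq_sym ji mul0r mulr0 mul0r.
rewrite addr0 mulrDr mulr1 mulrDl -expr2 -addrA; congr (_ + _).
rewrite mulrAC -expr2 big_distrr -sumrB; apply: eq_bigr => j _ /=.
by rewrite /pencil_term /ihara_gap; ring.
Qed.

Lemma pencil_term_lipschitz s t x a b : 1 <= s -> 1 <= t -> `|x| <= 1 / 2 ->
  `|pencil_term s x a b - pencil_term t x a b| <= 2 * (a ^+ 2 + b ^+ 2) * `|s - t|.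
Proof.
move=> s1 t1 xh.
have x2 : x ^+ 2 <= 1 / 4.
  exact: sqr_le_quarter.
have st : 1 <= s * t by rewrite -[1]mulr1 ler_pM.
have s2 : 1 <= s ^+ 2 by rewrite -[1](mulr1 1) expr2 ler_pM.
have t2 : 1 <= t ^+ 2 by rewrite -[1](mulr1 1) expr2 ler_pM.
have gs : 0 < s ^+ 2 - x ^+ 2 by lra.
have gt : 0 < t ^+ 2 - x ^+ 2 by lra.
pose N := x ^+ 2 * a ^+ 2 * (s + t) - x * (a * b) * (s * t + x ^+ 2).
have -> : pencil_term s x a b - pencil_term t x a b =
    (t - s) * (N / ((s ^+ 2 - x ^+ 2) * (t ^+ 2 - x ^+ 2))).
  by rewrite /pencil_term /N; field; rewrite !gt_eqF.
rewrite normrM distrC mulrC ler_wpM2r //.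
rewrite normrM normfV (gtr0_norm (mulr_gt0 gs gt)) ler_pdivrMr ?mulr_gt0 //.
have gg : 9 / 16 * (s * t) <= (s ^+ 2 - x ^+ 2) * (t ^+ 2 - x ^+ 2).
  apply: (le_trans (y := (3 / 4 * s ^+ 2) * (3 / 4 * t ^+ 2))).
    rewrite (_ : 3 / 4 * s ^+ 2 * (3 / 4 * t ^+ 2) = 9 / 16 * (s * t) * (s * t)); last by field.
    by rewrite ler_peMr //; lra.
  by apply: ler_pM; lra.
have N1 : `|x ^+ 2 * a ^+ 2 * (s + t)| <= 1 / 4 * a ^+ 2 * (2 * (s * t)).
  have xa0 : 0 <= x ^+ 2 * a ^+ 2 by rewrite mulr_ge0 ?sqr_ge0.
  have st0 : 0 <= s + t by lra.
  rewrite (ger0_norm (mulr_ge0 xa0 st0)); apply: ler_pM => //.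
    by rewrite ler_wpM2r ?sqr_ge0.
  have : 0 <= (s - 1) * (t - 1) by rewrite mulr_ge0 // subr_ge0.
  lra.
have N2 : `|x * (a * b) * (s * t + x ^+ 2)| <= 1 / 2 * ((a ^+ 2 + b ^+ 2) / 2) * (2 * (s * t)).
  rewrite 2!normrM; apply: ler_pM; rewrite ?mulr_ge0 //.
    apply: ler_pM => //; rewrite ler_norml; apply/andP; split.
      by have := sqr_ge0 (a + b); lra.
    by have := sqr_ge0 (a - b); lra.
  by rewrite ger0_norm ?addr_ge0 ?sqr_ge0 //; lra.
apply: le_trans (ler_normB _ _) _; apply: (le_trans (lerD N1 N2)).
have ab : 0 <= 2 * (a ^+ 2 + b ^+ 2) by rewrite mulr_ge0 // addr_ge0 // sqr_ge0.
apply: le_trans (ler_wpM2l ab gg).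
have : 0 <= b ^+ 2 * (s * t) by rewrite mulr_ge0 ?sqr_ge0 //; lra.
have : 0 <= a ^+ 2 * (s * t) by rewrite mulr_ge0 ?sqr_ge0 //; lra.
lra.
Qed.

Lemma sum_sqr_pairs (y : 'I_n -> R) c :
  \sum_i \sum_j c * (y i ^+ 2 + y j ^+ 2) = 2 * c * n%:R * sqnorm y.
Proof.
under eq_bigr => i _ do rewrite -big_distrr big_split /= sumr_const card_ord -/(sqnorm y).
rewrite -big_distrr big_split /= sumr_const card_ord sumrMnl -/(sqnorm y) -mulr_natl.
ring.
Qed.

Lemma quad_pencil_lipschitz s t y : 1 <= s -> 1 <= t ->
  `|quad (ihara_pencil s) y - quad (ihara_pencil t) y| <=
  4 * n%:R * `|s - t| * sqnorm y.
Proof.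
move=> s1 t1; rewrite !quad_pencil opprD addrACA subrr add0r -sumrB.
under eq_bigr => i _ do rewrite -sumrB.
apply: (le_trans (y := \sum_i \sum_j (2 * `|s - t|) * (y i ^+ 2 + y j ^+ 2))).
  apply: le_trans (ler_norm_sum _ _ _) _; apply: ler_sum => i _.
  apply: le_trans (ler_norm_sum _ _ _) _; apply: ler_sum => j _.
  by have := @pencil_term_lipschitz s t _ (y i) (y j) s1 t1 (h_half i j); lra.
by rewrite sum_sqr_pairs; lra.
Qed.

Lemma quad_pencil_large s y : 1 <= s -> n%:R <= s -> 0 <= quad (ihara_pencil s) y.
Proof.
move=> s1 ns; rewrite quad_pencil.
have le i j : - (1 / (2 * s)) * (y i ^+ 2 + y j ^+ 2) <=
    pencil_term s (h i j) (y i) (y j).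
  have xh := h_half i j; move: (h i j) (y i) (y j) xh => x a b xh.
  have x2 : x ^+ 2 <= 1 / 4.
    exact: sqr_le_quarter.
  have s2 : 1 <= s ^+ 2 by rewrite -[1](mulr1 1) expr2 ler_pM.
  have gs : 0 < s ^+ 2 - x ^+ 2 by lra.
  have gh : s ^+ 2 / 2 <= s ^+ 2 - x ^+ 2 by lra.
  rewrite /pencil_term ler_pdivlMr // mulNr.
  have ab0 : 0 <= (a ^+ 2 + b ^+ 2) / 2 by rewrite divr_ge0 // addr_ge0 ?sqr_ge0.
  have xab : x * (a * b) <= 1 / 2 * ((a ^+ 2 + b ^+ 2) / 2).
    apply: le_trans (ler_norm _) _; rewrite normrM; apply: ler_pM => //.
    rewrite ler_norml; apply/andP; split.
      by have := sqr_ge0 (a + b); lra.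
    by have := sqr_ge0 (a - b); lra.
  have s0 : 0 < s by lra.
  have := ler_wpM2l (ltW s0) xab.
  have : s / 2 * ((a ^+ 2 + b ^+ 2) / 2) <= 
      1 / (2 * s) * (a ^+ 2 + b ^+ 2) * (s ^+ 2 - x ^+ 2).
    rewrite (_ : s / 2 * _ = 1 / (2 * s) * (a ^+ 2 + b ^+ 2) * (s ^+ 2 / 2)); last first.
      by field; rewrite gt_eqF.
    by rewrite ler_wpM2l // mulr_ge0 ?addr_ge0 ?sqr_ge0 // divr_ge0 //; lra.
  have : 0 <= x ^+ 2 * a ^+ 2 by rewrite mulr_ge0 ?sqr_ge0.
  lra.
have : \sum_i \sum_j - (1 / (2 * s)) * (y i ^+ 2 + y j ^+ 2) <=
    \sum_i \sum_j pencil_term s (h i j) (y i) (y j).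
  by apply: ler_sum => i _; apply: ler_sum => j _; exact: le.
rewrite sum_sqr_pairs; have s0 : 0 < s by lra.
have -> : 2 * - (1 / (2 * s)) * n%:R * sqnorm y = - (n%:R / s * sqnorm y).
  by field; rewrite gt_eqF.
have : n%:R / s * sqnorm y <= sqnorm y.
  by rewrite ler_piMl ?sqnorm_ge0 // ler_pdivrMr // mul1r.
lra.
Qed.

(** The smallest eigenvalue of the pencil is continuous in [s] and nonnegative for
    large [s].  Were it negative somewhere, it would vanish further on, and a
    kernel vector there would force more non-backtracking walks than there are. *)
Lemma pencil_psd s l y : 1 <= s ->
  5 * n%:R * nb_energy x0 h l.+1 < s ^+ (2 * l) -> 0 <= quad (ihara_pencil s) y.
Proof.
move=> s1 few; have n0 : (0 < n)%N by apply: leq_ltn_trans (ltn_ord x0).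
pose i0 := Ordinal n0.
(* The argument is clamped because the pencil can have poles below [1]. *)
pose phi r := lambda (ihara_pencil (Num.max 1 r)) i0.
have max1 (r : R) : 1 <= Num.max 1 r by rewrite le_max lexx.
have max_lip (r t : R) : `|Num.max 1 r - Num.max 1 t| <= `|r - t|.
  rewrite !maxEle; case: (leP 1 r) => r1; case: (leP 1 t) => t1 //.
  - by rewrite !ger0_norm; lra.
  - by rewrite distrC (distrC r) !ger0_norm; lra.
  - by rewrite subrr normr0.
have phi_lip (r t : R) : `|phi r - phi t| <= 4 * n%:R * `|r - t|.
  apply: (le_trans (y := 4 * n%:R * `|Num.max 1 r - Num.max 1 t|)).
    apply: weyl; try exact: ihara_pencil_sym.
    by move=> x; apply: quad_pencil_lipschitz.
  by rewrite ler_wpM2l ?mulr_ge0.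
have phi_cont : continuous (phi : R -> R).
  move=> r; apply/cvgrPdist_le => e e0; near=> t.
  apply: le_trans (phi_lip _ _) _.
  have : `|r - t| <= e / (4 * n%:R + 1).
    near: t; apply: cvgr_dist_le; last by rewrite divr_gt0 // ltr_wpDl // mulr_ge0.
    exact: cvg_id.
  rewrite ler_pdivlMr; last by rewrite ltr_wpDl // mulr_ge0.
  by have := normr_ge0 (r - t); lra.
suff phi0 : 0 <= phi s.
  have := @lambda_min_quad _ _ _ i0 y (ihara_pencil_sym (Num.max 1 s)) erefl.
  rewrite -/(phi s) (max_idPr s1); apply: le_trans.
  exact: mulr_ge0 phi0 (sqnorm_ge0 y).
rewrite leNgt; apply/negP => neg.
pose b := Num.max s n%:R.
have sb : s <= b by rewrite le_max lexx.
have b1 : 1 <= b := le_trans s1 sb.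
have phib : 0 <= phi b.
  have [x x1 ev] := lambda_eigenvector i0 (ihara_pencil_sym (Num.max 1 b)).
  have := quad_eigenvector ev; rewrite x1 mulr1 -/(phi b) => <-.
  by rewrite (max_idPr b1); apply: quad_pencil_large => //; rewrite le_max lexx orbT.
have mm : Num.min (phi s) (phi b) <= 0 <= Num.max (phi s) (phi b).
  by move: (phi s) (phi b) neg phib => u v u0 v0; rewrite ge_min (ltW u0) le_max v0 orbT.
have [c] := IVT sb (continuous_subspaceT phi_cont) mm.
rewrite in_itv /= => /andP[sc cb] phic.
have c1 : 1 <= c := le_trans s1 sc.
have [x x1 ev] := lambda_eigenvector i0 (ihara_pencil_sym (Num.max 1 c)).
rewrite -/(phi c) phic (max_idPr c1) in ev.
have := @nb_growth c x c1 _ l; rewrite x1 => /(_ _ ltr01) => gr.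
have {}gr := gr (fun a => etrans (ev a) (mul0r _)).
have mono : s ^+ (2 * l) <= c ^+ (2 * l).
  by rewrite lerXn2r // nnegrE; [exact: le_trans ler01 s1 | exact: le_trans ler01 c1].
by have := lt_le_trans few (le_trans mono gr); rewrite ltxx.
Unshelve. all: by end_near.
Qed.

(** Positivity of the pencil at [s = 1 + e], solved for [h].  To leading order it says
    that [h] is at most [s + r / s], where the row sums [r] of the squares are at most
    [1 + e]: about [2] in total.  The corrections to the leading order are of the order
    of the entries. *)
Lemma nb_quad_le K e l : K <= 1 / 2 -> (forall i j, `|h i j| <= K) -> 0 <= e <= 1 ->
  (forall i, \sum_j h i j ^+ 2 <= 1 + e) ->
  5 * n%:R * nb_energy x0 h l.+1 < (1 + e) ^+ (2 * l) ->
  forall y, \sum_i \sum_j y i * h i j * y j <= (2 + 5 * e + 8 * K) * sqnorm y.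
Proof.
move=> K2 hK /andP[e0 e1] row few y; pose s := 1 + e.
have s1 : 1 <= s by rewrite lerDl.
have K0 : 0 <= K by apply: le_trans (hK x0 x0).
have psd := pencil_psd y s1 few; rewrite quad_pencil in psd.
have gap i j : 0 < ihara_gap s i j by apply: ihara_gap_gt0.
have gapK i j : 1 - K ^+ 2 <= ihara_gap s i j.
  have : h i j ^+ 2 <= K ^+ 2 by rewrite -real_normK ?num_real // ler_sqr ?nnegrE.
  have : 1 <= s ^+ 2 by rewrite -[1](mulr1 1) expr2 ler_pM.
  by rewrite /ihara_gap; lra.
have KK : K ^+ 2 <= 1 / 4 by apply: sqr_le_quarter; rewrite ger0_norm.
have igap i j : (ihara_gap s i j)^-1 <= 1 + 2 * K ^+ 2.
  rewrite -[leLHS]div1r ler_pdivrMr //.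
  have := ler_wpM2l (_ : 0 <= 1 + 2 * K ^+ 2) (gapK i j).
  have := sqr_ge0 K; nra.
have term i j : y i * h i j * y j <= - s * pencil_term s (h i j) (y i) (y j)
    + s * ((1 + 2 * K ^+ 2) * h i j ^+ 2 * y i ^+ 2)
    + K * (1 + 2 * K ^+ 2) * (h i j ^+ 2 * (y i ^+ 2 / 2) + h i j ^+ 2 * (y j ^+ 2 / 2)).
  have g0 := gap i j; have := igap i j; rewrite /pencil_term -/(ihara_gap s i j).
  have xK := hK i j; have gE : s ^+ 2 = ihara_gap s i j + h i j ^+ 2 by rewrite /ihara_gap; ring.
  move: (ihara_gap s i j) (h i j) (y i) (y j) g0 xK gE => g x a b g0 xK gE ig.
  have -> : a * x * b = - s * ((x ^+ 2 * a ^+ 2 - s * x * (a * b)) / g)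
      + s * (g^-1 * x ^+ 2 * a ^+ 2) - g^-1 * (x ^+ 2 * (x * (a * b))).
    have -> : - s * ((x ^+ 2 * a ^+ 2 - s * x * (a * b)) / g) =
      - s * (x ^+ 2 * a ^+ 2 / g) + s ^+ 2 * (x * (a * b)) / g by field; rewrite gt_eqF.
    by rewrite gE; field; rewrite gt_eqF.
  have i0 : 0 <= g^-1 by rewrite invr_ge0 ltW.
  have xa : 0 <= x ^+ 2 * a ^+ 2 by rewrite mulr_ge0 ?sqr_ge0.
  have s0 : 0 <= s := le_trans ler01 s1.
  have t1 : s * (g^-1 * x ^+ 2 * a ^+ 2) <= s * ((1 + 2 * K ^+ 2) * x ^+ 2 * a ^+ 2).
    by rewrite -!(mulrA _ (x ^+ 2)) ler_wpM2l // ler_wpM2r.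
  have t2 : - (g^-1 * (x ^+ 2 * (x * (a * b)))) <=
      K * (1 + 2 * K ^+ 2) * (x ^+ 2 * (a ^+ 2 / 2) + x ^+ 2 * (b ^+ 2 / 2)).
    have abn : `|a * b| <= a ^+ 2 / 2 + b ^+ 2 / 2.
      by rewrite ler_norml; have := sqr_ge0 (a + b); have := sqr_ge0 (a - b); lra.
    apply: le_trans (ler_norm _) _; rewrite normrN (normrM g^-1) (ger0_norm i0).
    rewrite (normrM (x ^+ 2)) (ger0_norm (sqr_ge0 x)) (normrM x) -mulrDr.
    have -> : K * (1 + 2 * K ^+ 2) * (x ^+ 2 * (a ^+ 2 / 2 + b ^+ 2 / 2)) =
      (1 + 2 * K ^+ 2) * (x ^+ 2 * (K * (a ^+ 2 / 2 + b ^+ 2 / 2))) by ring.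
    have xab : `|x| * `|a * b| <= K * (a ^+ 2 / 2 + b ^+ 2 / 2) by apply: ler_pM.
    have q0 : 0 <= x ^+ 2 * (`|x| * `|a * b|) by rewrite mulr_ge0 ?sqr_ge0 // mulr_ge0.
    by apply: ler_pM => //; rewrite ler_wpM2l ?sqr_ge0.
  lra.
have tot : \sum_i \sum_j y i * h i j * y j <= \sum_i \sum_j
    (- s * pencil_term s (h i j) (y i) (y j)
    + s * ((1 + 2 * K ^+ 2) * h i j ^+ 2 * y i ^+ 2)
    + K * (1 + 2 * K ^+ 2) * (h i j ^+ 2 * (y i ^+ 2 / 2) + h i j ^+ 2 * (y j ^+ 2 / 2))).
  by apply: ler_sum => i _; apply: ler_sum => j _; exact: term.
apply: (le_trans tot).
have hy1 : \sum_i \sum_j h i j ^+ 2 * y i ^+ 2 <= s * sqnorm y.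
  rewrite /sqnorm big_distrr /=; apply: ler_sum => i _.
  by rewrite -big_distrl /= ler_wpM2r ?sqr_ge0 ?row.
have hy2 : \sum_i \sum_j h i j ^+ 2 * y j ^+ 2 <= s * sqnorm y.
  rewrite exchange_big; apply: le_trans hy1; apply: ler_sum => i _.
  by apply: ler_sum => j _; rewrite h_sym.
set A := \sum_i \sum_j h i j ^+ 2 * y i ^+ 2 in hy1.
set B := \sum_i \sum_j h i j ^+ 2 * y j ^+ 2 in hy2.
set Q := \sum_i \sum_j pencil_term s (h i j) (y i) (y j) in psd.
have -> : \sum_i \sum_j (- s * pencil_term s (h i j) (y i) (y j)
    + s * ((1 + 2 * K ^+ 2) * h i j ^+ 2 * y i ^+ 2)
    + K * (1 + 2 * K ^+ 2) * (h i j ^+ 2 * (y i ^+ 2 / 2) + h i j ^+ 2 * (y j ^+ 2 / 2))) =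
    - s * Q + s * (1 + 2 * K ^+ 2) * A + K * (1 + 2 * K ^+ 2) / 2 * A
    + K * (1 + 2 * K ^+ 2) / 2 * B.
  rewrite /Q /A /B !big_distrr -!big_split /=; apply: eq_bigr => i _.
  by rewrite !big_distrr -!big_split /=; apply: eq_bigr => j _; field.
have N0 := sqnorm_ge0 y; have s0 : 0 <= s := le_trans ler01 s1.
have C0 : 0 <= 1 + 2 * K ^+ 2 by rewrite addr_ge0 // mulr_ge0 // sqr_ge0.
have a1 : - s * Q <= s * sqnorm y by have := ler_wpM2l s0 psd; lra.
have a2 : s * (1 + 2 * K ^+ 2) * A <= s * (1 + 2 * K ^+ 2) * (s * sqnorm y).
  by rewrite ler_wpM2l // mulr_ge0.
have KC : 0 <= K * (1 + 2 * K ^+ 2) / 2 by rewrite divr_ge0 ?mulr_ge0.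
have a3 := ler_wpM2l KC hy1; have a4 := ler_wpM2l KC hy2.
apply: (le_trans (y := (s + s * (1 + 2 * K ^+ 2) * s + K * (1 + 2 * K ^+ 2) * s) * sqnorm y)).
  lra.
rewrite ler_wpM2r // /s.
have K2' : 2 * K ^+ 2 <= K by rewrite expr2; nra.
have ee : e ^+ 2 <= e by rewrite expr2; nra.
have b1 : (1 + e) * (1 + 2 * K ^+ 2) * (1 + e) <= (1 + 3 * e) * (1 + K).
  have -> : (1 + e) * (1 + 2 * K ^+ 2) * (1 + e) = (1 + e) ^+ 2 * (1 + 2 * K ^+ 2) by ring.
  apply: ler_pM => //; rewrite ?sqr_ge0 //; last by lra.
  by rewrite sqrrD expr1n mul1r mulr2n; lra.
have b2 : K * (1 + 2 * K ^+ 2) * (1 + e) <= K * (3 / 2) * 2.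
  by apply: ler_pM; rewrite ?mulr_ge0 ?ler_wpM2l //; lra.
have eK : e * K <= K by rewrite ler_piMl.
lra.
Qed.

End NonBacktracking.

Lemma nb_energy_opp (R : realType) n (x0 : 'I_n) (h : 'I_n -> 'I_n -> R) m :
  nb_energy x0 (fun i j => - h i j) m = nb_energy x0 h m.
Proof.
apply: eq_bigr => k _; rewrite /nb_power.
rewrite (eq_bigr (fun w : m.+1.-tuple 'I_n => (-1) ^+ m * walk_prod h m (nth x0 w))).
  by rewrite -big_distrr /= exprMn -exprM mulnC exprM sqrrN !expr1n mul1r.
move=> w _; rewrite /walk_prod -[X in (-1) ^+ X]card_ord -prodr_const -big_split /=.
by apply: eq_bigr => t _; rewrite mulN1r.
Qed.

(** Changing the sign of all entries does not change the energy, so the upper bound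
    of [nb_quad_le] for [- H] is the lower bound for [H]. *)
Theorem nb_norm_bound (R : realType) n (x0 : 'I_n) (H : 'M[R]_n) K e l :
  H^T = H -> K <= 1 / 2 -> (forall i j, `|H i j| <= K) -> 0 <= e <= 1 ->
  (forall i, \sum_j H i j ^+ 2 <= 1 + e) ->
  5 * n%:R * nb_energy x0 H l.+1 < (1 + e) ^+ (2 * l) ->
  forall y, `|quad H y| <= (2 + 5 * e + 8 * K) * sqnorm y.
Proof.
move=> Hs K2 HK e01 row few y; have Hsym i j : H i j = H j i by rewrite -{1}Hs mxE.
have H2 i j : `|H i j| <= 1 / 2 by apply: le_trans K2.
rewrite ler_norml lerNl; apply/andP; split; last exact: nb_quad_le few y.
have -> : - quad H y = \sum_i \sum_j y i * - H i j * y j.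
  rewrite /quad -sumrN; apply: eq_bigr => i _; rewrite -sumrN.
  by apply: eq_bigr => j _; ring.
apply: (@nb_quad_le _ _ x0 (fun i j => - H i j) _ _ K e l) => //.
- by move=> i j; rewrite Hsym.
- by move=> i j; rewrite normrN.
- by move=> i j; rewrite normrN.
- by move=> i; under eq_bigr do rewrite sqrrN.
- by rewrite (nb_energy_opp x0 (fun i j => H i j)).
Qed.

(** * Perturbation of the Laplacian *)

Lemma cauchy_schwarz_sqrt (R : realType) (I : finType) (A : pred I) (a b : I -> R) :
  \sum_(i | A i) a i * b i <=
  Num.sqrt (\sum_(i | A i) a i ^+ 2) * Num.sqrt (\sum_(i | A i) b i ^+ 2).
Proof.
have a0 : 0 <= \sum_(i | A i) a i ^+ 2 by apply: sumr_ge0 => i _; rewrite sqr_ge0.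
rewrite -sqrtrM //; apply: le_trans (ler_norm _) _.
by rewrite -sqrtr_sqr ler_wsqrtr // cauchy_schwarz.
Qed.

Section Perturbation.
Variables (R : realType) (n : nat) (p : 'M[R]_n) (delta c : R).
Hypothesis p01 : forall i j, 0 <= p i j <= 1.
Hypothesis p_sym : forall i j, p i j = p j i.
Hypothesis delta0 : 0 < delta.
Hypothesis delta_le : forall i, delta <= degree p i.

Let t i := degree p i.

Lemma degree_gt0 i : 0 < t i.
Proof. exact: lt_le_trans (delta_le i). Qed.

Lemma sqrt_degree_gt0 i : 0 < Num.sqrt (t i).
Proof. by rewrite sqrtr_gt0 degree_gt0. Qed.

(** Normalization of [A] by the degrees of [p] instead of its own; this keeps the
    expression linear in [A]. *)
Definition degree_scaled (A : 'M[R]_n) : 'M[R]_n :=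
  \matrix_(i, j) (A i j / (Num.sqrt (t i) * Num.sqrt (t j))).

Lemma laplacianE (A : 'M[R]_n) i j : laplacian A i j =
  (i == j)%:R - A i j / (Num.sqrt (degree A i) * Num.sqrt (degree A j)).
Proof.
rewrite /laplacian /inv_sqrt_degree mul_mx_diag mul_diag_mx !mxE.
by rewrite invfM; ring.
Qed.

Lemma quad_laplacian (A : 'M[R]_n) x : quad (laplacian A) x = sqnorm x -
  \sum_i \sum_j A i j / (Num.sqrt (degree A i) * Num.sqrt (degree A j)) * (x i * x j).
Proof.
rewrite /quad /sqnorm -sumrB; apply: eq_bigr => i _.
under eq_bigr => j _ do rewrite laplacianE mulrBr mulrBl.
rewrite sumrB (bigD1 i) //= eqxx mulr1 [X in _ + X - _]big1 => [|j /negPf ji]; last first.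
  by rewrite eq_sym ji mulr0 mul0r.
by rewrite addr0 expr2; congr (_ - _); apply: eq_bigr => j _; ring.
Qed.

Lemma quad_scaled (A : 'M[R]_n) x : quad (degree_scaled A) x =
  \sum_i \sum_j A i j / (Num.sqrt (t i) * Num.sqrt (t j)) * (x i * x j).
Proof.
apply: eq_bigr => i _; apply: eq_bigr => j _; rewrite mxE; ring.
Qed.

Lemma quad_expected_le x : `|quad (degree_scaled p) x| <= sqnorm x.
Proof.
rewrite quad_scaled.
apply: (le_trans (y := \sum_i \sum_j (p i j * (x i ^+ 2 / t i / 2) + p j i * (x j ^+ 2 / t j / 2)))).
  apply: le_trans (ler_norm_sum _ _ _) _; apply: ler_sum => i _.
  apply: le_trans (ler_norm_sum _ _ _) _; apply: ler_sum => j _.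
  have /andP[p0 _] := p01 i j; rewrite (p_sym j i) -mulrDr.
  rewrite -mulrA normrM (ger0_norm p0) ler_wpM2l //.
  have ti : t i = Num.sqrt (t i) ^+ 2 by rewrite sqr_sqrtr // ltW // degree_gt0.
  have tj : t j = Num.sqrt (t j) ^+ 2 by rewrite sqr_sqrtr // ltW // degree_gt0.
  have si := sqrt_degree_gt0 i; have sj := sqrt_degree_gt0 j.
  rewrite {2}ti {2}tj; move: (Num.sqrt (t i)) (Num.sqrt (t j)) si sj {ti tj} => u v u0 v0.
  rewrite (_ : (u * v)^-1 * _ = (x i / u) * (x j / v)); last by field; rewrite !gt_eqF.
  rewrite -!expr_div_n; move: (x i / u) (x j / v) => a b.
  by rewrite ler_norml; have := sqr_ge0 (a + b); have := sqr_ge0 (a - b); lra.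
under eq_bigr => i _ do rewrite big_split.
rewrite big_split /= [X in _ + X]exchange_big /=.
have -> : \sum_i \sum_j p i j * (x i ^+ 2 / t i / 2) = sqnorm x / 2.
  rewrite /sqnorm big_distrl; apply: eq_bigr => i _ /=.
  rewrite -big_distrl /= -/(degree p i) -/(t i).
  by field; rewrite gt_eqF // degree_gt0.
lra.
Qed.

Lemma p_symT : p^T = p.
Proof. by apply/matrixP => i j; rewrite mxE. Qed.

Let mu i := 1 - lambda (laplacian p) i.

Lemma mu_le1 i : `|mu i| <= 1.
Proof.
have [x x1 ev] := lambda_eigenvector i (laplacian_sym p_symT).
have := quad_expected_le x; rewrite x1.
have := quad_eigenvector ev; rewrite quad_laplacian -/(t _) -quad_scaled x1 mulr1.
by move=> e; rewrite /mu -e opprB addrC subrK.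
Qed.

Let far i := c <= `|mu i|.

Lemma sum_far_eigvals : \sum_(x <- far_eigvals (laplacian p) c) (1 - x) ^+ 2 =
  \sum_(i | far i) mu i ^+ 2.
Proof.
rewrite /far_eigvals big_filter (eigvals_lambda (laplacian_sym p_symT)).
by rewrite big_map big_enum_cond.
Qed.

Lemma sum_far_le_size : \sum_(i | far i) mu i ^+ 2 <=
  (size (far_eigvals (laplacian p) c))%:R.
Proof.
rewrite -sum_far_eigvals -sum1_size natr_sum big_filter [leRHS]big_filter.
rewrite (eigvals_lambda (laplacian_sym p_symT)) !big_map; apply: ler_sum => i _.
by rewrite -/(mu i) -real_normK ?num_real // exprn_ile1 // mu_le1.
Qed.

(** The exact slope [1 / 2] at the origin matters: it gives the coefficient [1] of the
    first square root in [laplacian_perturbation]. *)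
Lemma inv_sqrt_expansion (r : R) : - (1 / 2) <= r ->
  `|(Num.sqrt (1 + r))^-1 - 1| <= `|r| / 2 + r ^+ 2.
Proof.
move=> r2; have r0 : 0 <= 1 + r by lra.
have s0 : 0 < Num.sqrt (1 + r) by rewrite sqrtr_gt0; lra.
have := sqr_sqrtr r0; move: (Num.sqrt (1 + r)) s0 => s s0 e.
have rE : r = s ^+ 2 - 1 by lra.
have s2 : 1 / 2 <= s ^+ 2 by lra.
have sh : 7 / 10 <= s.
  rewrite leNgt; apply/negP => lt; have : s ^+ 2 <= (7 / 10) ^+ 2.
    by rewrite ler_sqr ?nnegrE; lra.
  lra.
rewrite (_ : s^-1 - 1 = (1 - s) / s); last by field; rewrite gt_eqF.
rewrite normrM normfV (gtr0_norm s0) ler_pdivrMr //.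
rewrite rE (_ : s ^+ 2 - 1 = (s - 1) * (s + 1)); last by ring.
rewrite normrM (gtr0_norm (_ : 0 < s + 1)); last by lra.
have -> : ((s - 1) * (s + 1)) ^+ 2 = `|s - 1| ^+ 2 * (s + 1) ^+ 2.
  by rewrite exprMn real_normK ?num_real.
rewrite distrC; case: (leP 1 s) => s1.
  have d0 : 0 <= `|s - 1| by [].
  have : 1 <= (s + 1) / 2 * s by nra.
  have : 0 <= `|s - 1| ^+ 2 * (s + 1) ^+ 2 * s
    by apply: mulr_ge0; [apply: mulr_ge0; exact: sqr_ge0 | exact: ltW].
  move: (`|s - 1|) d0 => d d0 h1 h2.
  have := ler_wpM2l d0 h2; lra.
have dE : `|s - 1| = 1 - s by rewrite distrC ger0_norm //; lra.
rewrite dE.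
have d0 : 0 <= 1 - s by lra.
suff : 1 <= ((s + 1) / 2 + (1 - s) * (s + 1) ^+ 2) * s.
  by move=> h; have := ler_wpM2l d0 h; lra.
have k1 : 289 / 100 <= (s + 1) ^+ 2.
  by rewrite (_ : 289 / 100 = (17 / 10) ^+ 2) ?ler_sqr ?nnegrE; [lra..|field].
have k2 : 289 / 100 * (7 / 10) <= (s + 1) ^+ 2 * s by apply: ler_pM; lra.
have k3 := ler_wpM2l d0 (le_trans (_ : 2 <= _) k2).
by have := k3 (ltac:(lra)); have := sqr_ge0 (1 - s); lra.
Qed.

(** Let [N] be the expected matrix normalized by the expected degrees, and [theta] the
    diagonal matrix that corrects the degrees, about [1 - r / 2].  The quadratic forms
    of the two Laplacians at [x] differ by that of the normalized noise at [theta x]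
    and by that of [N] at [theta x] minus that at [x].  In the eigenbasis of [N], whose
    eigenvalues are [mu], the latter is twice a scalar product of [N x] and
    [theta x - x], plus a quadratic term.  The eigenvalues below [c] in absolute value
    contribute at most [2 * c * eta].  For the others the Cauchy-Schwarz inequality leaves the
    Hilbert-Schmidt norm of [N (theta - 1)] restricted to their eigenspaces, in which
    vertex [a] has the weight [w a]. *)
Theorem laplacian_perturbation : exists w : 'I_n -> R,
  [/\ forall a, 0 <= w a <= delta^-1,
      \sum_a w a = \sum_(i | far i) mu i ^+ 2 &
      forall (A : 'M[R]_n) (nu eta : R), A^T = A ->
      let r a := (degree A a - t a) / t a in
      (forall y, `|quad (degree_scaled (A - p)) y| <= nu * sqnorm y) ->
      0 <= c -> 0 <= nu -> eta <= 1 / 2 -> (forall a, `|r a| <= eta) ->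
      forall i, `|lambda (laplacian A) i - lambda (laplacian p) i| <=
        nu * (1 + eta) ^+ 2 + (Num.sqrt (\sum_a w a * r a ^+ 2) +
          2 * Num.sqrt (\sum_a w a * r a ^+ 4)) + eta ^+ 2 + 2 * c * eta].
Proof.
have [P [nP LE oP cP]] := spectral_theorem (laplacian_sym p_symT).
have NE a b : degree_scaled p a b = \sum_j mu j * (P j a * P j b).
  have -> : degree_scaled p a b = (a == b)%:R - laplacian p a b.
    by rewrite laplacianE mxE opprB addrC subrK.
  rewrite -cP LE -sumrB; apply: eq_bigr => j _; rewrite /mu; ring.
pose w a := \sum_(j | far j) mu j ^+ 2 * P j a ^+ 2.
have w0 a : 0 <= w a by apply: sumr_ge0 => j _; rewrite mulr_ge0 ?sqr_ge0.
exists w; split.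
- move=> a; rewrite w0 /=.
  apply: (le_trans (y := \sum_j mu j ^+ 2 * P j a ^+ 2)).
    rewrite /w big_mkcond; apply: ler_sum => j _; case: ifP => // _.
    by rewrite mulr_ge0 ?sqr_ge0.
  have -> : \sum_j mu j ^+ 2 * P j a ^+ 2 = \sum_b degree_scaled p a b ^+ 2.
    have e b : degree_scaled p a b ^+ 2 =
        \sum_j \sum_k (mu j * P j a) * (mu k * P k a) * (P j b * P k b).
      rewrite NE expr2 big_distrl; apply: eq_bigr => j _; rewrite big_distrr.
      by apply: eq_bigr => k _ /=; ring.
    rewrite (eq_bigr _ (fun b _ => e b)) exchange_big; apply: eq_bigr => j _ /=.
    rewrite exchange_big (bigD1 j) //= -big_distrr /= oP eqxx big1 => [|k kj].
      by rewrite mulr1 addr0; ring.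
    by rewrite -big_distrr /= oP eq_sym (negPf kj) mulr0.
  apply: (le_trans (y := \sum_b p a b / (t a * delta))).
    apply: ler_sum => b _; rewrite mxE expr_div_n exprMn !sqr_sqrtr ?(ltW (degree_gt0 _)) //.
    have /andP[p0 p1] := p01 a b; apply: ler_pM; rewrite ?sqr_ge0 //.
    - by rewrite invr_ge0 mulr_ge0 // ltW // degree_gt0.
    - by rewrite expr2 ler_piMl.
    - by rewrite lef_pV2 ?posrE ?mulr_gt0 ?degree_gt0 // ler_pM2l ?degree_gt0.
  rewrite -big_distrl /= -/(degree p a) -/(t a) invfM mulrA mulfV ?mul1r //.
  by rewrite gt_eqF // degree_gt0.
- rewrite exchange_big; apply: eq_bigr => j _ /=; rewrite -big_distrr /=.
  rewrite (eq_bigr (fun a => P j a * P j a)); last by move=> a _; rewrite expr2.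
  by rewrite oP eqxx mulr1.
move=> A nu eta As r hC c0 nu0 eta2 hr.
apply: weyl; rewrite ?laplacian_sym ?p_symT // => x.
have eta0 : 0 <= eta \/ forall a : 'I_n, False.
  case: (pickP (fun _ : 'I_n => true)) => [a _|no]; last by right => a; have := no a.
  by left; apply: le_trans (hr a).
case: eta0 => [eta0|no]; last first.
  by rewrite /quad /sqnorm !big1 ?subrr ?normr0 ?mulr0 // => a; have := no a.
pose theta a := (Num.sqrt (1 + r a))^-1.
pose y a := theta a * x a.
pose z a := (theta a - 1) * x a.
have th1 a : `|theta a - 1| <= `|r a| / 2 + r a ^+ 2.
  by apply: inv_sqrt_expansion; have := hr a; rewrite ler_norml; lra.
have th_eta a : `|theta a - 1| <= eta.
  apply: le_trans (th1 a) _; have := hr a; rewrite -[r a ^+ 2]real_normK ?num_real //.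
  by have := normr_ge0 (r a); move: `|r a| => u; nra.
have dE a : degree A a = t a * (1 + r a).
  by rewrite /r; field; rewrite gt_eqF // degree_gt0.
have z2 : sqnorm z <= eta ^+ 2 * sqnorm x.
  rewrite /sqnorm big_distrr; apply: ler_sum => a _; rewrite /z exprMn ler_wpM2r ?sqr_ge0 //.
  by rewrite -real_normK ?num_real // ler_sqr ?nnegrE.
have y2 : sqnorm y <= (1 + eta) ^+ 2 * sqnorm x.
  rewrite /sqnorm big_distrr; apply: ler_sum => a _; rewrite /y exprMn ler_wpM2r ?sqr_ge0 //.
  rewrite -real_normK ?num_real // ler_sqr ?nnegrE //; last by rewrite addr_ge0.
  by rewrite -[theta a](subrK 1) addrC; apply: le_trans (ler_normD _ _) _; rewrite normr1 lerD2l.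
have LA : quad (laplacian A) x = sqnorm x - (quad (degree_scaled p) y + quad (degree_scaled (A - p)) y).
  rewrite quad_laplacian; congr (_ - _); rewrite !quad_scaled -big_split.
  apply: eq_bigr => a _; rewrite -big_split; apply: eq_bigr => b _ /=.
  rewrite !mxE !dE !sqrtrM ?(ltW (degree_gt0 _)) // /y /theta !invfM; ring.
have Lp : quad (laplacian p) x = sqnorm x - quad (degree_scaled p) x.
  by rewrite quad_laplacian quad_scaled.
have -> : quad (laplacian A) x - quad (laplacian p) x =
    - quad (degree_scaled (A - p)) y - (quad (degree_scaled p) y - quad (degree_scaled p) x).
  by rewrite LA Lp; ring.
pose px j := \sum_k P j k * x k; pose pz j := \sum_k P j k * z k.
have diffE : quad (degree_scaled p) y - quad (degree_scaled p) x =
    \sum_j mu j * (2 * (px j * pz j) + pz j ^+ 2).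
  rewrite !(quad_spectral _ NE) -sumrB; apply: eq_bigr => j _.
  have -> : \sum_k P j k * y k = px j + pz j.
    by rewrite -big_split; apply: eq_bigr => k _ /=; rewrite /y /z; ring.
  by rewrite -/(px j); ring.
have nx : \sum_j px j ^+ 2 = sqnorm x by apply: nP.
have nz : \sum_j pz j ^+ 2 = sqnorm z by apply: nP.
pose X := Num.sqrt (sqnorm x); have X0 : 0 <= X by rewrite sqrtr_ge0.
have X2 : sqnorm x = X ^+ 2 by rewrite sqr_sqrtr // sqnorm_ge0.
pose Q := \sum_a w a * r a ^+ 2; pose Q4 := \sum_a w a * r a ^+ 4.
have Q0 : 0 <= Q by apply: sumr_ge0 => a _; rewrite mulr_ge0 ?sqr_ge0.
have Q40 : 0 <= Q4 by apply: sumr_ge0 => a _; rewrite mulr_ge0 // (exprM _ 2 2) sqr_ge0.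
pose phi := Num.sqrt Q / 2 + Num.sqrt Q4.
have phi0 : 0 <= phi by rewrite addr_ge0 ?divr_ge0 ?sqrtr_ge0.
have Phi : \sum_a w a * (theta a - 1) ^+ 2 <= phi ^+ 2.
  apply: (le_trans (y := \sum_a (w a * r a ^+ 2 / 4 + w a * r a ^+ 4 +
     (Num.sqrt (w a) * `|r a|) * (Num.sqrt (w a) * r a ^+ 2)))).
    apply: ler_sum => a _; rewrite mulrACA -expr2 sqr_sqrtr //.
    have -> : w a * r a ^+ 2 / 4 + w a * r a ^+ 4 + w a * (`|r a| * r a ^+ 2) =
        w a * (`|r a| / 2 + r a ^+ 2) ^+ 2.
      by rewrite -[r a ^+ 2]real_normK ?num_real // (exprM _ 2 2) -[r a ^+ 2]real_normK ?num_real //; field.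
    rewrite ler_wpM2l // -real_normK ?num_real // ler_sqr ?nnegrE //.
    by rewrite addr_ge0 ?sqr_ge0 // divr_ge0.
  rewrite !big_split /= -big_distrl /= -/Q -/Q4.
  have := cauchy_schwarz_sqrt xpredT (fun a => Num.sqrt (w a) * `|r a|)
    (fun a => Num.sqrt (w a) * r a ^+ 2).
  rewrite [X in _ <= Num.sqrt X * _](eq_bigr (fun a => w a * r a ^+ 2)); last first.
    by move=> a _; rewrite exprMn sqr_sqrtr // real_normK ?num_real.
  rewrite [X in _ <= _ * Num.sqrt X](eq_bigr (fun a => w a * r a ^+ 4)); last first.
    by move=> a _; rewrite exprMn sqr_sqrtr // -exprM.
  rewrite -/Q -/Q4 /phi => cs.
  have -> : (Num.sqrt Q / 2 + Num.sqrt Q4) ^+ 2 =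
      Num.sqrt Q ^+ 2 / 4 + Num.sqrt Q4 ^+ 2 + Num.sqrt Q * Num.sqrt Q4 by field.
  by rewrite !sqr_sqrtr // lerD2l.
have far_le : \sum_(j | far j) `|px j| * `|mu j * pz j| <= X * (X * phi).
  apply: le_trans (cauchy_schwarz_sqrt _ _ _) _.
  apply: ler_pM; rewrite ?sqrtr_ge0 //.
    apply: ler_wsqrtr; rewrite -nx big_mkcond; apply: ler_sum => j _.
    by rewrite real_normK ?num_real //; case: ifP => // _; rewrite sqr_ge0.
  rewrite -[leRHS](@ger0_norm _ (X * phi)) ?mulr_ge0 // -sqrtr_sqr ler_wsqrtr //.
  rewrite exprMn -X2; apply: (le_trans (y := sqnorm x * \sum_a w a * (theta a - 1) ^+ 2)); last first.
    by rewrite ler_wpM2l // sqnorm_ge0.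
  have -> : \sum_a w a * (theta a - 1) ^+ 2 =
      \sum_(j | far j) mu j ^+ 2 * \sum_a (P j a * (theta a - 1)) ^+ 2.
    under [RHS]eq_bigr => j _ do rewrite big_distrr /=.
    rewrite exchange_big; apply: eq_bigr => a _; rewrite big_distrl.
    by apply: eq_bigr => j _ /=; rewrite [in RHS]exprMn [RHS]mulrA.
  rewrite big_distrr; apply: ler_sum => j _ /=.
  rewrite real_normK ?num_real // exprMn [leRHS]mulrCA ler_wpM2l ?sqr_ge0 // [leRHS]mulrC.
  apply: le_trans (cauchy_schwarz xpredT (fun a => P j a * (theta a - 1)) x).
  rewrite le_eqVlt; apply/orP; left; apply/eqP; congr (_ ^+ 2).
  by apply: eq_bigr => a _; rewrite /z mulrA.
have all_le : \sum_j `|px j| * `|pz j| <= X * (eta * X).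
  apply: le_trans (cauchy_schwarz_sqrt _ _ _) _.
  under eq_bigr do rewrite real_normK ?num_real //.
  under [X in _ * Num.sqrt X]eq_bigr do rewrite real_normK ?num_real //.
  rewrite nx nz ler_wpM2l //.
  rewrite -[leRHS](@ger0_norm _ (eta * X)) ?mulr_ge0 // -sqrtr_sqr ler_wsqrtr //.
  by rewrite exprMn -X2.
have diff_le : `|quad (degree_scaled p) y - quad (degree_scaled p) x| <=
    (2 * phi + eta ^+ 2 + 2 * c * eta) * X ^+ 2.
  rewrite diffE.
  apply: (le_trans (y := \sum_j ((if far j then 2 * (`|px j| * `|mu j * pz j|) else 0) +
      2 * c * (`|px j| * `|pz j|) + pz j ^+ 2))).
    apply: le_trans (ler_norm_sum _ _ _) _; apply: ler_sum => j _.
    rewrite mulrDr; apply: le_trans (ler_normD _ _) _; apply: lerD; last first.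
      by rewrite normrM (ger0_norm (sqr_ge0 (pz j))) ler_piMl ?sqr_ge0 // mu_le1.
    rewrite !normrM (ger0_norm (ler0n R 2)).
    have pp : 0 <= `|px j| * `|pz j| by rewrite mulr_ge0.
    rewrite /far; case: (leP c `|mu j|) => [_|/ltW lt].
      by have := mulr_ge0 c0 pp; lra.
    by have := ler_wpM2r pp lt; lra.
  rewrite !big_split /= -big_mkcond /= -!big_distrr /= nz.
  have := ler_wpM2l c0 all_le; rewrite X2 in z2; lra.
apply: le_trans (ler_normB _ _) _; rewrite normrN X2.
have := le_trans (hC y) (ler_wpM2l nu0 y2); rewrite X2 -/Q -/Q4.
by move: diff_le; rewrite /phi; lra.
Qed.

End Perturbation.

(** * Fluctuations of the degrees *)

Section DegreeFluctuation.
Variables (R : realType) (n : nat) (p : 'M[R]_n).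
Hypothesis p01 : forall i j, 0 <= p i j <= 1.
Hypothesis p_sym : forall i j, p i j = p j i.

Implicit Types (E : {set 'I_n * 'I_n}).

Let t i := degree p i.

Lemma adjacency_noise E i j : E \subset slots n ->
  adjacency R E i j - p i j = noise p E (slot i j).
Proof.
move=> /fintype.subsetP sE; rewrite mxE /noise slot_sym //; congr (_%:R - _).
rewrite /slot; case: leqP => ij.
  case: (boolP ((j, i) \in E)) => [jiE|_]; last by rewrite orbF.
  have := sE _ jiE; rewrite inE /= => ji.
  by have e : i = j by [apply: val_inj; apply/eqP; rewrite eqn_leq ij ji]; subst; rewrite jiE.
case: (boolP ((i, j) \in E)) => [ijE|//].
by have := sE _ ijE; rewrite inE /= leqNgt ij.
Qed.

Definition incident (i : 'I_n) (e : 'I_n * 'I_n) := (i == e.1) || (i == e.2).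

Lemma sum_slot (f : 'I_n * 'I_n -> R) i :
  \sum_j f (slot i j) = \sum_(e in slots n) (incident i e)%:R * f e.
Proof.
pose other e := if i == e.1 then e.2 else e.1 : 'I_n.
rewrite [RHS](bigID (incident i)) /= [X in _ + X]big1 ?addr0; last first.
  by move=> e /andP[_ /negPf->]; rewrite mul0r.
rewrite (reindex_onto (slot i) other) /=; last first.
  move=> [a b] /andP[]; rewrite inE /= /incident /other /= => ab.
  case: (eqVneq i a) => [->|_] /=; first by rewrite /slot ab.
  by move=> /eqP->; rewrite slotC /slot ab.
apply: eq_big => [j|j _].
  rewrite slot_in /= /incident /other /slot.
  case: (leqP i j) => ij /=; rewrite eqxx ?orbT /= ?eqxx //.
  by case: (eqVneq i j) => [e|_]; rewrite ?e eqxx.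
by rewrite (_ : incident i (slot i j)) ?mul1r // /incident /slot; case: leqP; rewrite /= eqxx ?orbT.
Qed.

Lemma degree_noise E i : E \subset slots n -> degree (adjacency R E) i - t i =
  \sum_(e in slots n) (incident i e)%:R * noise p E e.
Proof.
move=> sE; rewrite -sum_slot /t /degree -sumrB.
by apply: eq_bigr => j _; rewrite adjacency_noise.
Qed.

Lemma incident_var_le i : \sum_(e in slots n) (incident i e)%:R * edge_var p e <= t i.
Proof.
rewrite -sum_slot; apply: ler_sum => j _.
by apply: le_trans (edge_var_le p01 _) _; rewrite slot_sym.
Qed.

Lemma sum_incident_le2 (c : 'I_n -> R) M e : (forall a, 0 <= c a <= M) ->
  \sum_a c a * (incident a e)%:R <= 2 * M.
Proof.
move=> cM; have M0 : 0 <= M by have := cM e.1; lra.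
apply: (le_trans (y := \sum_a ((a == e.1)%:R * M + (a == e.2)%:R * M))).
  apply: ler_sum => a _; have /andP[c0 c1] := cM a; rewrite /incident.
  by case: (a == e.1); case: (a == e.2); rewrite /= ?mulr1 ?mulr0 ?mul1r ?mul0r; lra.
rewrite big_split /= -!big_distrl /=.
have one x : \sum_(a < n) (a == x)%:R = 1 :> R.
  by rewrite (bigD1 x) //= eqxx big1 ?addr0 // => a /negPf->.
by rewrite !one; lra.
Qed.

Section Squares.
Variables (c : 'I_n -> R) (M : R).
Hypothesis c0 : forall a, 0 <= c a.
Hypothesis M0 : 0 <= M.
Hypothesis cM : forall e, \sum_a c a * (incident a e)%:R <= M.

Definition fluctuation E a := \sum_(e in slots n) (incident a e)%:R * noise p E e.

Let q e f := \sum_a c a * ((incident a e)%:R * (incident a f)%:R).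

Lemma weighted_fluctuationE E :
  \sum_a c a * fluctuation E a ^+ 2 = noise_form p q E.
Proof.
rewrite /noise_form /fluctuation.
under eq_bigr => a _. rewrite expr2 big_distrl big_distrr /=.
  under eq_bigr => e _ do rewrite big_distrr big_distrr /=. over.
rewrite exchange_big; apply: eq_bigr => e _ /=.
rewrite exchange_big; apply: eq_bigr => f _ /=.
by rewrite /q big_distrl; apply: eq_bigr => a _ /=; ring.
Qed.

Let q_ge0 e f : 0 <= q e f.
Proof. by apply: sumr_ge0 => a _; rewrite !mulr_ge0. Qed.

Let qee e : q e e = \sum_a c a * (incident a e)%:R.
Proof. by apply: eq_bigr => a _; case: incident; rewrite ?mulr1 ?mulr0. Qed.

Lemma expect_fluctuation_le :
  expect p (fun E => \sum_a c a * fluctuation E a ^+ 2) <= \sum_a c a * t a.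
Proof.
rewrite (_ : expect p _ = expect p (noise_form p q)); last first.
  by apply: eq_expect => E _; rewrite weighted_fluctuationE.
rewrite expect_noise_form //.
under eq_bigr => e _ do rewrite qee big_distrl /=.
rewrite exchange_big; apply: ler_sum => a _ /=.
under eq_bigr => e _ do rewrite -mulrA.
by rewrite -big_distrr /= ler_wpM2l // incident_var_le.
Qed.

(** The weighted sum of squares is a quadratic form [q] in the noise, so that
    [expect_noise_form_sqr] applies; one factor of [q ^ 2] is at most [M]. *)
Lemma expect_fluctuation_sqr :
  expect p (fun E => (\sum_a c a * fluctuation E a ^+ 2) ^+ 2) <=
  expect p (fun E => \sum_a c a * fluctuation E a ^+ 2) ^+ 2 +
  M * (2 * (\sum_a c a * t a ^+ 2) + \sum_a c a * t a).
Proof.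
have e1 : expect p (fun E => \sum_a c a * fluctuation E a ^+ 2) =
    \sum_(e in slots n) q e e * edge_var p e.
  rewrite -expect_noise_form //; apply: eq_expect => E _.
  by rewrite weighted_fluctuationE.
rewrite (_ : expect p (fun E => _ ^+ 2) = expect p (fun E => noise_form p q E ^+ 2)); last first.
  by apply: eq_expect => E _; rewrite weighted_fluctuationE.
apply: (le_trans (expect_noise_form_sqr p01 q_ge0 _)).
  by move=> e f; apply: eq_bigr => a _; rewrite [_%:R * _]mulrC.
rewrite e1 lerD2l.
have qM e f : q e f <= M.
  apply: le_trans (cM e); apply: ler_sum => a _; rewrite ler_wpM2l //.
  by case: (incident a f); rewrite ?mulr1 ?mulr0.
have vv e f : 0 <= edge_var p e * edge_var p f by rewrite mulr_ge0 ?edge_var_ge0.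
rewrite mulrDr mulrCA; apply: lerD.
  rewrite ler_wpM2l //.
  apply: (le_trans (y := M * \sum_(e in slots n) \sum_(f in slots n)
      q e f * (edge_var p e * edge_var p f))).
    rewrite big_distrr; apply: ler_sum => e _ /=; rewrite big_distrr.
    by apply: ler_sum => f _ /=; rewrite expr2 -mulrA ler_wpM2r // mulr_ge0.
  rewrite ler_wpM2l //.
  apply: (le_trans (y := \sum_a c a *
      (\sum_(e in slots n) (incident a e)%:R * edge_var p e) ^+ 2)).
    rewrite le_eqVlt; apply/orP; left; apply/eqP.
    under [RHS]eq_bigr => a _. rewrite expr2 big_distrl big_distrr /=.
      under eq_bigr => e _ do rewrite big_distrr big_distrr /=. over.
    rewrite [RHS]exchange_big; apply: eq_bigr => e _ /=.
    rewrite [RHS]exchange_big; apply: eq_bigr => f _ /=.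
    by rewrite /q big_distrl; apply: eq_bigr => a _ /=; ring.
  apply: ler_sum => a _; rewrite ler_wpM2l // lerXn2r ?nnegrE ?incident_var_le //.
    by apply: sumr_ge0 => e _; rewrite mulr_ge0 ?edge_var_ge0.
  by apply: sumr_ge0 => j _; have /andP[] := p01 a j.
apply: le_trans (ler_wpM2l M0 expect_fluctuation_le); rewrite e1 big_distrr.
apply: ler_sum => e _ /=; rewrite expr2 -mulrA ler_wpM2r // mulr_ge0 //.
exact: edge_var_ge0.
Qed.

End Squares.

(** The case of weights concentrated at [a]. *)
Lemma expect_fluctuation4 a : 1 <= t a ->
  expect p (fun E => fluctuation E a ^+ 4) <= 4 * t a ^+ 2.
Proof.
move=> t1; pose c b : R := (b == a)%:R.
have c0 b : 0 <= c b by rewrite /c.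
have pick (f : 'I_n -> R) : \sum_b c b * f b = f a.
  by rewrite (bigD1 a) //= /c eqxx mul1r big1 ?addr0 // => b /negPf->; rewrite mul0r.
have cM e : \sum_b c b * (incident b e)%:R <= 1 by rewrite pick; case: incident.
have := expect_fluctuation_sqr c0 ler01 cM; have := expect_fluctuation_le c0.
rewrite !pick => m1.
rewrite (_ : expect p (fun E => _ ^+ 2) = expect p (fun E => fluctuation E a ^+ 4)); last first.
  by apply: eq_expect => E _; rewrite pick -exprM.
have eE : expect p (fun E => \sum_b c b * fluctuation E b ^+ 2) =
    expect p (fun E => fluctuation E a ^+ 2).
  by apply: eq_expect => E _; rewrite pick.
rewrite eE in m1 *.
have m0 : 0 <= expect p (fun E => fluctuation E a ^+ 2).
  rewrite -(expect_cst p 0); apply: le_expect => // E _; exact: sqr_ge0.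
have : expect p (fun E => fluctuation E a ^+ 2) ^+ 2 <= t a ^+ 2.
  by rewrite ler_sqr ?nnegrE //; lra.
have : t a <= t a ^+ 2 by rewrite expr2; nra.
lra.
Qed.

End DegreeFluctuation.

(** * A non-asymptotic bound *)

Lemma sqrtr_le (R : realType) (a b : R) : 0 <= b -> a <= b ^+ 2 -> Num.sqrt a <= b.
Proof. by move=> b0 ab; rewrite -(ger0_norm b0) -sqrtr_sqr ler_wsqrtr. Qed.

Lemma le_sqrtr (R : realType) (a b : R) : 0 <= a -> a ^+ 2 <= b -> a <= Num.sqrt b.
Proof. by move=> a0 ab; rewrite -(ger0_norm a0) -sqrtr_sqr ler_wsqrtr. Qed.

Lemma norm_budget (R : realType) (e K eta : R) : e <= 1 -> 0 <= K <= e ->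
  0 <= eta <= e / 2 -> (2 + 5 * e + 8 * K) * (1 + eta) ^+ 2 <= 2 + 58 * e.
Proof.
move=> e1 /andP[K0 Ke] /andP[eta0 eta_e].
have ee : e * e <= e by rewrite ler_piMl //; lra.
have ete : eta * eta <= eta by rewrite ler_piMl //; lra.
apply: (le_trans (y := (2 + 13 * e) * (1 + 3 * e))); last by lra.
apply: ler_pM; rewrite ?sqr_ge0 //; [lra | lra |].
rewrite sqrrD expr1n mul1r expr2; lra.
Qed.

Section FixedSize.
Variables (R : realType) (n : nat) (p : 'M[R]_n) (x0 : 'I_n).
Hypothesis p01 : forall i j, 0 <= p i j <= 1.
Hypothesis p_sym : forall i j, p i j = p j i.
Implicit Types (E : {set 'I_n * 'I_n}).

Let t i := degree p i.
Let L : R := ln n%:R.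
Let N : R := n%:R.
Let delta := min_degree p.
Let D := Num.sqrt delta.

Let n_gt0 : (0 < n)%N.
Proof. exact: leq_ltn_trans (ltn_ord x0). Qed.

Let N0 : 0 < N.
Proof. by rewrite ltr0n. Qed.

Let delta_le i : delta <= t i.
Proof. by have [le _] := min_degreeP n_gt0 p01; apply: le. Qed.

Lemma degree_le_order i : t i <= N.
Proof.
rewrite /N -[n in n%:R]card_ord -sumr_const; apply: ler_sum => j _.
by have /andP[] := p01 i j.
Qed.

Let delta_N : delta <= N.
Proof. exact: le_trans (delta_le x0) (degree_le_order x0). Qed.

Lemma expR_neg_ln k : expR (- (k%:R * L)) = (N ^+ k)^-1.
Proof. by rewrite expRN expRM_natl lnK // posrE. Qed.

(** The sum has variance at most [t i].  The constant [4] makes the failure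
    probability [1 / n ^ 2], which survives a union bound over the vertices. *)
Lemma vertex_deviation i (u : 'I_n * 'I_n -> R) :
  (forall e, `|u e| <= 1) -> 0 < t i -> 0 <= L -> 4 * L <= t i ->
  graph_prob p (fun E => 4 * Num.sqrt (t i * L) <=
    \sum_(e in slots n) u e * (incident i e)%:R * noise p E e) <= (N ^+ 2)^-1.
Proof.
move=> u1 t0 L0 Lt.
have tL : 0 <= t i * L by rewrite mulr_ge0 // ltW.
have -> : (N ^+ 2)^-1 = expR (- ((4 * Num.sqrt (t i * L)) ^+ 2 / (8 * t i))).
  rewrite -expR_neg_ln exprMn sqr_sqrtr //; congr (expR (- _)).
  by field; rewrite gt_eqF.
apply: noise_chernoff => //.
- by move=> e; rewrite normrM; case: incident; rewrite ?normr1 ?normr0 ?mulr1 ?mulr0.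
- apply: le_trans (incident_var_le p01 p_sym i); apply: ler_sum => e _.
  rewrite ler_wpM2r ?edge_var_ge0 //; case: incident; rewrite ?mulr1 ?mulr0 ?expr0n //.
  by rewrite -real_normK ?num_real // exprn_ile1.
- rewrite mulr_ge0 ?sqrtr_ge0 //=.
  have : Num.sqrt (t i * L) <= t i / 2.
    apply: sqrtr_le; first by lra.
    by have := ler_wpM2l (ltW t0) Lt; rewrite expr_div_n expr2; lra.
  lra.
Qed.

Lemma some_vertex_deviation (u : 'I_n -> 'I_n * 'I_n -> R) :
  (forall i e, `|u i e| <= 1) -> 0 < delta -> 0 <= L -> 4 * L <= delta ->
  graph_prob p (fun E => [exists i, 4 * Num.sqrt (t i * L) <=
    \sum_(e in slots n) u i e * (incident i e)%:R * noise p E e]) <= N^-1.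
Proof.
move=> u1 d0 L0 Ld.
apply: le_trans (graph_prob_exists p01 (fun i E => 4 * Num.sqrt (t i * L) <=
    \sum_(e in slots n) u i e * (incident i e)%:R * noise p E e)) _.
apply: (le_trans (y := \sum_(i < n) (N ^+ 2)^-1)).
  apply: ler_sum => i _; apply: vertex_deviation => //.
    exact: lt_le_trans (delta_le i).
  exact: le_trans (delta_le i).
rewrite sumr_const card_ord -mulr_natl -/N expr2 invfM mulrA mulfV ?mul1r //.
by rewrite gt_eqF.
Qed.

(** The noise normalized by the expected degrees is multiplied by [D], the square root
    of the minimum degree, which makes the row variances at most [1] and the entries at
    most [1 / D]. *)
Definition noise_scale : 'M[R]_n := \matrix_(i, j) (D / (Num.sqrt (t i) * Num.sqrt (t j))).
Definition scaled_noise E : 'M[R]_n := \matrix_(i, j) weighted_noise p noise_scale E i j.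

Section LargeDegrees.
Hypothesis delta1 : 1 <= delta.

Let t_gt0 i : 0 < t i. Proof. exact: lt_le_trans ltr01 (le_trans delta1 (delta_le i)). Qed.
Let st_gt0 i : 0 < Num.sqrt (t i). Proof. by rewrite sqrtr_gt0. Qed.
Let D1 : 1 <= D. Proof. by rewrite -sqrtr1 ler_wsqrtr. Qed.
Let D2 : D ^+ 2 = delta. Proof. by rewrite sqr_sqrtr // (le_trans ler01 delta1). Qed.

Let D0 : 0 < D. Proof. exact: lt_le_trans ltr01 D1. Qed.
Let delta0 : 0 <= delta. Proof. exact: le_trans ler01 delta1. Qed.
Let sD0 : 0 < Num.sqrt D. Proof. by rewrite sqrtr_gt0. Qed.

(* The square of [kappa] bounds the entries. *)
Let kappa := (Num.sqrt D)^-1.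

Lemma kappa_sqr : kappa ^+ 2 = D^-1.
Proof. by rewrite exprVn sqr_sqrtr // ltW. Qed.

Lemma kappa01 : 0 < kappa <= 1.
Proof.
rewrite invr_gt0 sD0 /= invf_le1 //.
by rewrite -sqrtr1 ler_wsqrtr.
Qed.

Lemma noise_scale_sym i j : noise_scale i j = noise_scale j i.
Proof. by rewrite !mxE [_ * Num.sqrt (t j)]mulrC. Qed.

Lemma noise_scale_bound i j : 0 <= noise_scale i j <= kappa ^+ 2.
Proof.
rewrite kappa_sqr mxE divr_ge0 ?mulr_ge0 ?sqrtr_ge0 //=.
rewrite ler_pdivrMr ?mulr_gt0 // mulrC ler_pdivlMr // -expr2 D2.
by rewrite -D2 expr2; apply: ler_pM; rewrite ?(ltW D0) // ler_wsqrtr.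
Qed.

Lemma noise_scale_sqr i j : noise_scale i j ^+ 2 = delta / (t i * t j).
Proof. by rewrite mxE expr_div_n exprMn D2 !sqr_sqrtr // ltW. Qed.

Lemma scaled_row_var i : \sum_j weighted_var p noise_scale i j <= 1.
Proof.
apply: (le_trans (y := \sum_j p i j / t i)); last first.
  by rewrite -big_distrl /= mulfV // gt_eqF // t_gt0.
apply: ler_sum => j _; rewrite /weighted_var noise_scale_sqr.
have := edge_var_le p01 (slot i j); rewrite slot_sym // => vp.
have v0 := edge_var_ge0 p01 (slot i j).
rewrite mulrAC ler_pdivrMr ?mulr_gt0 //.
have -> : p i j / t i * (t i * t j) = t j * p i j by field; rewrite gt_eqF.
exact: ler_pM.
Qed.

Lemma scaled_noise_sym E : (scaled_noise E)^T = scaled_noise E.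
Proof.
by apply/matrixP => i j; rewrite !mxE weighted_noise_sym //; exact: noise_scale_sym.
Qed.

Lemma scaled_noiseE E i j : E \subset slots n ->
  degree_scaled p (adjacency R E - p) i j = scaled_noise E i j / D.
Proof.
move=> sE.
rewrite !mxE [_ + _](_ : _ = adjacency R E i j - p i j); last by rewrite mxE.
rewrite (adjacency_noise p_sym) // /weighted_noise mxE -/(t i) -/(t j).
have := st_gt0 i; have := st_gt0 j; move: (Num.sqrt _) (Num.sqrt _) => u v v0 u0.
by field; rewrite !gt_eqF.
Qed.

Lemma scaled_noise_norm E i j : `|scaled_noise E i j| <= D^-1.
Proof.
rewrite mxE /weighted_noise normrM -[leRHS]mulr1; apply: ler_pM => //.
  have /andP[c0 c1] := noise_scale_bound i j.
  by rewrite ger0_norm // -kappa_sqr.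
exact: noise_norm.
Qed.

(** For an indicator [X] of mean [q], the square of [X - q] is [q * (1 - q)] plus
    [(1 - 2 * q) * (X - q)]: the deviation of the square norm of a row is again a
    centred sum over the edges at one vertex. *)
Lemma scaled_row_sqr E i : \sum_j scaled_noise E i j ^+ 2 <=
  1 + (\sum_(e in slots n) (1 - 2 * p e.1 e.2) * (incident i e)%:R * noise p E e) / t i.
Proof.
apply: (le_trans (y := \sum_j noise p E (slot i j) ^+ 2 / t i)).
  apply: ler_sum => j _; rewrite mxE /weighted_noise exprMn noise_scale_sqr.
  rewrite mulrC ler_wpM2l ?sqr_ge0 // ler_pdivrMr ?mulr_gt0 //.
  rewrite mulrA mulVf ?mul1r ?gt_eqF //; exact: delta_le.
rewrite -big_distrl /= ler_pdivrMr // mulrDl mul1r divfK ?gt_eqF //.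
have -> : \sum_(e in slots n) (1 - 2 * p e.1 e.2) * (incident i e)%:R * noise p E e =
    \sum_j (1 - 2 * p i j) * noise p E (slot i j).
  transitivity (\sum_j (1 - 2 * p (slot i j).1 (slot i j).2) * noise p E (slot i j)).
    rewrite (sum_slot (fun e => (1 - 2 * p e.1 e.2) * noise p E e)).
    by apply: eq_bigr => e _; ring.
  by apply: eq_bigr => j _; rewrite slot_sym.
rewrite /t /degree -big_split; apply: ler_sum => j _ /=.
rewrite /noise slot_sym //; have /andP[q0 q1] := p01 i j.
by case: (_ \in E) => /=; nra.
Qed.

(** Over [2 * l] steps the growth rates [1 + e / 2] and [1 + e] diverge by a factor
    [n ^ 4], which absorbs the polynomial factors in the moment bound. *)
Lemma growth_ratio (e : R) l : 0 < e <= 1 -> 8 * L <= e * l%:R ->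
  ((1 + e / 2) / (1 + e)) ^+ (2 * l) <= (N ^+ 4)^-1.
Proof.
move=> /andP[e0 e1] lL.
have q0 : 0 <= (1 + e / 2) / (1 + e) by rewrite divr_ge0; lra.
have q1 : (1 + e / 2) / (1 + e) <= expR (- (e / 4)).
  apply: le_trans (expR_ge1Dx _); rewrite ler_pdivrMr; last by lra.
  have : e * e <= e by rewrite ler_piMl; lra.
  lra.
apply: (le_trans (y := expR (- (e / 4)) ^+ (2 * l))).
  by rewrite lerXn2r // nnegrE expR_ge0.
rewrite -expRM_natl -expR_neg_ln ler_expR natrM; lra.
Qed.

(** Markov's inequality for the energy.  The walks have length of order [ln n / e], and
    [expect_nb_energy] asks that this be at most [kappa ^ -1] times a constant.  As
    [kappa] is the inverse fourth root of the minimum degree, this is where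
    [ln ^ 4 n] comes from. *)
Lemma few_nb_walks (e : R) l : 0 < e <= 1 -> 1 <= L -> 8 * L <= e * l%:R ->
  e * l%:R <= 8 * L + e -> (320 / e ^+ 3) ^+ 4 * L ^+ 4 <= delta ->
  graph_prob p (fun E => (1 + e) ^+ (2 * l) <=
    5 * n%:R * nb_energy x0 (scaled_noise E) l.+1) <= 80 / (e * N).
Proof.
move=> /[dup] e01 /andP[e0 e1] L1 lL lU dL.
have k0 := andP kappa01; pose b := e / 4.
have b01 : 0 < b <= 1 by rewrite /b; lra.
(* The number [l + 1] of steps is at most [10 * L / e]; and [20 * L / e] divided by
   [b ^ 2 = e ^ 2 / 16] is [320 * L / e ^ 3]. *)
have k_le : (2 * l.+1)%:R * kappa <= b ^+ 2.
  rewrite /kappa ler_pdivrMr //.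
  have y0 : 0 <= 320 / e ^+ 3 * L.
    by rewrite mulr_ge0 ?divr_ge0 ?exprn_ge0 ?ltW //; lra.
  have : 320 / e ^+ 3 * L <= Num.sqrt D.
    by apply: le_sqrtr => //; apply: le_sqrtr; rewrite ?sqr_ge0 // -exprM exprMn.
  have b20 : 0 <= b ^+ 2 by rewrite sqr_ge0.
  move=> /(ler_wpM2l b20); apply: le_trans.
  have -> : b ^+ 2 * (320 / e ^+ 3 * L) = 20 * L / e by rewrite /b; field; rewrite gt_eqF.
  rewrite ler_pdivlMr // natrM -[l.+1%:R]natr1; nra.
have en0 E : 0 <= nb_energy x0 (scaled_noise E) l.+1.
  by apply: sumr_ge0 => k _; rewrite sqr_ge0.
have e10 : 0 < (1 + e) ^+ (2 * l) by rewrite exprn_gt0 //; lra.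
apply: (le_trans (markov p01 e10 _)) => [E _|]; first by rewrite !mulr_ge0.
rewrite ler_pdivrMr // expectZ.
have enE : expect p (fun E => nb_energy x0 (scaled_noise E) l.+1) =
    expect p (fun E => nb_energy x0 (weighted_noise p noise_scale E) l.+1).
  apply: eq_expect => E _; congr (nb_energy x0 _ l.+1).
  by apply/funext => i; apply/funext => j; rewrite mxE.
have := expect_nb_energy x0 (ltn0Sn l) p01 noise_scale_sym kappa01
  noise_scale_bound b01 scaled_row_var k_le.
rewrite -enE; move: (expect p _) => X Xle.
have rho : 1 + b + b ^+ 2 <= 1 + e / 2.
  have : e ^+ 2 <= e by rewrite expr2 ler_piMl; lra.
  by rewrite /b expr_div_n; lra.
have k3 : (kappa ^+ 3)^-1 <= N.
  have -> : (kappa ^+ 3)^-1 = Num.sqrt D ^+ 3 by rewrite /kappa exprVn invrK.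
  apply: le_trans delta_N; rewrite -D2.
  have -> : D ^+ 2 = Num.sqrt D ^+ 4 by rewrite (exprM _ 2 2) sqr_sqrtr // ltW.
  by apply: ler_weXn2l => //; rewrite -sqrtr1 ler_wsqrtr.
have X2 : X <= N * (N * (4 * (1 + e / 2) ^+ (2 * l)) / b).
  apply: le_trans Xle _.
  have b0 : 0 < b by rewrite /b; lra.
  have r0 : 0 <= 1 + b + b ^+ 2 by have := sqr_ge0 b; lra.
  apply: ler_pM => //.
  - by rewrite invr_ge0 exprn_ge0 // invr_ge0 sqrtr_ge0.
  - by rewrite divr_ge0 ?(ltW b0) // mulr_ge0 // exprn_ge0.
  rewrite ler_wpM2r ?invr_ge0 ?(ltW b0) // ler_wpM2l ?(ltW N0) //.
  rewrite mulnS exprD; apply: ler_pM; rewrite ?exprn_ge0 //.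
    have : (1 + b + b ^+ 2) ^+ 2 <= 2 ^+ 2 by rewrite lerXn2r ?nnegrE //; lra.
    by lra.
  by rewrite lerXn2r ?nnegrE //; lra.
have gr := growth_ratio e01 lL; rewrite expr_div_n ler_pdivrMr // in gr.
apply: (le_trans (y := 5 * N * (N * (N * (4 * ((N ^+ 4)^-1 * (1 + e) ^+ (2 * l))) / b)))).
  rewrite ler_wpM2l ?mulr_ge0 ?(ltW N0) //; apply: le_trans X2 _.
  rewrite ler_wpM2l ?(ltW N0) // ler_wpM2r ?invr_ge0 ?divr_ge0 ?(ltW e0) //.
  by rewrite ler_wpM2l ?(ltW N0) // ler_wpM2l.
rewrite le_eqVlt; apply/orP; left; apply/eqP; rewrite /b; field.
by rewrite !gt_eqF.
Qed.

Section Weights.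
Variables (w : 'I_n -> R) (W : R).
Hypothesis w_bound : forall a, 0 <= w a <= delta^-1.
Hypothesis w_sum : \sum_a w a = W.

Let dev E a := fluctuation p E a / t a.

Let w0 a : 0 <= w a. Proof. by have /andP[] := w_bound a. Qed.
Let W0 : 0 <= W. Proof. by rewrite -w_sum; apply: sumr_ge0. Qed.
Let d0 : 0 < delta. Proof. exact: lt_le_trans ltr01 delta1. Qed.

Let div_le a k : w a / t a ^+ k <= w a / delta ^+ k.
Proof.
rewrite ler_wpM2l // lef_pV2 ?posrE ?exprn_gt0 // lerXn2r ?nnegrE ?(ltW (t_gt0 a)) //.
Qed.

(** Chebyshev's inequality: the mean is at most [W / delta], and the variance is at most
    [6 * W / delta ^ 3], which is small against the square of [1 / delta] as long as
    [W] is small against [delta]. *)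
Lemma weighted_square_prob (e : R) : 0 < e ->
  graph_prob p (fun E => (W + e ^+ 2) / delta <= \sum_a w a * dev E a ^+ 2) <=
  6 * W / (e ^+ 4 * delta).
Proof.
move=> e0; pose c a := w a / t a ^+ 2; pose M := 2 * (delta ^+ 3)^-1.
have c0 a : 0 <= c a by rewrite divr_ge0 ?sqr_ge0.
have M0 : 0 <= M by rewrite mulr_ge0 // invr_ge0 exprn_ge0 // ltW.
have cM f : \sum_a c a * (incident a f)%:R <= M.
  apply: sum_incident_le2 => a; rewrite c0 /=.
  apply: le_trans (div_le a 2) _; have /andP[_ wd] := w_bound a.
  have -> : (delta ^+ 3)^-1 = delta^-1 / delta ^+ 2 by field; rewrite gt_eqF.
  by rewrite ler_wpM2r // invr_ge0 sqr_ge0.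
have QE E : \sum_a w a * dev E a ^+ 2 = \sum_a c a * fluctuation p E a ^+ 2.
  by apply: eq_bigr => a _; rewrite /dev /c expr_div_n; ring.
have ct2 : \sum_a c a * t a ^+ 2 = W.
  by rewrite -w_sum; apply: eq_bigr => a _; rewrite /c divfK // expf_neq0 // gt_eqF.
have ct : \sum_a c a * t a <= W / delta.
  rewrite -w_sum big_distrl; apply: ler_sum => a _ /=.
  have -> : c a * t a = w a / t a ^+ 1 by rewrite /c; field; rewrite gt_eqF.
  exact: div_le a 1%N.
have ct0 : 0 <= \sum_a c a * t a by apply: sumr_ge0 => a _; rewrite mulr_ge0 // ltW.
have m1 := expect_fluctuation_le p01 p_sym c0.
have m2 := expect_fluctuation_sqr p01 p_sym c0 M0 cM.
rewrite -/t in m1 m2.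
set m := expect p _ in m1 m2.
have s0 : 0 < e ^+ 2 / delta by rewrite divr_gt0 ?exprn_gt0.
apply: (le_trans (y := graph_prob p (fun E => m + e ^+ 2 / delta <=
    \sum_a c a * fluctuation p E a ^+ 2))).
  apply: graph_prob_le => // E _; rewrite QE mulrDl; apply: le_trans.
  by rewrite lerD2r; apply: le_trans ct.
apply: le_trans (chebyshev p01 s0 m2 erefl) _.
rewrite ct2; apply: (le_trans (y := (M * (2 * W + W)) / (e ^+ 2 / delta) ^+ 2)).
  rewrite ler_wpM2r ?invr_ge0 ?sqr_ge0 // ler_wpM2l // lerD2l.
  by apply: le_trans ct _; rewrite ler_pdivrMr // ler_peMr.
rewrite le_eqVlt; apply/orP; left; apply/eqP; rewrite /M; field.
by rewrite !gt_eqF.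
Qed.

Lemma weighted_fourth_prob (e : R) : 0 < e ->
  graph_prob p (fun E => e ^+ 2 / delta <= \sum_a w a * dev E a ^+ 4) <=
  4 * W / (e ^+ 2 * delta).
Proof.
move=> e0; have s0 : 0 < e ^+ 2 / delta by rewrite divr_gt0 ?exprn_gt0.
apply: (le_trans (markov p01 s0 _)) => [E _|].
  by apply: sumr_ge0 => a _; rewrite mulr_ge0 // (exprM _ 2 2) sqr_ge0.
rewrite expect_sum ler_pdivrMr //.
have -> : 4 * W / (e ^+ 2 * delta) * (e ^+ 2 / delta) = \sum_a 4 * (w a / delta ^+ 2).
  by rewrite -big_distrr -big_distrl /= w_sum; field; rewrite !gt_eqF.
apply: ler_sum => a _.
have -> : expect p (fun E => w a * dev E a ^+ 4) =
    w a / t a ^+ 4 * expect p (fun E => fluctuation p E a ^+ 4).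
  by rewrite -expectZ; apply: eq_expect => E _; rewrite /dev expr_div_n; ring.
have t1 : 1 <= t a := le_trans delta1 (delta_le a).
have c0 : 0 <= w a / t a ^+ 4 by rewrite divr_ge0 // exprn_ge0 // ltW.
apply: (le_trans (ler_wpM2l c0 (expect_fluctuation4 p01 p_sym t1))).
have -> : w a / t a ^+ 4 * (4 * degree p a ^+ 2) = 4 * (w a / t a ^+ 2).
  by rewrite -/(t a); field; rewrite gt_eqF.
by rewrite ler_wpM2l // div_le.
Qed.

End Weights.

Lemma quad_degree_scaled E y : E \subset slots n ->
  quad (degree_scaled p (adjacency R E - p)) y = quad (scaled_noise E) y / D.
Proof.
move=> sE; rewrite /quad big_distrl; apply: eq_bigr => i _ /=.
rewrite big_distrl; apply: eq_bigr => j _ /=.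
by rewrite scaled_noiseE //; ring.
Qed.

(** When the deviations at every vertex, the energy and the weighted moments of the
    relative degree fluctuations are all under control, [nb_norm_bound] bounds the
    normalized noise by [(2 + O(e)) / D], the weighted second moment contributes
    [sqrt W / D], and all other terms of [laplacian_perturbation] are [O(e / D)]. *)
Lemma lambda_bound_of_events E (w : 'I_n -> R) W (e c : R) l :
  E \subset slots n -> 0 < e <= 1 -> 1 <= L -> 320 * L <= e * D ->
  0 <= c -> 8 * c * Num.sqrt L <= e -> 0 <= W ->
  let dev u i := \sum_(f in slots n) u f * (incident i f)%:R * noise p E f in
  let r a := fluctuation p E a / t a in
  (forall i, dev (fun=> 1) i <= 4 * Num.sqrt (t i * L)) ->
  (forall i, dev (fun=> -1) i <= 4 * Num.sqrt (t i * L)) ->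
  (forall i, dev (fun f => 1 - 2 * p f.1 f.2) i <= 4 * Num.sqrt (t i * L)) ->
  5 * n%:R * nb_energy x0 (scaled_noise E) l.+1 < (1 + e) ^+ (2 * l) ->
  \sum_a w a * r a ^+ 2 <= (W + e ^+ 2) / delta ->
  \sum_a w a * r a ^+ 4 <= e ^+ 2 / delta ->
  (forall (nu eta : R),
      (forall y, `|quad (degree_scaled p (adjacency R E - p)) y| <= nu * sqnorm y) ->
      0 <= c -> 0 <= nu -> eta <= 1 / 2 -> (forall a, `|r a| <= eta) ->
      forall i, `|lambda (laplacian (adjacency R E)) i - lambda (laplacian p) i| <=
        nu * (1 + eta) ^+ 2 + (Num.sqrt (\sum_a w a * r a ^+ 2) +
          2 * Num.sqrt (\sum_a w a * r a ^+ 4)) + eta ^+ 2 + 2 * c * eta) ->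
  forall i, `|lambda (laplacian (adjacency R E)) i - lambda (laplacian p) i| <=
    (2 + Num.sqrt W + 63 * e) / D.
Proof.
move=> sE /[dup] e01 /andP[e0 e1] L1 LeD c0 cL W0 dev r h1 h2 h3 hen hQ hQ4 pert.
have LL0 : 0 <= L by lra.
have dD := D0; have dD2 := D2.
pose s := Num.sqrt L; have s0 : 0 <= s by rewrite sqrtr_ge0.
have s2 : s ^+ 2 = L by rewrite sqr_sqrtr.
(* The relative deviation of every degree is at most [eta]. *)
pose eta := 4 * s / D; have eta0 : 0 <= eta by rewrite divr_ge0 ?mulr_ge0 ?(ltW dD).
have eD : 320 <= e * D by lra.
have eta2 : eta ^+ 2 = 16 * L / delta.
  by rewrite /eta expr_div_n exprMn s2 D2; field; rewrite gt_eqF // -D2 exprn_gt0.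
have eta_e : eta ^+ 2 <= (e / 2) ^+ 2.
  rewrite eta2 ler_pdivrMr -D2 ?exprn_gt0 //.
  have -> : (e / 2) ^+ 2 * D ^+ 2 = (e * D) * (e * D) / 4 by field.
  have := ler_pM (_ : 0 <= 320) (_ : 0 <= 320 * L) eD LeD; lra.
have {}eta_e : eta <= e / 2 by rewrite ler_sqr ?nnegrE in eta_e; lra.
have sqE i : 4 * Num.sqrt (t i * L) <= eta * t i.
  have ti := t_gt0 i; rewrite sqrtrM ?(ltW ti) // -/s /eta.
  have -> : 4 * s / D * t i = 4 * (Num.sqrt (t i) * s) * (Num.sqrt (t i) / D).
    by rewrite -{1}(sqr_sqrtr (ltW ti)); field; rewrite gt_eqF.
  rewrite ler_peMr ?mulr_ge0 ?sqrtr_ge0 // ler_pdivlMr // mul1r ler_wsqrtr //.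
have rE a : `|r a| <= eta.
  rewrite /r normrM normfV (gtr0_norm (t_gt0 a)) ler_pdivrMr //.
  apply: le_trans (sqE a); rewrite ler_norml lerNl.
  apply/andP; split.
    apply: le_trans (h2 a); rewrite /fluctuation -sumrN le_eqVlt; apply/orP; left.
    by apply/eqP/eq_bigr => f _; ring.
  apply: le_trans (h1 a); rewrite le_eqVlt; apply/orP; left.
  by apply/eqP/eq_bigr => f _; ring.
pose nu := (2 + 5 * e + 8 * D^-1) / D.
have iD0 : 0 <= D^-1 by rewrite invr_ge0 ltW.
have iDe : D^-1 <= e by rewrite -[leLHS]div1r ler_pdivrMr //; lra.
have iDh : D^-1 <= 1 / 2.
  rewrite -[leLHS]div1r ler_pdivrMr //.
  have : e * D <= D by rewrite ler_piMl // (ltW dD).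
  lra.
have nu0 : 0 <= nu by rewrite divr_ge0 ?(ltW dD) // ; lra.
have norm_ok y : `|quad (degree_scaled p (adjacency R E - p)) y| <= nu * sqnorm y.
  rewrite quad_degree_scaled // normrM normfV (gtr0_norm dD) ler_pdivrMr //.
  rewrite (_ : nu * sqnorm y * D = (2 + 5 * e + 8 * D^-1) * sqnorm y); last first.
    by rewrite /nu; field; rewrite gt_eqF.
  apply: (@nb_norm_bound _ _ x0 (scaled_noise E) D^-1 e l) => //.
  - exact: scaled_noise_sym.
  - exact: scaled_noise_norm.
  - by rewrite ltW.
  move=> i; apply: le_trans (scaled_row_sqr E i) _; rewrite lerD2l ler_pdivrMr //.
  apply: le_trans (h3 i) (le_trans (sqE i) _).
  by rewrite ler_wpM2r ?(ltW (t_gt0 i)) //; lra.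
have half : eta <= 1 / 2 by lra.
move=> i; apply: le_trans (pert nu eta norm_ok c0 nu0 half rE i) _.
rewrite ler_pdivlMr //.
have q1 : Num.sqrt (\sum_a w a * r a ^+ 2) * D <= Num.sqrt W + e.
  rewrite -ler_pdivlMr //; apply: sqrtr_le.
    by rewrite divr_ge0 ?addr_ge0 ?sqrtr_ge0 ?(ltW dD) ?(ltW e0).
  rewrite expr_div_n D2; apply: le_trans hQ _.
  rewrite ler_wpM2r ?invr_ge0 // sqrrD sqr_sqrtr //.
  have : 0 <= Num.sqrt W * e by rewrite mulr_ge0 ?sqrtr_ge0 ?(ltW e0).
  lra.
have q2 : Num.sqrt (\sum_a w a * r a ^+ 4) * D <= e.
  rewrite -ler_pdivlMr //; apply: sqrtr_le; first by rewrite divr_ge0 ?(ltW e0) ?(ltW dD).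
  by rewrite expr_div_n D2.
have q3 : eta ^+ 2 * D <= e.
  rewrite eta2 -D2 (_ : _ * D = 16 * L / D); last by field; rewrite gt_eqF.
  by rewrite ler_pdivrMr //; lra.
have q4 : 2 * c * eta * D <= e.
  by rewrite (_ : _ * D = 8 * c * s) //; rewrite /eta; field; rewrite gt_eqF.
have q5 : nu * (1 + eta) ^+ 2 * D <= 2 + 58 * e.
  rewrite (_ : _ * D = (2 + 5 * e + 8 * D^-1) * (1 + eta) ^+ 2); last first.
    by rewrite /nu; field; rewrite gt_eqF.
  by apply: norm_budget; rewrite ?iD0 ?eta0.
move: q1 q2 q3 q4 q5; move: (Num.sqrt (\sum_a _)) (Num.sqrt (\sum_a _)) => x y.
move: (nu * _) (eta ^+ 2) (2 * c * eta) (Num.sqrt W) => z1 z2 z3 z4 h1' h2' h3' h4' h5'.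
rewrite (_ : _ * D = z1 * D + (y * D + (x * D + x * D)) + z2 * D + z3 * D); last by ring.
apply: (le_trans (lerD (lerD (lerD h5' (lerD h1' (lerD h2' h2'))) h3') h4')).
by rewrite le_eqVlt; apply/orP; left; apply/eqP; ring.
Qed.

End LargeDegrees.

(** A union bound over the events excluded in [lambda_bound_of_events].  The bound
    [W <= k] on the sum over the far eigenvalues makes the last two probabilities
    small, which is what the assumption on the number of those eigenvalues is for. *)
Theorem laplacian_failure_prob (e B c : R) :
  0 < e <= 1 -> (320 / e ^+ 3) ^+ 4 <= B -> 1 <= L -> B * L ^+ 4 <= delta ->
  B * (size (far_eigvals (laplacian p) c))%:R <= delta ->
  0 <= c -> 8 * c * Num.sqrt L <= e ->
  graph_prob p (fun E => ~~ [forall i : 'I_n,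
    `|lambda (laplacian (adjacency R E)) i - lambda (laplacian p) i| <=
    (2 + Num.sqrt (\sum_(x <- far_eigvals (laplacian p) c) (1 - x) ^+ 2) + 63 * e) / D]) <=
  93 / (e ^+ 4 * B).
Proof.
move=> /[dup] e01 /andP[e0 e1] Bb L1 BL Bk c0 cL.
pose b := 320 / e ^+ 3.
have e3 : e ^+ 3 <= e by rewrite exprS ler_piMr ?(ltW e0) // exprn_ile1 ?(ltW e0).
have b320 : 320 / e <= b.
  by rewrite /b ler_wpM2l // lef_pV2 ?posrE ?exprn_gt0.
have e320 : 320 <= 320 / e by rewrite ler_pdivlMr //; lra.
have b1 : 1 <= b by lra.
have b4 : 1 <= b ^+ 4 by rewrite exprn_ege1.
have B1 : 1 <= B := le_trans b4 Bb.
have L4 : 1 <= L ^+ 4 by rewrite exprn_ege1.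
have Bd : B <= delta.
  by apply: le_trans BL; rewrite ler_peMr // (le_trans ler01 B1).
have d1 : 1 <= delta := le_trans B1 Bd.
have d0 : 0 < delta := lt_le_trans ltr01 d1.
have bL4 : b ^+ 4 * L ^+ 4 <= delta.
  by apply: le_trans BL; rewrite ler_wpM2r // (le_trans ler01 L4).
have LL0 : 0 <= L := le_trans ler01 L1.
have bL0 : 0 <= b * L by rewrite mulr_ge0 //; lra.
have bLD : (b * L) ^+ 2 <= D.
  by apply: le_sqrtr; rewrite ?sqr_ge0 // -exprM exprMn.
have bL1 : 1 <= b * L by rewrite -[1](mulr1 1) ler_pM.
have LeD : 320 * L <= e * D.
  rewrite [leRHS]mulrC -ler_pdivrMr // mulrAC.
  apply: le_trans bLD; apply: (le_trans (y := b * L)).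
    by rewrite ler_wpM2r.
  by rewrite expr2 ler_peMr.
have L4d : 4 * L <= delta.
  have dD : 0 < D by rewrite sqrtr_gt0.
  have DD : D ^+ 2 = delta by rewrite sqr_sqrtr // ltW.
  have eDD : e * D <= D by rewrite ler_piMl // (ltW dD).
  have D1' : D <= D ^+ 2 by rewrite expr2 ler_peMr ?(ltW dD) // -sqrtr1 ler_wsqrtr.
  by rewrite -DD; lra.
pose x := 8 * L / e; have x_ge0 : 0 <= x by rewrite divr_ge0 ?mulr_ge0 // ltW.
pose l := (Num.truncn x).+1.
have /andP[tr1 tr2] := truncn_itv x_ge0.
have lL : 8 * L <= e * l%:R.
  by rewrite [leRHS]mulrC -ler_pdivrMr // -/x ltW.
have lU : e * l%:R <= 8 * L + e.
  rewrite /l -natr1 mulrDr mulr1 lerD2r mulrC -ler_pdivlMr //.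
have [w [wb wS pert]] := laplacian_perturbation c p01 p_sym d0 delta_le.
rewrite -(sum_far_eigvals c p_sym) in wS.
set W := \sum_(x <- far_eigvals _ _) _ in wS *.
have W0 : 0 <= W by rewrite -wS; apply: sumr_ge0 => a _; have /andP[] := wb a.
have Wk : W <= delta / B.
  rewrite ler_pdivlMr ?(lt_le_trans ltr01 B1) // mulrC; apply: le_trans Bk.
  rewrite ler_wpM2l ?(le_trans ler01 B1) // /W (sum_far_eigvals c p_sym).
  exact: sum_far_le_size p01 p_sym d0 delta_le.
pose dev u i E := \sum_(f in slots n) u f * (incident i f)%:R * noise p E f.
pose r E a := fluctuation p E a / t a.
pose bad1 (u : 'I_n * 'I_n -> R) E := [exists i, 4 * Num.sqrt (t i * L) <= dev u i E].
pose bad4 E := (1 + e) ^+ (2 * l) <= 5 * n%:R * nb_energy x0 (scaled_noise E) l.+1.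
pose bad5 E := (W + e ^+ 2) / delta <= \sum_a w a * r E a ^+ 2.
pose bad6 E := e ^+ 2 / delta <= \sum_a w a * r E a ^+ 4.
pose u3 (f : 'I_n * 'I_n) := 1 - 2 * p f.1 f.2.
have u3_le f : `|u3 f| <= 1.
  by have /andP[q0 q1] := p01 f.1 f.2; rewrite /u3 ler_norml; lra.
have P1 u : (forall f, `|u f| <= 1) -> graph_prob p (bad1 u) <= N^-1.
  by move=> u1; apply: (some_vertex_deviation (u := fun=> u)).
have P11 := P1 (fun=> 1) (fun=> _); have P12 := P1 (fun=> -1) (fun=> _).
have P13 := P1 u3 u3_le.
have P4 : graph_prob p bad4 <= 80 / (e * N) by apply: few_nb_walks.
have P5 : graph_prob p bad5 <= 6 * W / (e ^+ 4 * delta) by apply: weighted_square_prob.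
have P6 : graph_prob p bad6 <= 4 * W / (e ^+ 2 * delta) by apply: weighted_fourth_prob.
apply: (le_trans (y := graph_prob p (predU (bad1 (fun=> 1)) (predU (bad1 (fun=> -1))
    (predU (bad1 u3) (predU bad4 (predU bad5 bad6))))))).
  apply: graph_prob_le => // E sE; apply: contraR.
  rewrite !inE /= !negb_or => /and5P[n1 n2 n3 n4 /andP[n5 n6]].
  have un u : ~~ bad1 u E -> forall i, dev u i E <= 4 * Num.sqrt (t i * L).
    by rewrite negb_exists => /forallP h i; have := h i; rewrite -ltNge => /ltW.
  apply/forallP => i.
  apply: (@lambda_bound_of_events d1 E w W e c l) => //; try exact: un.
  - by rewrite ltNge.
  - by move: n5; rewrite -ltNge => /ltW.
  - by move: n6; rewrite -ltNge => /ltW.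
  move=> nu eta hn cc hnu he hr.
  have drE a : (degree (adjacency R E) a - t a) / t a = r E a.
    by rewrite /r /fluctuation (degree_noise p_sym).
  have := pert (adjacency R E) nu eta (adjacency_sym R E) hn cc hnu he.
  rewrite (eq_bigr (fun a => w a * r E a ^+ 2)); last by move=> a _; rewrite drE.
  rewrite [X in _ + 2 * Num.sqrt X](eq_bigr (fun a => w a * r E a ^+ 4)); last first.
    by move=> a _; rewrite drE.
  move=> H; apply: H => a; rewrite -/(t a) drE; exact: hr.
have e40 : 0 < e ^+ 4 by rewrite exprn_gt0.
have e41 : e ^+ 4 <= e by rewrite exprS ler_piMr ?(ltW e0) // exprn_ile1 ?(ltW e0).
have B0 : 0 < B := lt_le_trans ltr01 B1.
have BN : B <= N := le_trans Bd delta_N.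
have eBN : e ^+ 4 * B <= e * N by apply: ler_pM; rewrite ?(ltW e40) ?(ltW B0).
have q0 : 0 < e ^+ 4 * B by rewrite mulr_gt0.
pose q := (e ^+ 4 * B)^-1.
have qE : q = B^-1 / e ^+ 4 by rewrite /q; field; rewrite !gt_eqF.
have Nq : N^-1 <= q.
  rewrite lef_pV2 ?posrE //; apply: le_trans eBN _.
  by rewrite ler_piMl ?(ltW N0).
have Q4 : 80 / (e * N) <= 80 * q by rewrite ler_wpM2l // lef_pV2 ?posrE ?mulr_gt0.
have WB : W / delta <= B^-1.
  rewrite ler_pdivrMr // mulrC; exact: Wk.
have Q5 : 6 * W / (e ^+ 4 * delta) <= 6 * q.
  have -> : 6 * W / (e ^+ 4 * delta) = 6 * (W / delta / e ^+ 4).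
    by field; rewrite !gt_eqF.
  by rewrite ler_wpM2l // qE ler_wpM2r // invr_ge0 (ltW e40).
have Q6 : 4 * W / (e ^+ 2 * delta) <= 4 * q.
  have -> : 4 * W / (e ^+ 2 * delta) = 4 * (W / delta * (e ^+ 2)^-1).
    by field; rewrite !gt_eqF.
  rewrite ler_wpM2l // qE.
  apply: ler_pM => //; first by rewrite divr_ge0 // (ltW d0).
    by rewrite invr_ge0 sqr_ge0.
  rewrite lef_pV2 ?posrE ?exprn_gt0 // (exprD _ 2 2) ler_piMl ?sqr_ge0 //.
  by rewrite exprn_ile1 ?(ltW e0).
have split2 (U1 U2 : pred {set 'I_n * 'I_n}) x1 x2 : graph_prob p U1 <= x1 ->
    graph_prob p U2 <= x2 -> graph_prob p (predU U1 U2) <= x1 + x2.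
  by move=> h1 h2; apply: le_trans (graph_probU p01 U1 U2) _; apply: lerD.
have {}P11 := le_trans (P1 (fun=> 1) _) Nq; have {}P12 := le_trans (P1 (fun=> -1) _) Nq.
apply: (le_trans (split2 _ _ _ _ (P11 _) (split2 _ _ _ _ (P12 _) (split2 _ _ _ _
  (le_trans P13 Nq) (split2 _ _ _ _ (le_trans P4 Q4) (split2 _ _ _ _ (le_trans P5 Q5)
  (le_trans P6 Q6))))))); try by move=> f; rewrite ?normrN normr1.
by rewrite le_eqVlt; apply/orP; left; apply/eqP; rewrite -/q; ring.
Qed.

End FixedSize.

(** * Letting the order tend to infinity *)

Local Open Scope classical_set_scope.

(** Diagonal extraction: [eps n] is [1 / (m + 1)] for the largest [m < n] such that the
    bound for [1 / (m + 1)] holds from [n] on. *)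
Lemma diagonal_rate (R : realType) (P : nat -> R -> R) :
  (forall e, 0 < e <= 1 -> \forall n \near \oo, 1 - e <= P n e) ->
  exists2 eps : nat -> R, eps n @[n --> \oo] --> 0 &
    \forall n \near \oo, 1 - eps n <= P n (eps n).
Proof.
move=> hP; pose e m : R := m.+1%:R^-1.
have e0 m : 0 < e m by rewrite invr_gt0.
have e1 m : e m <= 1 by rewrite invf_le1 // ler1n.
pose good m n := `[< forall n', (n <= n')%N -> 1 - e m <= P n' (e m) >].
have ex_good m : exists n, good m n.
  have [|n _ hn] := hP (e m); first by rewrite e0 e1.
  by exists n; apply/asboolP => n' nn'; apply: hn.
have good_mono m n n' : (n <= n')%N -> good m n -> good m n'.
  by move=> nn' /asboolP g; apply/asboolP => k kn'; apply: g; apply: leq_trans kn'.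
pose M n := (\max_(m < n | good m n) m)%N.
have M_ge m : \forall n \near \oo, (m <= M n)%N /\ good (M n) n.
  have [k gk] := ex_good m.
  exists (maxn k m.+1) => // n /=; rewrite geq_max => /andP[kn mn].
  have gn := good_mono _ _ _ kn gk.
  split; first exact: (leq_bigmax_cond (Ordinal mn) gn).
  have [|j gj eM] := @eq_bigmax_cond 'I_n (fun j => good j n) val.
    by apply/card_gt0P; exists (Ordinal mn).
  by rewrite /M eM.
exists (fun n => e (M n)); last first.
  by apply: filterS (M_ge 0%N) => n [_ /asboolP]; apply.
apply/cvgrPdist_le => r r0; apply: filterS (M_ge (Num.truncn r^-1)) => n [mM _].
rewrite sub0r normrN ger0_norm ?(ltW (e0 _)) //.
rewrite -[leRHS]invrK lef_pV2 ?posrE ?invr_gt0 //.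
have ri : 0 <= r^-1 by rewrite invr_ge0 ltW.
have /andP[_ /ltW rt] := truncn_itv ri.
by apply: le_trans rt _; rewrite ler_nat.
Qed.

(** For fixed [e], the assumption on the minimum degree makes [laplacian_failure_prob]
    applicable with a constant [B] as large as desired, once [n] is large; then
    [diagonal_rate] lets [e] tend to [0]. *)
Theorem theorem2 (R : realType) (p : forall n : nat, 'M[R]_n) (g : nat -> R)
    (p_01 : forall (n : nat) (i j : 'I_n), 0 <= p n i j <= 1)
    (p_sym : forall (n : nat) (i j : 'I_n), p n i j = p n j i)
    (g_infty : g n @[n --> \oo] --> +oo) :
  let delta n := min_degree (p n) in
  let Lbar n := laplacian (p n) in
  let Lambda n := far_eigvals (Lbar n) (1 / (g n * Num.sqrt (ln n%:R))) in
  let k n := size (Lambda n) in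
  delta n / Num.max (k n)%:R (ln n%:R ^+ 4) @[n --> \oo] --> +oo ->
  exists2 eps : nat -> R, eps n @[n --> \oo] --> 0 &
    graph_prob (p n) (fun E : {set 'I_n * 'I_n} =>
      [forall i : 'I_n,
        `|lambda (laplacian (adjacency R E)) i - lambda (Lbar n) i|
         <= (2 + Num.sqrt (\sum_(x <- Lambda n) (1 - x) ^+ 2) + eps n)
            / Num.sqrt (delta n)])
    @[n --> \oo] --> (1 : R).
Proof.
move=> delta Lbar Lambda k delta_infty.
pose P n (e : R) := graph_prob (p n) (fun E : {set 'I_n * 'I_n} =>
  [forall i : 'I_n, `|lambda (laplacian (adjacency R E)) i - lambda (Lbar n) i|
    <= (2 + Num.sqrt (\sum_(x <- Lambda n) (1 - x) ^+ 2) + e) / Num.sqrt (delta n)]).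
suff hP e : 0 < e <= 1 -> \forall n \near \oo, 1 - e <= P n e.
  have [eps eps0 hn] := diagonal_rate hP; exists eps => //.
  apply: (@squeeze_cvgr _ _ _ _ (fun n => 1 - eps n) (fun=> 1)).
  - near=> n; rewrite (near hn n) //=; exact: graph_prob_le1 (p_01 n) _.
  - by rewrite -[X in _ --> X]subr0; apply: cvgB => //; apply: cvg_cst.
  - exact: cvg_cst.
move=> /andP[e_gt0 e_le1].
(* The constants [63] and [93] are those of [laplacian_failure_prob]. *)
pose e' := e / 63; pose B := Num.max ((320 / e' ^+ 3) ^+ 4) (93 / (e' ^+ 4 * e)).
have e'0 : 0 < e' by rewrite divr_gt0.
have B2 : 93 / (e' ^+ 4 * e) <= B by rewrite le_max lexx orbT.
have ee0 : 0 < e' ^+ 4 * e by rewrite mulr_gt0 // exprn_gt0.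
have B0 : 0 < B by apply: lt_le_trans B2; rewrite divr_gt0.
near=> n.
have n0 : (0 < n)%N by near: n; exists 1%N.
have L1 : 1 <= ln n%:R :> R.
  have : expR 1 <= n%:R :> R.
    by near: n; move: (expR 1); apply/cvgryPge/cvgr_idn.
  by move=> h; rewrite -[leLHS]expRK ler_ln ?posrE ?expR_gt0 ?ltr0n.
have g8 : 8 / e' <= g n by near: n; move: (8 / e'); apply/cvgryPge.
have Bd : B <= delta n / Num.max (k n)%:R (ln n%:R ^+ 4).
  by near: n; move: (B); apply/cvgryPge.
have g0 : 0 < g n by apply: lt_le_trans g8; rewrite divr_gt0.
have sL0 : 0 < Num.sqrt (ln n%:R) :> R by rewrite sqrtr_gt0 (lt_le_trans ltr01).
have m0 : 0 < Num.max (k n)%:R (ln n%:R ^+ 4) :> R.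
  by rewrite lt_max exprn_gt0 ?orbT // (lt_le_trans ltr01).
rewrite ler_pdivlMr // in Bd.
have Bk : B * (k n)%:R <= delta n.
  by apply: le_trans Bd; rewrite ler_wpM2l ?(ltW B0) // le_max lexx.
have BL : B * ln n%:R ^+ 4 <= delta n.
  by apply: le_trans Bd; rewrite ler_wpM2l ?(ltW B0) // le_max lexx orbT.
have c0 : 0 <= 1 / (g n * Num.sqrt (ln n%:R)) 
  by rewrite divr_ge0 // mulr_ge0 ?(ltW g0) ?(ltW sL0).
have cL : 8 * (1 / (g n * Num.sqrt (ln n%:R))) * Num.sqrt (ln n%:R) <= e'.
  rewrite (_ : 8 * _ * _ = 8 / g n); last by field; rewrite !gt_eqF.
  by rewrite ler_pdivrMr // mulrC -ler_pdivrMr.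
have e'01 : 0 < e' <= 1 by rewrite e'0 /= /e'; lra.
have B1 : (320 / e' ^+ 3) ^+ 4 <= B by rewrite le_max lexx.
have := laplacian_failure_prob (Ordinal n0) (p_01 n) (p_sym n) e'01 B1 L1 BL Bk c0 cL.
rewrite graph_probC (_ : 63 * e' = e); last by rewrite /e'; field.
rewrite -/(P n e) lerBlDr -lerBlDl.
apply: le_trans; rewrite lerD2l lerN2.
have q0 : 0 < e' ^+ 4 * B by apply: mulr_gt0 => //; apply: exprn_gt0.
rewrite ler_pdivrMr // in B2; rewrite ler_pdivrMr //.
by rewrite (_ : e * _ = B * (e' ^+ 4 * e)) //; ring.
Unshelve. all: end_near. Qed.
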